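(* Let $m\ge 1$ be an integer and $p>1$. Let $f\in C^0([0,\infty))$ be strictly increasing on $[0,\infty)$ with $f>0$ on $(0,\infty)$. Let $h\in C^0((0,\infty))$ be non-negative and monotone non-increasing, with $h\in L^1((0,\infty))$. Let $g\in C^0([0,\infty))$ be non-negative and suppose that, with $\varphi(t)=t^{p-1}$, for some constant $\widetilde D>0$ $$g(st)\le\widetilde D\,s\,t^2\varphi'(t)=\widetilde D\,(p-1)\,s\,t^{p}\qquad\forall\,s\in[0,1],\ t\in(0,\infty).$$ Set $K(t)=\int_0^t s\varphi'(s)\,ds=(p-1)\int_0^t s^{p-1}\,ds$ and $F(t)=\int_0^t f(s)\,ds$ for $t\ge 0$. Then the following conditions are equivalent: (i) there exists a non-negative, non-constant weak solution $u\in C^1(H^m)$ of the inequality $\Delta^p_{H^m}u\ge f(u)-h(u)\,g(|\nabla_{H^m}u|_{H^m})$ on $H^m$; (ii) $\displaystyle\frac{1}{K^{-1}(F(t))}\notin L^1(+\infty)$.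
   Context: $H^m$ is the Heisenberg group: the manifold $\mathbb{R}^{2m+1}$ with points $q=(z,t)=(x_1,\dots,x_m,y_1,\dots,y_m,t)$ and group law $q\circ q'=\left(z+z',\,t+t'+2\sum_{i=1}^m (y_ix_i'-x_iy_i')\right)$. Its horizontal left-invariant vector fields are $X_j=\frac{\partial}{\partial x_j}+2y_j\frac{\partial}{\partial t}$, $Y_j=\frac{\partial}{\partial y_j}-2x_j\frac{\partial}{\partial t}$, $j=1,\dots,m$. For $C^1$ functions $u,v$: $\nabla_{H^m}u=\sum_j (X_ju)X_j+(Y_ju)Y_j$, $\nabla_{H^m}u\cdot\nabla_{H^m}v=\sum_j (X_ju)(X_jv)+(Y_ju)(Y_jv)$, and $|\nabla_{H^m}u|_{H^m}^2=\nabla_{H^m}u\cdot\nabla_{H^m}u$. The $p$-Laplacian is $\Delta^p_{H^m}u=\sum_j\left[X_j\left(|\nabla_{H^m}u|_{H^m}^{p-2}X_ju\right)+Y_j\left(|\nabla_{H^m}u|_{H^m}^{p-2}Y_ju\right)\right]$. The differential inequality is understood weakly: $u\in C^1(H^m)$ and, for all $\zeta\in C_0^\infty(H^m)$ with $\zeta\ge 0$, $$-\int_{\mathbb{R}^{2m+1}}|\nabla_{H^m}u|_{H^m}^{p-2}\,\nabla_{H^m}u\cdot\nabla_{H^m}\zeta\ \ge\ \int_{\mathbb{R}^{2m+1}}\left[f(u)-h(u)\,g(|\nabla_{H^m}u|_{H^m})\right]\zeta$$ (Lebesgue measure; the integrand on the left is $0$ where $\nabla_{H^m}u=0$). At points where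 $u=0$ one has $\nabla_{H^m}u=0$, while $g(0)=0$ by the bound on $g$; there the product $h(u)g(|\nabla_{H^m}u|_{H^m})$ is taken to be $0$. $L^1(+\infty)$ means integrable in a neighbourhood of $+\infty$. $K^{-1}$ is the inverse of the increasing bijection $K$ of $[0,\infty)$. *)

(* Defs.v *)
From HB Require Import structures.
From mathcomp Require Import all_boot all_order all_algebra.
From mathcomp Require Import all_classical all_reals all_analysis.

Set Implicit Arguments.
Unset Strict Implicit.
Unset Printing Implicit Defensive.

Import Order.TTheory GRing.Theory Num.Theory.
Import numFieldNormedType.Exports.

Local Open Scope classical_set_scope.
Local Open Scope ring_scope.

(* Lebesgue measure on R^n, carried by n.-tuple R because the library equips
   tuples (but not row vectors) with the product sigma-algebra.  It is the
   image of the product measure on R * R^(n-1) under (x, w) |-> x :: w;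
   lebesgue_tuple_box computes it on boxes. *)
Section lebesgue_tuple.
Context {R : realType}.

Definition tuple_cons n (xw : R * n.-tuple R) : n.+1.-tuple R :=
  [tuple of xw.1 :: xw.2].

Lemma measurable_tuple_cons n : measurable_fun setT (@tuple_cons n).
Proof. exact: measurable_cons. Qed.

Definition tuple_uncons n (w : n.+1.-tuple R) : R * n.-tuple R :=
  (thead w, [tuple of behead w]).

Lemma measurable_tuple_uncons n : measurable_fun setT (@tuple_uncons n).
Proof.
apply: measurable_fun_pair; [exact: measurable_tnth|exact: measurable_behead].
Qed.

Lemma tuple_consK n : cancel (@tuple_cons n) (@tuple_uncons n).
Proof. by case=> x w; congr pair; apply: val_inj. Qed.

Fixpoint lebesgue_tuple n : set (n.-tuple R) -> \bar R :=
  match n with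
  | 0 => \d_([tuple] : 0.-tuple R)
  | n'.+1 => pushforward (lebesgue_measure \x lebesgue_tuple (n:=n'))%E
               (@tuple_cons n')
  end.

Section lebesgue_cons.
Variables (n : nat) (mu : {sigma_finite_measure set (n.-tuple R) -> \bar R}).

Definition lebesgue_cons : set (n.+1.-tuple R) -> \bar R :=
  pushforward (lebesgue_measure \x mu)%E (@tuple_cons n).

Let nu : {measure set (n.+1.-tuple R) -> \bar R} :=
  measure_function_pushforward__canonical__measure_function_Measure
    (lebesgue_measure \x mu)%E (@measurable_tuple_cons n).

HB.instance Definition _ := isMeasure.Build _ _ _ lebesgue_cons
  (measure0 nu) (@measure_ge0 _ _ _ nu) (@measure_semi_sigma_additive _ _ _ nu).

Let lebesgue_cons_sigma_finite : sigma_finite setT lebesgue_cons.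
Proof.
have /sigma_finiteP[F [FT ndF Foo]] := sigma_finiteT (@lebesgue_measure R).
have /sigma_finiteP[G [GT ndG Goo]] := sigma_finiteT mu.
exists (fun i => @tuple_uncons n @^-1` (F i `*` G i)).
  rewrite -preimage_bigcup -[RHS]/(preimage _ _) (_ : \bigcup_i _ = setT).
    by rewrite preimage_setT.
  apply/seteqP; split => // -[x w] _.
  have [i _ Fix] : (\bigcup_i F i) x by rewrite -FT.
  have [j _ Gjw] : (\bigcup_i G i) w by rewrite -GT.
  exists (maxn i j) => //; split => /=.
    by move: x Fix; exact/subsetPset/ndF/leq_maxl.
  by move: w Gjw; exact/subsetPset/ndG/leq_maxr.
move=> i; have [mF Fi] := Foo i; have [mG Gi] := Goo i; split.
  rewrite -[X in measurable X]setTI; apply: measurable_tuple_uncons => //.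
  exact: measurableX.
suff FE : @tuple_cons n @^-1` (@tuple_uncons n @^-1` (F i `*` G i)) =
    F i `*` G i.
  rewrite /lebesgue_cons /pushforward FE product_measure1E// lte_mul_pinfty//.
  by rewrite ge0_fin_numE.
by apply/seteqP; split => xw; rewrite /preimage /mkset tuple_consK.
Qed.

HB.instance Definition _ := Measure_isSigmaFinite.Build _ _ _
  lebesgue_cons lebesgue_cons_sigma_finite.

End lebesgue_cons.

Lemma lebesgue_tuple_measure n :
  exists mu : {sigma_finite_measure set (n.-tuple R) -> \bar R},
    @lebesgue_tuple n = mu.
Proof.
elim: n => [|n [mu mu_eq]]; first by exists \d_([tuple] : 0.-tuple R).
by exists (lebesgue_cons mu); rewrite /= mu_eq.
Qed.

Section instances.
Variable n : nat.

Let lebesgue_tuple0 : @lebesgue_tuple n set0 = 0.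
Proof. by have [mu ->] := lebesgue_tuple_measure n; rewrite measure0. Qed.

Let lebesgue_tuple_ge0 A : (0 <= @lebesgue_tuple n A)%E.
Proof. by have [mu ->] := lebesgue_tuple_measure n; rewrite measure_ge0. Qed.

Let lebesgue_tuple_semi_sigma_additive :
  semi_sigma_additive (@lebesgue_tuple n).
Proof.
have [mu ->] := lebesgue_tuple_measure n.
exact: measure_semi_sigma_additive.
Qed.

HB.instance Definition _ := isMeasure.Build _ _ _ (@lebesgue_tuple n)
  lebesgue_tuple0 lebesgue_tuple_ge0 lebesgue_tuple_semi_sigma_additive.

Let sigma_finite_lebesgue_tuple : sigma_finite setT (@lebesgue_tuple n).
Proof.
have [mu ->] := lebesgue_tuple_measure n; exact: sigma_finiteT.
Qed.

HB.instance Definition _ := Measure_isSigmaFinite.Build _ _ _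
  (@lebesgue_tuple n) sigma_finite_lebesgue_tuple.

End instances.

Lemma lebesgue_tuple_box n (A : 'I_n -> set R) :
  (forall i, measurable (A i)) ->
  lebesgue_tuple [set w : n.-tuple R | forall i, A i (tnth w i)] =
  (\prod_(i < n) lebesgue_measure (A i))%E.
Proof.
elim: n A => [|n IH] A mA.
  rewrite big_ord0 /= diracE mem_set// => -[]//.
pose B := [set w : n.-tuple R | forall i, A (lift ord0 i) (tnth w i)].
have mB : measurable B.
  rewrite [X in measurable X](_ : _ =
      \bigcap_(i in [set: 'I_n]) ((fun w => tnth w i) @^-1` A (lift ord0 i))).
    apply: fin_bigcap_measurable => // i _.
    by rewrite -[X in measurable X]setTI; exact: measurable_tnth.
  by apply/seteqP; split=> w /= wA i; [move=> _; exact: wA|exact: wA i I].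
have AB : @tuple_cons n @^-1` [set w | forall i, A i (tnth w i)] =
    A ord0 `*` B.
  apply/seteqP; split => -[x w] /=.
    move=> xwA; split; first exact: (xwA ord0).
    by move=> i; have := xwA (lift ord0 i); rewrite tnthS.
  move=> [Ax wA] i; have [->//|i0] := eqVneq i ord0.
  have [j ->] : exists j, i = lift ord0 j.
    by case: (unliftP ord0 i) i0 => [j ->|->]; [exists j|rewrite eqxx].
  by rewrite tnthS; exact: wA.
rewrite big_ord_recl -IH// -/B.
rewrite -(product_measure1E lebesgue_measure (@lebesgue_tuple n) (mA ord0) mB).
by rewrite -AB.
Qed.

End lebesgue_tuple.

Section function_spaces.
Context {R : realType} {n : nat}.

Fixpoint class_C (k : nat) (u : 'rV[R]_n -> R) : Prop :=
  match k with
  | 0 => continuous u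
  | k'.+1 => (forall q : 'rV[R]_n, differentiable u q) /\
    forall v : 'rV[R]_n, class_C k' ('D_v u)
  end.

Definition compactly_supported (u : 'rV[R]_n -> R) : Prop :=
  compact (closure [set q | u q != 0]).

Definition test_function (zeta : 'rV[R]_n -> R) : Prop :=
  (forall k, class_C k zeta) /\ compactly_supported zeta.

(* Extended-real-valued: the integral of the positive part minus that of the
   negative part. *)
Definition integral_Rn (F : 'rV[R]_n -> R) : \bar R :=
  (\int[@lebesgue_tuple R n]_w (F (\row_i tnth w i))%:E)%E.

End function_spaces.

Section heisenberg.
Context {R : realType} {m : nat}.

(* Points are row vectors (x_1, ..., x_m, y_1, ..., y_m, t). *)
Definition heis := 'rV[R]_(m + m + 1).

Definition ix (j : 'I_m) : 'I_(m + m + 1) := lshift 1 (lshift m j).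
Definition iy (j : 'I_m) : 'I_(m + m + 1) := lshift 1 (rshift m j).
Definition it : 'I_(m + m + 1) := rshift (m + m) ord0.

Definition partial (i : 'I_(m + m + 1)) (u : heis -> R) : heis -> R :=
  'D_(delta_mx ord0 i) u.

Definition hX (j : 'I_m) (u : heis -> R) (q : heis) : R :=
  partial (ix j) u q + 2 * q ord0 (iy j) * partial it u q.

Definition hY (j : 'I_m) (u : heis -> R) (q : heis) : R :=
  partial (iy j) u q - 2 * q ord0 (ix j) * partial it u q.

Definition hgrad_dot (u v : heis -> R) (q : heis) : R :=
  \sum_(j < m) (hX j u q * hX j v q + hY j u q * hY j v q).

Definition hgrad_norm (u : heis -> R) (q : heis) : R :=
  Num.sqrt (hgrad_dot u u q).

(* Two conventions hold automatically.  Where hgrad_norm u q = 0, the factor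
   hgrad_dot u zeta q vanishes, hence so does the integrand on the right,
   whatever 0 `^ (p - 2) is.  Where u q = 0 for some u >= 0, hgrad_norm u q = 0
   and, if g 0 = 0, the product with g vanishes whatever h 0 is.  The integral
   on the left is well defined in [-oo, +oo[ when f, g, h are non-negative. *)
Definition weak_solution (p : R) (f h g : R -> R) (u : heis -> R) : Prop :=
  class_C 1 u /\
  forall zeta : heis -> R, test_function zeta -> (forall q, 0 <= zeta q) ->
    (integral_Rn
       (fun q => (f (u q) - h (u q) * g (hgrad_norm u q)) * zeta q)%R
     <= - integral_Rn
            (fun q => hgrad_norm u q `^ (p - 2) * hgrad_dot u zeta q)%R)%E.

End heisenberg.
Arguments heis : clear implicits.

Section keller_osserman.
Context {R : realType}.

Definition phi (p t : R) : R := t `^ (p - 1).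

Definition KO_K (p t : R) : R :=
  \int[lebesgue_measure]_(s in `[0, t]) (s * derive1 (phi p) s).

Definition KO_Kinv (p : R) : R -> R := 'pinv_(fun=> 0) `[0, +oo[ (KO_K p).

Definition primitive0 (f : R -> R) (t : R) : R :=
  \int[lebesgue_measure]_(s in `[0, t]) f s.

Definition L1_at_pinfty (k : R -> R) : Prop :=
  exists a : R, lebesgue_measure.-integrable `[a, +oo[ (EFin \o k).

End keller_osserman.

(* Main.v *)
Require Import Defs.
From HB Require Import structures.
From mathcomp Require Import all_boot all_order all_algebra.
From mathcomp Require Import all_classical all_reals all_analysis.
From mathcomp Require Import measurable_realfun.
From mathcomp Require Import ring lra.

Set Implicit Arguments.
Unset Strict Implicit.
Unset Printing Implicit Defensive.

Import Order.TTheory GRing.Theory Num.Theory.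
Import numFieldNormedType.Exports.

Local Open Scope classical_set_scope.
Local Open Scope ring_scope.

(* Write the Keller-Osserman profile problem as (|a'|^(p-2) a')' = f(a).  If the
   integral in (ii) diverges, it has a positive increasing solution a on the whole
   line, and u(q) = a(x_1) solves the inequality because h g >= 0.

   Suppose the integral converges and u is a solution with u(q0) > 0; put
   a = u(q0) / 2.  The change of unknown v = psi(u), psi' = exp(H - sup H), H' = D h,
   absorbs the gradient term on {u >= a}, and psi' stays bounded below since h is
   integrable: there Delta^p v >= sigma f(v).  The convergent integral lets a profile
   alpha with right-hand side g <= f climb from a to any height before a time T that
   does not depend on the height.  With rho = |z|^4 + t^2 and L large,
   w = alpha((rho / L - 1)^+) satisfies Delta^p w <= sigma g(w); moreover w(q0) = a
   and w exceeds v before rho reaches L (1 + T).  Testing the difference of the two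
   inequalities with ((v - w)^+)^2 and using that the p-Laplacian and f are monotone
   gives v <= w, which contradicts v(q0) > a.

   The weak inequality is assumed for smooth test functions only.  It extends to C^1
   ones because quasi-interpolation by a smooth spline approximates them together
   with their first derivatives, boundedly and pointwise. *)

(** * Calculus on the line *)

(** The p-Laplacian degenerates where a profile starts and where the horizontal gradient of rho
    vanishes. Hence the profile is solved for the momentum b = |a'|^(p-2) a', whose derivative f(a)
    stays positive there, rather than for a. The flux of the barrier need not be C^1 at such points;
    it is replaced by C^1 fields whose divergence is bounded uniformly in the regularisation. The
    order of the choices is forced. The barrier must exceed v on the set rho <= L (1 + T); the size
    of v there depends on L, and L depends on T. So T has to be fixed before the height of the
    profile is known. A large L pays for every constant because rho has degree 4 under the dilations
    (z, t) -> (s z, s^2 t): the p-Laplacian of a function of rho / L is of order L^(-p/4). The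
    square of the positive part makes the test function C^1. Since u may vanish at points where h is
    singular, the tests that meet u live in {u >= a}. *)

Section real_derivatives.
Context {R : realType} {V : normedModType R}.
Implicit Types (f g : V -> R) (x v : V) (a b c : R).

Lemma isd_derivable f x v a : is_derive x v f a -> derivable f x v.
Proof. by case. Qed.

Lemma isd_cst c x v : is_derive x v (fun=> c : R) 0.
Proof. exact: is_derive_cst. Qed.

Lemma isd_add f g x v a b : is_derive x v f a -> is_derive x v g b ->
  is_derive x v (fun y => f y + g y) (a + b).
Proof. exact: is_deriveD. Qed.

Lemma isd_sub f g x v a b : is_derive x v f a -> is_derive x v g b ->
  is_derive x v (fun y => f y - g y) (a - b).
Proof. exact: is_deriveB. Qed.

Lemma isd_opp f x v a : is_derive x v f a -> is_derive x v (fun y => - f y) (- a).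
Proof. exact: is_deriveN. Qed.

Lemma isd_mul f g x v a b : is_derive x v f a -> is_derive x v g b ->
  is_derive x v (fun y => f y * g y) (f x * b + a * g x).
Proof. by rewrite (mulrC a); exact: is_deriveM. Qed.

Lemma isd_scale c f x v a : is_derive x v f a ->
  is_derive x v (fun y => c * f y) (c * a).
Proof. exact: is_deriveZ. Qed.

Lemma isd_exp n f x v a : is_derive x v f a ->
  is_derive x v (fun y => f y ^+ n) (n%:R * f x ^+ n.-1 * a).
Proof.
have -> : (fun y => f y ^+ n) = f ^+ n.
  by apply/funext => y; rewrite exprfctE.
exact: is_deriveX.
Qed.

(** Only a directional derivative of [f] is at hand, so the one-variable chain rule is applied to
    the restriction [h |-> f (h *: v + x)] at 0. *)
Lemma isd_comp (phi : R -> R) f x v a b : is_derive (f x) (1 : R) phi a ->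
  is_derive x v f b -> is_derive x v (fun y => phi (f y)) (a * b).
Proof.
move=> dphi df.
have E : f x = f (0 *: v + x) by rewrite scale0r add0r.
have [df0 Ef] := df.
have D : is_derive (0 : R) (1 : R) (fun h : R => f (h *: v + x)) b.
  split; first exact: (iffLR (derivable1P f x v) df0).
  rewrite -Ef /derive; set g1 := (fun h => h^-1 *: _); set g2 := (fun h => h^-1 *: _).
  suff -> : g1 = g2 by [].
  apply/funext => h; rewrite /g1 /g2 /= addr0 scale0r add0r.
  by rewrite [_%:A]mulr1.
rewrite E in dphi.
have [dc Ec] := is_derive1_comp dphi D.
split; first exact: (iffRL (derivable1P (fun y => phi (f y)) x v) dc).
rewrite -Ec /derive; set g1 := (fun h => h^-1 *: _); set g2 := (fun h => h^-1 *: _).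
suff -> : g1 = g2 by [].
apply/funext => h; rewrite /g1 /g2 /= addr0 scale0r add0r.
by rewrite [_%:A]mulr1.
Qed.

Lemma isd_line (F : V -> R) x v (s d : R) : is_derive (x + s *: v) v F d ->
  is_derive s (1 : R) (fun s => F (x + s *: v)) d.
Proof.
move=> dF.
have E : (fun h : R => h^-1 *: (((fun s => F (x + s *: v)) \o shift s) (h *: 1) -
    F (x + s *: v))) =
  (fun h : R => h^-1 *: ((F \o shift (x + s *: v)) (h *: v) - F (x + s *: v))).
  apply/funext => h /=; rewrite [_%:A]mulr1 scalerDl addrCA.
  by congr (_ *: (F _ - _)).
have [d1 d2] := dF; split.
  by move: d1; rewrite /derivable -E.
by move: d2; rewrite /derive -E.
Qed.

End real_derivatives.

Section real_functions.
Context {R : realType}.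
Implicit Types (f g F G P : R -> R) (x y a b d : R).
Local Notation mu := (@lebesgue_measure R).

Lemma is_derive1_continuous f x d : is_derive x 1 f d -> {for x, continuous f}.
Proof.
by move=> df; apply/differentiable_continuous/derivable1_diffP/ex_derive.
Qed.

Lemma continuous_integrable_itv f a b : continuous f ->
  mu.-integrable `[a, b] (EFin \o f).
Proof.
move=> cf; apply: continuous_compact_integrable; first exact: segment_compact.
exact: continuous_subspaceT.
Qed.

Lemma continuous_primitive f : continuous f ->
  exists P : R -> R, P 0 = 0 /\ forall x, is_derive x (1 : R) P (f x).
Proof.
move=> cf; pose P x := \int[mu]_(t in `[0, x]) f t - \int[mu]_(t in `[x, 0]) f t.
exists P; split; first by rewrite /P subrr.
(* The base point lies strictly to the left of [x] and of 0, so the fundamental theorem applies on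
   [a, x + 1], and near [x] one has [P = G - G 0] whatever the sign of the argument. *)
move=> x; pose a := Num.min x 0 - 1.
have ax : a < x by rewrite /a; case: (leP x 0) => ?; lra.
have a0 : a < 0 by rewrite /a; case: (leP x 0) => ?; lra.
pose G y := \int[mu]_(t in `[a, y]) f t.
have [dG G'] : derivable G x 1 /\ derive1 G x = f x.
  apply: (@continuous_FTC1_closed R f a x (x + 1)) => //.
  - by rewrite ltrDl.
  - exact: continuous_integrable_itv.
  - exact: cf.
have nG : \forall y \near x, G y - G 0 = P y; last first.
  apply: (near_eq_is_derive nG).
  have -> : f x = f x - 0 by rewrite subr0.
  apply: is_deriveB; first by apply: DeriveDef => //; rewrite -derive1E.
near=> y.
have ay : a < y by near: y; apply: lt_nbhsr.
rewrite /P /G; have [y0|y0] := leP 0 y.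
  rewrite (@Rintegral_itvB R f (BLeft a) (BRight y) 0)//; first last.
  - by rewrite bnd_simp ltW.
  - exact: continuous_integrable_itv.
  rewrite Rintegral_itv_obnd_cbnd; last first.
    apply: integrableS (continuous_integrable_itv 0 y cf) => //.
    by apply: subset_itvr; rewrite bnd_simp.
  have [->|yN0] := eqVneq y 0; first by rewrite !set_itv1 !Rintegral_set1 subrr.
  rewrite [X in _ = _ - X](_ : _ = 0) ?subr0// set_itv_ge ?Rintegral_set0//.
  by rewrite bnd_simp -ltNge lt_neqAle eq_sym yN0.
rewrite -[LHS]opprB (@Rintegral_itvB R f (BLeft a) (BRight 0) y)//; first last.
- by rewrite bnd_simp ltW.
- by rewrite bnd_simp ltW.
- exact: continuous_integrable_itv.
rewrite Rintegral_itv_obnd_cbnd; last first.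
  apply: integrableS (continuous_integrable_itv y 0 cf) => //.
  by apply: subset_itvr; rewrite bnd_simp.
rewrite [X in _ = X - _](_ : _ = 0) ?sub0r// set_itv_ge ?Rintegral_set0//.
by rewrite bnd_simp -ltNge.
Unshelve. all: by end_near. Qed.

Lemma derive_ge0_le F f a b : a <= b ->
  (forall x, a <= x <= b -> is_derive x 1 F (f x)) ->
  (forall x, a <= x <= b -> 0 <= f x) -> F a <= F b.
Proof.
move=> ab dF f0.
have [||c + /eqP] := @MVT_segment R F f a b ab.
- by move=> x; rewrite in_itv/= => /andP[ax xb]; apply: dF; rewrite !ltW.
- apply/subspace_continuousP => x; rewrite /= in_itv/= => xab.
  by apply: cvg_within_filter; exact: is_derive1_continuous (dF _ xab).
rewrite in_itv/= => cab; rewrite subr_eq => /eqP ->.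
by rewrite lerDr mulr_ge0 ?f0// subr_ge0.
Qed.

(** Inequalities between integrals are handled as inequalities between increments of primitives, for
    which the mean value theorem suffices. *)
Lemma derive_le_sub F G f g a b : a <= b ->
  (forall x, a <= x <= b -> is_derive x 1 F (f x)) ->
  (forall x, a <= x <= b -> is_derive x 1 G (g x)) ->
  (forall x, a <= x <= b -> f x <= g x) -> F b - F a <= G b - G a.
Proof.
move=> ab dF dG fg.
suff : G a - F a <= G b - F b by lra.
apply: (@derive_ge0_le (fun x => G x - F x) (fun x => g x - f x)) => // x xab.
  exact: isd_sub (dG x xab) (dF x xab).
by rewrite subr_ge0 fg.
Qed.

Lemma derive0_cst F f a b : a <= b ->
  (forall x, a <= x <= b -> is_derive x 1 F (f x)) ->
  (forall x, a <= x <= b -> f x = 0) -> F b = F a.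
Proof.
move=> ab dF f0; apply/eqP; rewrite eq_le -[X in X && _]lerN2; apply/andP; split.
  apply: (@derive_ge0_le (fun x => - F x) (fun x => - f x)) => // x xab.
    exact: isd_opp (dF x xab).
  by rewrite f0 ?oppr0.
by apply: derive_ge0_le ab dF _ => x xab; rewrite f0.
Qed.

Lemma derive_gt0_incr F f : (forall x, is_derive x 1 F (f x)) ->
  (forall x, 0 < f x) -> {mono F : x y / x <= y}.
Proof.
move=> dF f0; apply: le_mono => x y xy.
have [|c _ /eqP] := @MVT R F f x y xy (fun x _ => dF x).
  by apply: continuous_subspaceT => z; exact: is_derive1_continuous (dF z).
by rewrite subr_eq => /eqP ->; rewrite ltrDr mulr_gt0// subr_gt0.
Qed.

Lemma continuous_surjective F : continuous F ->
  (forall y, exists2 x, F x <= y & exists x', y <= F x') ->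
  (forall y, exists x, F x = y).
Proof.
move=> cF H y; have [x1 x1y [x2 yx2]] := H y.
have [x12|x21] := leP x1 x2.
  have [|c _ Fc] := @IVT R F x1 x2 y x12 (continuous_subspaceT cF); last by exists c.
  by rewrite ge_min x1y le_max yx2 orbT.
have [|c _ Fc] := @IVT R F x2 x1 y (ltW x21) (continuous_subspaceT cF); last by exists c.
by rewrite ge_min x1y orbT le_max yx2.
Qed.

Lemma inverse_derive F f : continuous f -> (forall x, is_derive x 1 F (f x)) ->
  (forall x, 0 < f x) -> (forall y, exists x, F x = y) ->
  exists S : R -> R, [/\ cancel S F, cancel F S &
    forall y, is_derive y (1 : R) S (f (S y))^-1].
Proof.
move=> cf dF f0 sF.
have [S FS] := choice sF.
have SF : cancel F S.
  by move=> x; apply: (inc_inj (derive_gt0_incr dF f0)); rewrite FS.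
exists S; split => // y; rewrite -{1}(FS y).
apply: is_derive_inverse; last by rewrite gt_eqF.
- by apply: filterE => x; exact: SF.
- by apply: filterE => x; exact: is_derive1_continuous (dF x).
Qed.

Lemma derive_ge0_ndecr F f : (forall x, is_derive x 1 F (f x)) ->
  (forall x, 0 <= f x) -> {homo F : x y / x <= y}.
Proof. by move=> dF f0 x y xy; exact: (derive_ge0_le xy (fun x _ => dF x)). Qed.

Lemma powRVK (r y : R) : 0 < r -> 0 <= y -> (y `^ r^-1) `^ r = y.
Proof. by move=> r0 y0; rewrite -powRrM mulVf ?gt_eqF// powRr1. Qed.

Lemma continuous_normr_powR (r : R) : 0 < r -> continuous (fun x : R => `|x| `^ r).
Proof.
move=> r0 x; have [->|xN0] := eqVneq x 0.
  apply/cvgrPdist_lt => e e0; rewrite normr0 powR0 ?gt_eqF//.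
  near=> y; rewrite sub0r normrN ger0_norm ?powR_ge0//.
  rewrite -[ltRHS](@powRVK r e) ?(ltW e0)//.
  apply: gt0_ltr_powR; rewrite ?nnegrE ?powR_ge0//.
  by near: y; apply: cvgr0_norm_lt => //; rewrite powR_gt0.
apply: (@continuous_comp R R R (fun x : R => `|x|) ((@powR R) ^~ r)).
  exact: norm_continuous.
apply: (@is_derive1_continuous _ _ (r * `|x| `^ (r - 1))).
by apply: is_derive1_powR; rewrite normr_gt0.
Unshelve. all: by end_near. Qed.

Lemma is_derive_normr_powR q x : 1 < q ->
  is_derive x 1 (fun y => `|y| `^ q / q) (Num.sg x * `|x| `^ (q - 1)).
Proof.
move=> q1; have q0 : q != 0 by rewrite gt_eqF// (lt_trans _ q1).
have [x0|x0|->] := ltgtP x 0; last first.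
- rewrite sgr0 mul0r; apply/is_derive1_caratheodory.
  (* This is the difference quotient at 0; it tends to 0 because q > 1. *)
  exists (fun z => Num.sg z * `|z| `^ (q - 1) / q); split.
  + move=> z; rewrite normr0 powR0// mul0r !subr0 -[LHS]mulr1.
    rewrite -(@mulr_powRB1 R `|z| q) ?(lt_trans _ q1)//.
    by set A := _ `^ (q - 1); rewrite normrEsg; ring.
  + apply: cvgMr_tmp.
    rewrite sgr0 mul0r; apply/cvgr0Pnorm_lt => e e0.
    have c0 := @continuous_normr_powR (q - 1) _ 0.
    have /c0/cvgrPdist_lt/(_ e e0) : 0 < q - 1 by rewrite subr_gt0.
    rewrite normr0 powR0 ?gt_eqF ?subr_gt0//.
    apply: filterS => z; rewrite sub0r normrN normrM => /le_lt_trans; apply.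
    by rewrite normr_sg ler_piMl//; case: (z != 0).
  + by rewrite sgr0 mul0r mul0r.
- rewrite gtr0_sg// gtr0_norm// mul1r.
  have : is_derive x 1 (fun y => y `^ q * q^-1) (x `^ (q - 1)).
    apply: is_derive_eq (is_deriveM _ _) _.
      exact: is_derive1_powR.
    by rewrite /= scaler0 add0r scalerA mulVf// scale1r.
  apply: near_eq_is_derive; near=> y; rewrite gtr0_norm//.
  by near: y; exact: lt_nbhsr.
- rewrite ltr0_sg// ltr0_norm// mulN1r.
  have : is_derive x 1 (fun y => (- y) `^ q * q^-1) (- (- x) `^ (q - 1)).
    have D : is_derive x 1 (((@powR R) ^~ q) \o -%R) (q * (- x) `^ (q - 1) * - 1).
      by apply: is_derive1_comp; apply: is_derive1_powR; rewrite oppr_gt0.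
    apply: is_derive_eq (is_deriveM D _) _.
    by rewrite /= scaler0 add0r /GRing.scale/=; field.
  apply: near_eq_is_derive; near=> y; rewrite ltr0_norm//.
  by near: y; exact: lt_nbhsl.
Unshelve. all: by end_near. Qed.

(** * Profiles of the one-dimensional problem by quadrature *)

Section profile.
Variables (f : R -> R) (a c q : R).
Hypotheses (cf : continuous f) (c0 : 0 < c) (fc : forall x, c <= f x).
Hypothesis q1 : 1 < q.

(** Along a solution alpha with momentum b, the first integral is Phi(alpha) = |b|^q / q, so the
    height is S(|b|^q / q) and b' = f(alpha) becomes a scalar autonomous equation. [theta] is the
    time as a function of the momentum. Its derivative is at most 1 / c, whereas the time as a
    function of the height has infinite slope at the start. *)
Lemma profile_time : exists Phi S theta : R -> R,
  [/\ Phi a = 0 /\ (forall x, is_derive x (1 : R) Phi (f x)),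
      cancel S Phi, cancel Phi S, theta 0 = 0
    & forall y, is_derive y (1 : R) theta (f (S (`|y| `^ q / q)))^-1].
Proof.
have f0 x : 0 < f x by exact: lt_le_trans (fc x).
have [P [P0 dP]] := continuous_primitive cf.
pose Phi x := P x - P a.
have dPhi x : is_derive x 1 Phi (f x).
  by apply: is_derive_eq (is_deriveB (dP x) (is_derive_cst _ _ _)) _; rewrite subr0.
have Phia : Phi a = 0 by rewrite /Phi subrr.
(* Since f >= c, Phi outgrows a linear function at both ends; it is therefore onto and [S] is
   defined everywhere. *)
have nd : {homo (fun x => Phi x - c * x) : x y / x <= y}.
  apply: (@derive_ge0_ndecr _ (fun x => f x - c)) => x; last by rewrite subr_ge0.
  apply: is_derive_eq (isd_sub (dPhi x) (isd_scale c (is_derive_id x 1))) _.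
  by rewrite mulr1.
have sPhi y : exists x, Phi x = y.
  apply: continuous_surjective => [x|{}y].
    exact: is_derive1_continuous (dPhi x).
  exists (a - `|y| / c).
    have := nd (a - `|y| / c) a; rewrite Phia gerBl divr_ge0// ?(ltW c0)//.
    move=> /(_ isT); rewrite mulrBr mulrCA mulfV ?gt_eqF// mulr1.
    by have := ler_norm (- y); rewrite normrN; lra.
  exists (a + `|y| / c).
  have := nd a (a + `|y| / c); rewrite Phia lerDl divr_ge0// ?(ltW c0)//.
  move=> /(_ isT); rewrite mulrDr mulrCA mulfV ?gt_eqF// mulr1.
  by have := ler_norm y; lra.
have [S [SK KS dS]] := inverse_derive cf dPhi f0 sPhi.
have cm : continuous (fun y : R => (f (S (`|y| `^ q / q)))^-1).
  move=> y; apply: cvgV; first by rewrite gt_eqF.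
  apply: (@continuous_comp R R R (fun y => S (`|y| `^ q / q)) f); last exact: cf.
  apply: (@continuous_comp R R R (fun y => `|y| `^ q / q) S).
    exact: is_derive1_continuous (is_derive_normr_powR y q1).
  exact: is_derive1_continuous (dS _).
have [theta [theta0 dtheta]] := continuous_primitive cm.
by exists Phi, S, theta.
Qed.

(** The momentum [b] is the inverse of [theta]. The derivative of [theta] is even, so [theta] is
    odd, and being unbounded above makes it onto. In the derivative of the height S(|b|^q / q) the
    factor b' = f cancels the factor 1 / f coming from S. *)
Lemma profile_ode (Phi S theta : R -> R) :
  Phi a = 0 -> (forall x, is_derive x 1 Phi (f x)) -> cancel S Phi ->
  cancel Phi S -> theta 0 = 0 ->
  (forall y, is_derive y 1 theta (f (S (`|y| `^ q / q)))^-1) ->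
  (forall T, exists y, T <= theta y) ->
  exists b : R -> R, [/\ cancel b theta, cancel theta b,
    b 0 = 0 /\ S (`|b 0| `^ q / q) = a,
    (forall x, is_derive x (1 : R) b (f (S (`|b x| `^ q / q))))
  & (forall x, is_derive x (1 : R) (fun x => S (`|b x| `^ q / q))
         (Num.sg (b x) * `|b x| `^ (q - 1)))].
Proof.
move=> Phia dPhi SK KS theta0 dtheta unb.
have f0 x : 0 < f x by exact: lt_le_trans (fc x).
have theta_odd y : theta (- y) = - theta y.
  apply/eqP; rewrite -addr_eq0; apply/eqP.
  have := @is_derive_0_is_cst R (fun y => theta (- y) + theta y) y 0 _.
  rewrite oppr0 theta0 addr0; apply => x.
  have D : is_derive x 1 (theta \o -%R) ((f (S (`|- x| `^ q / q)))^-1 * - 1).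
    exact: is_derive1_comp.
  apply: is_derive_eq (is_deriveD D (dtheta x)) _.
  by rewrite normrN mulrN1 addNr.
have dS y : is_derive y 1 S (f (S y))^-1.
  rewrite -{1}(SK y); apply: is_derive_inverse; last by rewrite gt_eqF.
  - by apply: filterE => x; exact: KS.
  - by apply: filterE => x; exact: is_derive1_continuous (dPhi x).
have dS1 y : is_derive y 1 (fun y => S (`|y| `^ q / q))
    ((f (S (`|y| `^ q / q)))^-1 * (Num.sg y * `|y| `^ (q - 1))).
  apply: (@is_derive1_comp R S (fun y => `|y| `^ q / q)).
  exact: is_derive_normr_powR.
have cm : continuous (fun y : R => (f (S (`|y| `^ q / q)))^-1).
  move=> y; apply: cvgV; first by rewrite gt_eqF.
  apply: (@continuous_comp R R R (fun y => S (`|y| `^ q / q)) f); last exact: cf.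
  exact: is_derive1_continuous (dS1 _).
have m0 x : 0 < (f (S (`|x| `^ q / q)))^-1 by rewrite invr_gt0.
have [|b [bK Kb db]] := inverse_derive cm dtheta m0.
  apply: continuous_surjective => [x|y]; first exact: is_derive1_continuous (dtheta x).
  have [y1 y1E] := unb (- y); have [y2 y2E] := unb y.
  by exists (- y1); [rewrite theta_odd lerNl|exists y2].
have b0 : b 0 = 0 by rewrite -{1}theta0 Kb.
have db' x : is_derive x 1 b (f (S (`|b x| `^ q / q))).
  by have := db x; rewrite invrK.
exists b; split => //.
  split => //; rewrite b0 normr0 powR0; last by rewrite gt_eqF// (lt_trans _ q1).
  by rewrite mul0r -Phia KS.
move=> x; apply: is_derive_eq.
  exact: (@is_derive1_comp R (fun y => S (`|y| `^ q / q)) b).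
by rewrite mulrC mulrA mulfV ?mul1r// gt_eqF.
Qed.

End profile.
End real_functions.

(** * The Keller-Osserman condition and the profiles *)

Section integrals_on_half_lines.
Context {R : realType}.
Implicit Types (f k F J : R -> R) (x y a b d : R).
Local Notation mu := (@lebesgue_measure R).

Lemma integral_itv_primitive k J a b : a < b ->
  {within `[a, b], continuous k} -> {within `[a, b], continuous J} ->
  (forall x, a < x < b -> is_derive x 1 J (k x)) ->
  (\int[mu]_(x in `[a, b]) (k x)%:E = (J b - J a)%:E)%E.
Proof.
move=> ab ck cJ dJ; rewrite (@continuous_FTC2 R k J)//.
- have [_ J1 J2] := (continuous_within_itvP J ab).1 cJ.
  split => // x; rewrite in_itv/= => xab; exact: isd_derivable (dJ x xab).
- by move=> x; rewrite in_itv/= => xab; rewrite derive1E; have [_ ->] := dJ x xab.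
Qed.

(** For a nonnegative integrand the improper integral is the supremum of the increments of a
    primitive. Both the Keller-Osserman condition and the integrability of [h] are used in this
    form. *)
Lemma integrable_pinfty_boundedP k J a : continuous k -> (forall x, 0 <= k x) ->
  (forall x, is_derive x 1 J (k x)) ->
  mu.-integrable `[a, +oo[ (EFin \o k) <-> exists B, forall x, J x <= B.
Proof.
move=> ck k0 dJ.
have cJ : continuous J by move=> x; exact: is_derive1_continuous (dJ x).
have ndJ : {homo J : x y / x <= y} by exact: derive_ge0_ndecr dJ k0.
split=> [ik|[B JB]].
  pose I := fine (\int[mu]_(x in `[a, +oo[) (k x)%:E)%E.
  exists (J a + Num.max I 0) => x; have [xa|ax] := leP x a.
    by rewrite (le_trans (ndJ _ _ xa))// lerDl le_max lexx orbT.
  rewrite -lerBlDl -lee_fin -(@integral_itv_primitive k J)//; last 2 first.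
  - exact: continuous_subspaceT.
  - exact: continuous_subspaceT.
  apply: (@le_trans _ _ I%:E); last by rewrite lee_fin le_max lexx.
  rewrite /I fineK; last exact: integrable_fin_num ik.
  apply: ge0_subset_integral => //.
  - have [] := integrableP _ _ _ ik; done.
  - by move=> ? _; rewrite lee_fin.
  - by apply: subset_itvl; rewrite bnd_simp.
apply/integrableP; split.
  apply/measurable_EFinP; apply: measurable_funTS.
  exact: continuous_measurable_fun.
under eq_integral do rewrite /= ger0_norm//.
rewrite (@ge0_continuous_FTC2y R k J a (sup (range J)))//.
- by rewrite -EFinB ltry.
- exact: continuous_subspaceT.
- apply: nondecreasing_cvgr => //; exists B => _ [x _ <-]; exact: JB.
- by apply: cvg_at_right_filter; exact: cJ.
- by move=> x _; rewrite derive1E; have [_ ->] := dJ x.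
Qed.

End integrals_on_half_lines.

(** * Closed forms of K and of its inverse *)

Section keller_osserman_condition.
Context {R : realType}.
Variables (p : R) (p1 : 1 < p).
Local Notation mu := (@lebesgue_measure R).
Let q := p / (p - 1).

Lemma phi_derive1 (t : R) : 0 < t -> derive1 (phi p) t = (p - 1) * t `^ (p - 2).
Proof.
move=> t0; rewrite /phi derive1E.
have [_ ->] := @is_derive1_powR R (p - 1) t t0.
by congr (_ * _ `^ _); ring.
Qed.

Lemma KO_K_powR (t : R) : 0 <= t -> KO_K p t = t `^ p / q.
Proof.
have p0 : 0 < p := lt_trans ltr01 p1.
have q0 : 0 < q by rewrite divr_gt0// subr_gt0.
rewrite le_eqVlt => /predU1P[<-|t0].
  by rewrite /KO_K set_itv1 Rintegral_set1 powR0 ?mul0r// gt_eqF.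
rewrite /KO_K.
under eq_Rintegral => s.
  rewrite inE/= in_itv/= => /andP[s0 _].
  (* At s = 0 the factor [s] kills whatever value [derive1] takes there; the absolute value makes
     the new integrand continuous on the whole line. *)
  have -> : s * derive1 (phi p) s = (p - 1) * `|s| `^ (p - 1).
    move: s0; rewrite le_eqVlt => /predU1P[<-|s0].
      by rewrite mul0r normr0 powR0 ?mulr0// gt_eqF// subr_gt0.
    rewrite phi_derive1// gtr0_norm// mulrCA.
    have -> : p - 2 = p - 1 - 1 by ring.
    by rewrite mulr_powRB1 ?(ltW s0) ?subr_gt0.
  over.
have dJ (s : R) : is_derive s 1 (fun y : R => (p - 1) * (`|y| `^ p / p))
    ((p - 1) * (Num.sg s * `|s| `^ (p - 1))).
  exact: (isd_scale (p - 1) (is_derive_normr_powR s p1)).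
have cp : continuous (fun s : R => (p - 1) * `|s| `^ (p - 1)).
  move=> s; apply: cvgMl_tmp; apply: continuous_normr_powR.
  by rewrite subr_gt0.
have dJ' (s : R) : 0 < s < t -> is_derive s 1
    (fun y : R => (p - 1) * (`|y| `^ p / p)) ((p - 1) * `|s| `^ (p - 1)).
  by move=> /andP[s0 _]; apply: is_derive_eq (dJ s) _; rewrite gtr0_sg// mul1r.
rewrite /Rintegral (integral_itv_primitive t0 (continuous_subspaceT cp) _ dJ')/=.
  rewrite normr0 powR0 ?gt_eqF// mul0r mulr0 subr0 gtr0_norm// /q.
  by field; rewrite !gt_eqF// subr_gt0.
by apply: continuous_subspaceT => s; exact: is_derive1_continuous (dJ s).
Qed.

(** [KO_K] is injective on the half line by its closed form, so [pinv_] is a true inverse there.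
    Condition (ii) thus concerns the integral of (q F)^(-1/p). *)
Lemma KO_Kinv_powR (y : R) : 0 <= y -> KO_Kinv p y = (q * y) `^ p^-1.
Proof.
have p0 : 0 < p := lt_trans ltr01 p1.
have q0 : 0 < q by rewrite divr_gt0// subr_gt0.
move=> y0.
have Ky : KO_K p ((q * y) `^ p^-1) = y.
  rewrite KO_K_powR ?powR_ge0// powRVK//; last exact: mulr_ge0 (ltW q0) y0.
  by rewrite mulrC mulKf// gt_eqF.
rewrite -{1}Ky /KO_Kinv pinvKV// ?inE/= ?in_itv/= ?powR_ge0//.
move=> s t; rewrite !inE/= !in_itv/= !andbT => s0 t0.
rewrite !KO_K_powR// => /(mulIf _) st; apply: (powR_injective p0); rewrite ?nnegrE//.
by apply: st; rewrite invr_eq0 gt_eqF.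
Qed.

(* The truncation at 0 makes [f] continuous on the whole line without changing
   the integrals over [0, t]. *)
Lemma primitive0_primitive (f F : R -> R) : {within `[0, +oo[, continuous f} ->
  F 0 = 0 -> (forall x : R, is_derive x 1 F (f (Num.max x 0))) ->
  forall t, 0 <= t -> primitive0 f t = F t.
Proof.
move=> cf F0 dF t; rewrite le_eqVlt => /predU1P[<-|t0].
  by rewrite /primitive0 set_itv1 Rintegral_set1 F0.
have dF' (s : R) : 0 < s < t -> is_derive s 1 F (f s).
  by move=> /andP[s0 _]; have := dF s; rewrite (max_idPl _)// ltW.
rewrite /primitive0 /Rintegral (integral_itv_primitive t0 _ _ dF')/=.
- by rewrite F0 subr0.
- apply: continuous_subspaceW cf; apply: subset_itvl; by rewrite bnd_simp.
- by apply: continuous_subspaceT => s; exact: is_derive1_continuous (dF s).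
Qed.

End keller_osserman_condition.

Section truncation.
Context {R : realType}.
Implicit Types (f : R -> R) (a s : R).

Lemma continuous_max_cst a : continuous (fun x : R => Num.max x a).
Proof.
move=> x; apply: (@continuous_max _ R^o id (cst a)); [exact: cvg_id|exact: cvg_cst].
Qed.

(** The data are continuous on half lines only; composing with [s |-> max s a] makes them continuous
    on the line and changes nothing at arguments >= a. *)
Lemma continuous_truncation f a (D : set R) : (forall s, a <= s -> D s) -> 
  {within D, continuous f} -> continuous (fun s => f (Num.max s a)).
Proof.
move=> aD cf s.
have /subspace_continuousP/(_ (Num.max s a)) := cf.
rewrite /= => /(_ (aD _ _)) H.
apply: cvg_comp; last first.
  by apply: H; rewrite le_max lexx orbT.
move=> A [e e0 eA].
have /cvgrPdist_lt/(_ e e0) := @continuous_max_cst a s.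
apply: filterS => z hz; apply: eA => //=.
by apply: aD; rewrite le_max lexx orbT.
Qed.

Lemma continuous_sg_powR (r : R) : 0 < r ->
  continuous (fun y : R => Num.sg y * `|y| `^ r).
Proof.
(* The odd power is the difference of the powers of the positive and negative parts, both of which
   are continuous through 0. *)
move=> r0; have -> : (fun y : R => Num.sg y * `|y| `^ r) =
    (fun y => `|Num.max y 0| `^ r - `|Num.max (- y) 0| `^ r).
  apply/funext => y; have [y0|y0|->] := ltgtP y 0.
  - rewrite ltr0_sg// (@max_l _ _ (- y)) ?oppr_ge0 ?ltW//.
    by rewrite normr0 powR0 ?gt_eqF// normrN mulN1r sub0r.
  - rewrite gtr0_sg// (@max_r _ _ (- y)) ?oppr_le0 ?ltW//.
    by rewrite normr0 powR0 ?gt_eqF// mul1r subr0.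
  - by rewrite sgr0 oppr0 maxxx mul0r subrr.
have cn := continuous_normr_powR r0.
move=> y; apply: cvgB.
  apply: (@continuous_comp R R R (fun y : R => Num.max y 0) (fun y => `|y| `^ r)).
    exact: continuous_max_cst.
  exact: cn.
apply: (@continuous_comp R R R (fun y : R => Num.max (- y) 0) (fun y => `|y| `^ r)).
  apply: (@continuous_comp R R R -%R (fun y : R => Num.max y 0)).
    exact: opp_continuous.
  exact: continuous_max_cst.
exact: cn.
Qed.

End truncation.

Section profile_time_derivative.
Context {R : realType}.
Variables (f Phi S theta : R -> R) (q : R).
Hypotheses (q1 : 1 < q) (f0 : forall x, 0 < f x).
Hypotheses (dPhi : forall x : R, is_derive x 1 Phi (f x)) (KS : cancel Phi S).
Hypothesis dtheta :
  forall y : R, is_derive y 1 theta (f (S (`|y| `^ q / q)))^-1.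

(** This is the time as a function of the height: at height [s] the momentum is (q Phi(s))^(1/q),
    and the factor f in its derivative cancels the one in theta'. Since 1/q - 1 = -1/p, the result
    is the Keller-Osserman integrand with Phi in place of F. *)
Lemma profile_time_derivative (s : R) : 0 < Phi s ->
  is_derive s 1 (fun s : R => theta ((q * Phi s) `^ q^-1))
    ((q * Phi s) `^ (q^-1 - 1)).
Proof.
move=> Phis; have q0 : 0 < q := lt_trans ltr01 q1.
have qPhis : 0 < q * Phi s by rewrite mulr_gt0.
have dpow := @is_derive1_powR R q^-1 (q * Phi s) qPhis.
have dy := @isd_comp R _ _ (fun s => q * Phi s) s 1 _ _ dpow (isd_scale q (dPhi s)).
have dth := @isd_comp R _ theta (fun s => (q * Phi s) `^ q^-1) s 1 _ _ (dtheta _) dy.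
apply: is_derive_eq dth _; rewrite (ger0_norm (powR_ge0 _ _)) powRVK ?(ltW qPhis)//.
rewrite (mulrC q (Phi s)) mulfK ?gt_eqF// KS (mulrC (Phi s)).
by field; rewrite !gt_eqF.
Qed.

End profile_time_derivative.

Section keller_osserman_profiles.
Context {R : realType}.
Implicit Types (s t a b x y : R).
Variables (p : R) (f F : R -> R).
Hypotheses (p1 : 1 < p) (f_cont : {within `[0, +oo[, continuous f})
  (f_incr : {in `[0, +oo[ &, {homo f : s t / s < t}})
  (f_pos : forall t : R, 0 < t -> 0 < f t).
Hypotheses (F0 : F 0 = 0)
  (dF : forall x : R, is_derive x 1 F (f (Num.max x 0))).
Let q := p / (p - 1).

Let p0 : 0 < p := lt_trans ltr01 p1.

Lemma conjugate_gt1 : 1 < q.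
Proof. by rewrite ltr_pdivlMr ?subr_gt0// mul1r ltrBlDr ltrDl. Qed.

Let q1 := conjugate_gt1.
Let q0 : 0 < q := lt_trans ltr01 q1.

Lemma conjugateV : q^-1 - 1 = - p^-1.
Proof. by rewrite /q; field; rewrite !gt_eqF// subr_gt0. Qed.

Lemma source_ndecr s t : 0 <= s -> s <= t -> f s <= f t.
Proof.
move=> s0; rewrite le_eqVlt => /predU1P[->//|st].
by apply/ltW/f_incr; rewrite ?in_itv/= ?andbT// (le_trans s0)// ltW.
Qed.

(** Positivity is given on (0, +oo) only. If f(0) were negative, continuity would make f negative at
    a small positive point. *)
Lemma source_ge0 s : 0 <= f (Num.max s 0).
Proof.
rewrite leNgt; apply/negP => fs0.
have s0 : s <= 0.
  by rewrite leNgt; apply: contraL fs0 => s0; rewrite (max_idPl (ltW s0)) -leNgt ltW// f_pos.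
rewrite (max_idPr s0) in fs0.
have cf : continuous (fun s : R => f (Num.max s 0)).
  by apply: continuous_truncation f_cont => t; rewrite /= in_itv/= andbT.
have e0 : 0 < - f 0 by rewrite oppr_gt0.
have /cvgrPdist_lt/(_ _ e0)[/= d d0 /(_ (d / 2))] := cf 0.
rewrite /ball_/= sub0r normrN gtr0_norm ?divr_gt0// maxxx.
rewrite (max_idPl _) ?divr_ge0 ?(ltW d0)//.
rewrite ltr_pdivrMr// mulr2n mulrDr mulr1 ltrDl => /(_ d0).
have := f_pos (divr_gt0 d0 (ltr0Sn R 1)).
by rewrite ltr_norml => ? /andP[]; lra.
Qed.

Lemma primitive_ndecr : {homo F : s t / s <= t}.
Proof. exact: derive_ge0_ndecr dF source_ge0. Qed.

Lemma primitive_gt0 s : 0 < s -> 0 < F s.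
Proof.
move=> s0; have s20 : 0 < s / 2 by rewrite divr_gt0.
have s2s : s / 2 <= s by lra.
suff : f (s / 2) * (s - s / 2) <= F s - F (s / 2).
  have := primitive_ndecr (ltW s20); rewrite F0 => F20.
  have : 0 < f (s / 2) * (s - s / 2) by rewrite mulr_gt0 ?f_pos//; lra.
  lra.
have [|c] := @MVT_segment R F (fun x : R => f (Num.max x 0)) (s / 2) s s2s.
  by apply: continuous_subspaceT => x; exact: is_derive1_continuous (dF x).
rewrite in_itv/= => /andP[sc _] ->; rewrite ler_wpM2r ?subr_ge0//.
rewrite (max_idPl _) ?(le_trans (ltW s20))//.
exact: source_ndecr (ltW s20) sc.
Qed.

(** For s >= s1 this is 1 / K^{-1}(F(s)). Freezing it below s1 > 0 avoids the zero of F and gives a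
    positive continuous function on the whole line. *)
Definition KO_kernel (s1 s : R) : R := ((q * F (Num.max s s1)) `^ p^-1)^-1.

Lemma KO_kernel_gt0 s1 s : 0 < s1 -> 0 < KO_kernel s1 s.
Proof.
move=> s10; rewrite /KO_kernel invr_gt0 powR_gt0// mulr_gt0// primitive_gt0//.
by rewrite lt_max s10 orbT.
Qed.

Lemma KO_kernel_continuous s1 : 0 < s1 -> continuous (KO_kernel s1).
Proof.
move=> s10 s.
have F1 : 0 < q * F (Num.max s s1).
  by rewrite mulr_gt0// primitive_gt0// lt_max s10 orbT.
apply: cvgV; first by rewrite gt_eqF// powR_gt0.
apply: (@continuous_comp R R R (fun s : R => q * F (Num.max s s1)) ((@powR R) ^~ p^-1)).
  apply: cvgMl_tmp; apply: (@continuous_comp R R R (fun s : R => Num.max s s1) F).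
    exact: continuous_max_cst.
  exact: is_derive1_continuous (dF _).
exact: is_derive1_continuous (is_derive1_powR _ F1).
Qed.

Lemma KO_boundedP (s1 : R) (J : R -> R) : 0 < s1 ->
  (forall s : R, is_derive s 1 J (KO_kernel s1 s)) ->
  L1_at_pinfty (fun t => (KO_Kinv p (primitive0 f t))^-1) <->
  exists B, forall s, J s <= B.
Proof.
move=> s10 dJ.
have kE s : s1 <= s -> (KO_Kinv p (primitive0 f s))^-1 = KO_kernel s1 s.
  move=> s1s; have s0 : 0 < s by exact: lt_le_trans s1s.
  rewrite (primitive0_primitive f_cont F0 dF (ltW s0)) (KO_Kinv_powR p1) ?(ltW (primitive_gt0 s0))//.
  by rewrite /KO_kernel (max_idPl s1s).
have k0 s : 0 <= KO_kernel s1 s by exact/ltW/KO_kernel_gt0.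
split=> [[a ia]|/(integrable_pinfty_boundedP s1 (KO_kernel_continuous s10) k0 dJ) ik].
  apply/(integrable_pinfty_boundedP (Num.max a s1) (KO_kernel_continuous s10) k0 dJ).
  apply: eq_integrable (integrableS _ _ _ ia) => //.
    by move=> s; rewrite inE/= in_itv/= andbT ge_max => /andP[_ ?]; rewrite /= kE.
  by apply: subset_itvr; rewrite bnd_simp le_max lexx.
exists s1; apply: eq_integrable ik => //.
by move=> s; rewrite inE/= in_itv/= andbT => ?; rewrite /= kE.
Qed.

Lemma KO_primitive s1 : 0 < s1 ->
  exists J : R -> R, forall s : R, is_derive s 1 J (KO_kernel s1 s).
Proof.
by move=> /KO_kernel_continuous/continuous_primitive[J [_ dJ]]; exists J.
Qed.

Section time_comparison.
Variables (a s1 s2 : R) (g Phi S theta J : R -> R).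
Hypotheses (a0 : 0 < a) (as1 : a < s1) (s12 : s1 <= s2).
Hypotheses (g0 : forall x : R, 0 < g x)
  (gE : forall s, a <= s <= s2 -> g s = f s).
Hypotheses (Phia : Phi a = 0) (dPhi : forall x : R, is_derive x 1 Phi (g x))
  (KS : cancel Phi S)
  (dtheta : forall y : R, is_derive y 1 theta (g (S (`|y| `^ q / q)))^-1).
Hypothesis dJ : forall s : R, is_derive s 1 J (KO_kernel s1 s).

Lemma profile_primitiveE s : a <= s <= s2 -> Phi s = F s - F a.
Proof.
move=> /andP[as_ ss2]; rewrite -[LHS]subr0 -Phia.
have dFf x : a <= x <= s -> is_derive x 1 F (g x).
  move=> /andP[ax xs]; have := dF x; rewrite (max_idPl _) ?gE ?ax ?(le_trans xs)//.
  exact: le_trans (ltW a0) ax.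
have dP x : a <= x <= s -> is_derive x 1 Phi (g x) by move=> _; exact: dPhi.
by apply/eqP; rewrite eq_le; apply/andP; split; exact: (derive_le_sub as_ _ _ (fun x _ => lexx (g x))).
Qed.

Let Phi_gt0 s : s1 <= s -> 0 < Phi s.
Proof.
by move=> s1s; rewrite -Phia (leW_mono (derive_gt0_incr dPhi g0)) (lt_le_trans as1).
Qed.

Let time s := theta ((q * Phi s) `^ q^-1).

Let dtime s : s1 <= s -> is_derive s 1 time ((q * Phi s) `^ p^-1)^-1.
Proof.
move=> s1s; rewrite -powRN -conjugateV.
exact: (profile_time_derivative q1 g0 dPhi KS dtheta (Phi_gt0 s1s)).
Qed.

Let s1_gt0 : 0 < s1 := lt_trans a0 as1.

(** Phi = F - F(a) is at most F, so the climb takes at least as long as the Keller-Osserman integral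
    between the two heights. *)
Lemma time_ge : J s2 - J s1 <= time s2 - time s1.
Proof.
apply: (derive_le_sub s12 (fun x _ => dJ x)) => x /andP[s1x xs2]; first exact: dtime.
rewrite /KO_kernel (max_idPl s1x) lef_pV2 ?posrE; last 2 first.
- by rewrite powR_gt0// mulr_gt0// primitive_gt0// (lt_le_trans s1_gt0).
- by rewrite powR_gt0// mulr_gt0// Phi_gt0.
apply: ge0_ler_powR; rewrite ?nnegrE ?invr_ge0 ?(ltW p0)//.
- by rewrite mulr_ge0 ?(ltW q0)// ltW// Phi_gt0.
- by rewrite mulr_ge0 ?(ltW q0)// ltW// primitive_gt0// (lt_le_trans s1_gt0).
- rewrite ler_wpM2l ?(ltW q0)// profile_primitiveE ?xs2 ?(le_trans (ltW as1))//.
  by rewrite gerBl ltW// primitive_gt0.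
Qed.

(** For s >= s1 one has F(s) - F(a) >= (1 - F(a) / F(s1)) F(s), because F(s) >= F(s1). Starting at
    s1 > a keeps this factor positive. *)
Lemma time_le : time s2 - time s1 <= ((1 - F a / F s1) `^ p^-1)^-1 * (J s2 - J s1).
Proof.
have Fs1 : 0 < F s1 by exact: primitive_gt0.
have FaFs1 : F a < F s1.
  have := Phi_gt0 (lexx s1).
  by rewrite profile_primitiveE ?s12 ?andbT ?(ltW as1)// subr_gt0.
set rho := 1 - _; have rho0 : 0 < rho by rewrite subr_gt0 ltr_pdivrMr// mul1r.
rewrite mulrBr.
apply: (@derive_le_sub R time (fun s => (rho `^ p^-1)^-1 * J s)
  (fun s => ((q * Phi s) `^ p^-1)^-1)
  (fun s => (rho `^ p^-1)^-1 * KO_kernel s1 s)) => // x /andP[s1x xs2]; first exact: dtime.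
have Fx : F s1 <= F x by exact: primitive_ndecr.
have Fx0 : 0 < F x by exact: lt_le_trans Fx.
have Px : 0 < Phi x by exact: Phi_gt0.
rewrite /KO_kernel (max_idPl s1x) -invfM -powRM ?(ltW rho0)//; last first.
  exact: mulr_ge0 (ltW q0) (ltW Fx0).
have rx : 0 < rho * (q * F x) := mulr_gt0 rho0 (mulr_gt0 q0 Fx0).
have qP : 0 < q * Phi x := mulr_gt0 q0 Px.
rewrite lef_pV2 ?posrE ?powR_gt0//.
apply: ge0_ler_powR; rewrite ?nnegrE ?invr_ge0 ?(ltW p0) ?(ltW rx)//.
  exact: mulr_ge0 (ltW q0) (ltW Px).
rewrite mulrCA ler_wpM2l ?(ltW q0)// profile_primitiveE ?xs2 ?(le_trans (ltW as1))//.
rewrite /rho mulrBl mul1r lerB// mulrAC ler_pdivlMr// ler_wpM2l//.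
exact/ltW/primitive_gt0.
Qed.

End time_comparison.

(** A bounded [theta] would bound the primitive [J] through [time_ge], and the integral in (ii)
    would converge. So [theta] is unbounded and its inverse is defined for all times. *)
Lemma global_profile (a : R) : 0 < a ->
  ~ L1_at_pinfty (fun t => (KO_Kinv p (primitive0 f t))^-1) ->
  exists b alpha : R -> R,
    [/\ b 0 = 0, forall x, a <= alpha x,
      forall x : R, is_derive x 1 b (f (alpha x))
    & forall x : R, is_derive x 1 alpha (Num.sg (b x) * `|b x| `^ (q - 1))].
Proof.
move=> a0 nKO; pose g s := f (Num.max s a).
have ga s : f a <= g s by apply: source_ndecr (ltW a0) _; rewrite le_max lexx orbT.
have fa : 0 < f a by exact: f_pos.
have g0 s : 0 < g s by exact: lt_le_trans (ga s).
have cg : continuous g.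
  apply: continuous_truncation f_cont => s; rewrite /= in_itv/= andbT.
  by apply: le_trans; exact: ltW.
have [Phi [S [theta [[Phia dPhi] SK KS theta0 dtheta]]]] :=
  profile_time a cg fa ga q1.
have s10 : 0 < a + 1 by rewrite addr_gt0.
have [J dJ] := KO_primitive s10.
have ndJ : {homo J : x y / x <= y}.
  by apply: derive_ge0_ndecr dJ _ => s; exact/ltW/KO_kernel_gt0.
have unb T : exists y, T <= theta y.
  apply: contrapT => /forallNP nT; apply: nKO.
  apply/(KO_boundedP s10 dJ).
  exists (Num.max (J (a + 1)) (J (a + 1) + T - theta ((q * Phi (a + 1)) `^ q^-1))) => s.
  rewrite le_max; have [/ndJ -> //|s1s] := leP s (a + 1).
  apply/orP; right.
  have gE t : a <= t <= s -> g t = f t by move=> /andP[? _]; rewrite /g (max_idPl _).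
  have a1 : a < a + 1 by rewrite ltrDl.
  have := time_ge a0 a1 (ltW s1s) g0 gE Phia dPhi KS dtheta dJ.
  have /negP := nT ((q * Phi s) `^ q^-1); rewrite -ltNge; lra.
have [b [bK Kb [b0 al0] db dal]] := profile_ode cg fa ga q1 Phia dPhi SK KS theta0 dtheta unb.
pose alpha x := S (`|b x| `^ q / q).
have alpha_ge x : a <= alpha x.
  rewrite -(derive_gt0_incr dPhi g0) Phia SK divr_ge0 ?powR_ge0// ltW//.
exists b, alpha; split => // x; have := db x.
by rewrite /g (max_idPl _)//; exact: alpha_ge.
Qed.

(** [T] adds up two climbing times. Up to height a + 1, where the momentum is [y1], the time is at
    most y1 / f(a) since theta' <= 1 / f(a). From there on [time_le] and the bound [B] of [J] give
    at most C (B - J(a + 1)), whatever the height. The last 1 makes the estimate strict. *)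
Lemma fast_profile (a : R) : 0 < a ->
  L1_at_pinfty (fun t => (KO_Kinv p (primitive0 f t))^-1) ->
  exists2 T : R, 0 < T & forall M, exists b alpha g : R -> R,
    [/\ [/\ continuous g, {homo g : x y / x <= y}, forall x, 0 < g x &
            forall x, a <= x -> g x <= f x],
      b 0 = 0 /\ alpha 0 = a, forall x, a <= alpha x,
      exists2 x, 0 < x < T & M < alpha x &
      (forall x : R, is_derive x 1 b (g (alpha x))) /\
      (forall x : R, is_derive x 1 alpha (Num.sg (b x) * `|b x| `^ (q - 1)))].
Proof.
move=> a0; have s10 : 0 < a + 1 by rewrite addr_gt0.
have fa : 0 < f a by exact: f_pos.
have a1 : a < a + 1 by rewrite ltrDl.
have [J dJ] := KO_primitive s10.
have ndJ : {homo J : x y / x <= y}.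
  by apply: derive_ge0_ndecr dJ _ => s; exact/ltW/KO_kernel_gt0.
move=> /(KO_boundedP s10 dJ)[B JB].
pose C := ((1 - F a / F (a + 1)) `^ p^-1)^-1.
pose y1 := (q * (F (a + 1) - F a)) `^ q^-1.
have C0 : 0 <= C by rewrite invr_ge0 powR_ge0.
have T0 : 0 < y1 / f a + C * (B - J (a + 1)) + 1.
  have h1 : 0 <= y1 / f a by rewrite divr_ge0 ?powR_ge0// ltW.
  have h2 : 0 <= C * (B - J (a + 1)) by rewrite mulr_ge0// subr_ge0.
  by lra.
exists (y1 / f a + C * (B - J (a + 1)) + 1); first exact: T0.
move=> M.
pose s2 := Num.max M (a + 1) + 1.
have [Ma1 MM] : a + 1 <= Num.max M (a + 1) /\ M <= Num.max M (a + 1).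
  by rewrite !le_max !lexx orbT.
have s12 : a + 1 <= s2 by rewrite /s2; lra.
have as2 : a <= s2 by lra.
have Ms2 : M < s2 by rewrite /s2; lra.
(* Freezing [f] above [s2] keeps theta' >= 1 / f(s2), so the profile exists for all times although
   (ii) fails; the climb up to [s2] > M is unchanged. *)
pose g s := f (Num.min (Num.max s a) s2).
have g_arg s : a <= Num.min (Num.max s a) s2 by rewrite le_min as2 le_max lexx orbT.
have ga s : f a <= g s by apply: source_ndecr (ltW a0) _; exact: g_arg.
have gs2 s : g s <= f s2.
  apply: source_ndecr; first exact: le_trans (ltW a0) _.
  by rewrite ge_min lexx orbT.
have fs2 : 0 < f s2 by rewrite f_pos// (lt_le_trans a0).
have g0 s : 0 < g s by exact: lt_le_trans (ga s).
have gE s : a <= s <= s2 -> g s = f s.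
  by move=> /andP[as_ ss2]; rewrite /g (max_idPl as_) (min_idPl ss2).
have cg : continuous g.
  have cf : continuous (fun s => f (Num.max s a)).
    apply: continuous_truncation f_cont => s; rewrite /= in_itv/= andbT.
    by apply: le_trans; exact: ltW.
  have -> : g = (fun s => f (Num.max s a)) \o (fun s => Num.min s s2).
    by apply/funext => s; rewrite /g /= max_minl (max_idPl as2).
  move=> s; apply: continuous_comp; last exact: cf.
  apply: (@continuous_min _ R^o id (cst s2)); [exact: cvg_id|exact: cvg_cst].
have ndg : {homo g : x y / x <= y}.
  move=> x y xy; apply: source_ndecr; first exact: le_trans (ltW a0) _.
  by rewrite le_min2// le_max2.
have gf x : a <= x -> g x <= f x.
  move=> ax; apply: source_ndecr; first exact: le_trans (ltW a0) _.
  by rewrite (max_idPl ax) ge_min lexx.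
have [Phi [S [theta [[Phia dPhi] SK KS theta0 dtheta]]]] :=
  profile_time a cg fa ga q1.
have Phi1 := profile_primitiveE a0 gE Phia dPhi.
have theta_le y : 0 <= y -> theta y <= y / f a.
  move=> y0; have := @derive_le_sub R theta (fun y => y / f a)
    (fun y => (g (S (`|y| `^ q / q)))^-1) (fun=> 1 / f a) 0 y y0 (fun x _ => dtheta x).
  rewrite theta0 mul0r !subr0; apply => [x _|x _].
    apply: is_derive_eq (isd_mul (is_derive_id x 1) (isd_cst (f a)^-1 x 1)) _.
    by rewrite mulr0 add0r.
  by rewrite div1r lef_pV2 ?posrE.
have theta_ge y : 0 <= y -> y / f s2 <= theta y.
  move=> y0; have := @derive_le_sub R (fun y => y / f s2) theta
    (fun=> 1 / f s2) (fun y => (g (S (`|y| `^ q / q)))^-1) 0 y y0.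
  rewrite theta0 mul0r !subr0; apply => [x _|x _].
  - apply: is_derive_eq (isd_mul (is_derive_id x 1) (isd_cst (f s2)^-1 x 1)) _.
    by rewrite mulr0 add0r.
  - by rewrite div1r lef_pV2 ?posrE.
have unb t : exists y, t <= theta y.
  exists (Num.max t 0 * f s2); have t0 : 0 <= Num.max t 0 by rewrite le_max lexx orbT.
  apply: le_trans (theta_ge _ _); last by rewrite mulr_ge0// ltW.
  by rewrite mulfK ?gt_eqF// le_max lexx.
have [b [bK Kb [b0 al0] db dal]] := profile_ode cg fa ga q1 Phia dPhi SK KS theta0 dtheta unb.
pose alpha x := S (`|b x| `^ q / q).
have alpha_ge x : a <= alpha x.
  by rewrite -(derive_gt0_incr dPhi g0) Phia SK divr_ge0 ?powR_ge0// ltW.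
exists b, alpha, g; split => //.
pose y2 := (q * Phi s2) `^ q^-1.
have Phis2 : 0 < Phi s2.
  by rewrite -Phia (leW_mono (derive_gt0_incr dPhi g0)) (lt_le_trans a1).
have qPhis2 : 0 < q * Phi s2 by rewrite mulr_gt0.
have y20 : 0 < y2 by rewrite powR_gt0.
(* [y2] is the momentum at height [s2], hence [theta y2] is the time at which the profile passes
   [s2]. *)
exists (theta y2); last first.
  rewrite /alpha Kb ger0_norm ?(ltW y20)// /y2 powRVK ?(ltW qPhis2)//.
  by rewrite mulrC mulKf ?gt_eqF// KS.
apply/andP; split.
  by apply: lt_le_trans (theta_ge _ (ltW y20)); rewrite divr_gt0.
have := time_le a0 a1 s12 g0 gE Phia dPhi KS dtheta dJ.
rewrite -/y2 -/C Phi1 ?s12 ?andbT ?(ltW a1)// -/y1.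
have := theta_le y1 (powR_ge0 _ _).
have : C * (J s2 - J (a + 1)) <= C * (B - J (a + 1)) by rewrite ler_wpM2l// lerB.
lra.
Qed.

End keller_osserman_profiles.

(** * Lebesgue integration on row vectors *)

Section tuple_integrals.
Context {R : realType}.
Implicit Types (n : nat).

(* Bounded, measurable, vanishing outside a cube: the functions integrated here. *)
Definition cube_bounded n (M : R) (F : n.-tuple R -> R) : Prop :=
  [/\ measurable_fun setT F, forall w, `|F w| <= M
    & forall w i, M < `|tnth w i| -> F w = 0].

Lemma cube_bounded_le n (M M' : R) (F : n.-tuple R -> R) : M <= M' ->
  cube_bounded M F -> cube_bounded M' F.
Proof.
move=> MM' [mF bF sF]; split=> // [w|w i wM]; first exact: le_trans (bF w) _.
by apply: (sF w i); exact: le_lt_trans wM.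
Qed.

Lemma cube_bounded_integrable n (M : R) (F : n.-tuple R -> R) :
  cube_bounded M F -> (@lebesgue_tuple R n).-integrable setT (EFin \o F).
Proof.
move=> [mF bF sF].
pose Q := [set w : n.-tuple R | forall i, `[- M, M]%classic (tnth w i)].
have mQ : measurable Q.
  rewrite [X in measurable X](_ : _ =
      \bigcap_(i in [set: 'I_n]) ((fun w => tnth w i) @^-1` `[- M, M]%classic)).
    apply: fin_bigcap_measurable => // i _.
    by rewrite -[X in measurable X]setTI; exact: measurable_tnth.
  by apply/seteqP; split=> w /= wA i; [move=> _; exact: wA|exact: wA i I].
have Qoo : (lebesgue_tuple Q \is a fin_num)%E.
  rewrite (lebesgue_tuple_box (A := fun=> `[- M, M]%classic))//.
  apply: (big_ind (fun x : \bar R => x \is a fin_num)) => // [x y|i _].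
    exact: fin_numM.
  by rewrite lebesgue_measure_itv; case: ifP.
have iQ : (@lebesgue_tuple R n).-integrable setT (EFin \o (fun w => M * \1_Q w)).
  have -> : EFin \o (fun w => M * \1_Q w) = (fun w => M%:E * (\1_Q w)%:E)%E by [].
  apply: integrableZl => //; apply/integrableP; split.
    exact/measurable_EFinP/measurable_indic.
  under eq_integral do rewrite /= ger0_norm//.
  by rewrite integral_indic// setIT ltey_eq Qoo.
apply: le_integrable iQ => //=; first exact/measurable_EFinP.
move=> w _; rewrite lee_fin normrM.
have [wQ|wQ] := pselect (Q w).
  by rewrite indicE mem_set// normr1 mulr1 (le_trans (bF w))// ler_norm.
suff -> : F w = 0 by rewrite normr0 mulr_ge0.
have [i] : exists i, ~ `[- M, M]%classic (tnth w i) by exact/existsNP.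
rewrite /= in_itv/= -ler_norml => /negP; rewrite -ltNge; exact: sF.
Qed.

Definition tuple_upd n (w : n.-tuple R) (i : 'I_n) (s : R) : n.-tuple R :=
  [tuple if j == i then s else tnth w j | j < n].

Lemma tuple_upd0 n (x s : R) (w : n.-tuple R) :
  tuple_upd (tuple_cons (x, w)) ord0 s = tuple_cons (s, w).
Proof.
apply: eq_from_tnth => j; rewrite tnth_mktuple.
have [->//|j0] := eqVneq j ord0.
have [k ->] : exists k, j = lift ord0 k.
  by case: (unliftP ord0 j) j0 => [k ->|->]; [exists k|rewrite eqxx].
by rewrite !tnthS.
Qed.

Lemma tuple_updS n (x s : R) (w : n.-tuple R) (i : 'I_n) :
  tuple_upd (tuple_cons (x, w)) (lift ord0 i) s = tuple_cons (x, tuple_upd w i s).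
Proof.
apply: eq_from_tnth => j; rewrite tnth_mktuple.
have [->//|j0] := eqVneq j ord0.
have [k ->] : exists k, j = lift ord0 k.
  by case: (unliftP ord0 j) j0 => [k ->|->]; [exists k|rewrite eqxx].
by rewrite !tnthS tnth_mktuple (inj_eq (@lift_inj _ ord0)).
Qed.

Lemma cube_bounded_slicer n (M x : R) (F : n.+1.-tuple R -> R) :
  cube_bounded M F -> cube_bounded M (fun w => F (tuple_cons (x, w))).
Proof.
move=> [mF bF sF]; split => // [|w i wM].
  apply: measurableT_comp => //.
  exact: (measurable_cons (f := fun=> x) (g := id)).
by apply: (sF _ (lift ord0 i)); rewrite tnthS.
Qed.

Lemma integral_cons n (F : n.+1.-tuple R -> R) M : cube_bounded M F ->
  (\int[@lebesgue_tuple R n.+1]_w (F w)%:E =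
   \int[lebesgue_measure \x @lebesgue_tuple R n]_xw (F (tuple_cons xw))%:E)%E /\
  (lebesgue_measure \x @lebesgue_tuple R n)%E.-integrable setT
    (fun xw => (F (tuple_cons xw))%:E).
Proof.
move=> bF; have iF := cube_bounded_integrable bF.
have mF : measurable_fun setT F by case: bF.
have mE : measurable_fun setT (EFin \o F) by exact/measurable_EFinP.
have iF' : (lebesgue_measure \x @lebesgue_tuple R n)%E.-integrable
   (@tuple_cons R n @^-1` setT) ((EFin \o F) \o @tuple_cons R n).
  move: iF => /integrableP[_ iF]; apply/integrableP; split.
    rewrite preimage_setT; apply: measurableT_comp mE _.
    exact: measurable_tuple_cons.
  (* By conversion [lebesgue_tuple n.+1] is this pushforward; the ascription exposes it to the
     change of variables. *)
  have : (\int[pushforward (lebesgue_measure \x @lebesgue_tuple R n)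
    (@tuple_cons R n)]_w `|(EFin \o F) w| < +oo)%E := iF.
  rewrite ge0_integral_pushforward//.
  - exact: measurable_tuple_cons.
  - exact: measurableT_comp.
split; last by move: iF'; rewrite preimage_setT.
have E : (\int[pushforward (lebesgue_measure \x @lebesgue_tuple R n)%E
    (@tuple_cons R n)]_w (EFin \o F) w =
  \int[lebesgue_measure \x @lebesgue_tuple R n]_(x in @tuple_cons R n @^-1` setT)
    ((EFin \o F) \o @tuple_cons R n) x)%E.
  apply: integral_pushforward => //; exact: measurable_tuple_cons.
by move: E; rewrite preimage_setT.
Qed.

Lemma integral_derive_line (M : R) (F dF : R -> R) :
  (forall s : R, is_derive s 1 F (dF s)) -> continuous dF ->
  (forall s, M < `|s| -> F s = 0) -> (forall s, M < `|s| -> dF s = 0) ->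
  (\int[lebesgue_measure]_s (dF s)%:E = 0)%E.
Proof.
(* [M] may be negative; [N] is positive and exceeds it, so [F] vanishes at both ends of [-N, N]. *)
move=> d_F cdF F0 dF0; pose N : R := `|M| + 1.
have N0 : 0 < N by rewrite ltr_pwDr.
have MN : M < N by rewrite (le_lt_trans (ler_norm M))// ltrDl.
have NN : - N < N by lra.
rewrite (_ : (\int[lebesgue_measure]_s (dF s)%:E)%E = (\int[lebesgue_measure]_(s in `[(- N)%R, N]) (dF s)%:E)%E).
  rewrite (@integral_itv_primitive R dF F)//.
  - by rewrite !F0 ?subrr// ?normrN gtr0_norm.
  - exact: continuous_subspaceT.
  - by apply: continuous_subspaceT => s; exact: is_derive1_continuous (d_F s).
rewrite [RHS]integral_mkcond; apply: eq_integral => s _; rewrite patchE.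
case: ifPn => //; rewrite notin_setE/= in_itv/= -ler_norml => /negP; rewrite -ltNge => Ns.
by rewrite dF0// (lt_trans MN).
Qed.

(** By Fubini: if the differentiated coordinate is the first one, the inner integral over it is
    already 0; otherwise the first coordinate is frozen and the induction hypothesis applies to the
    slice. *)
Lemma integral_derive_tuple n (i : 'I_n) (M : R) (F dF : n.-tuple R -> R) :
  cube_bounded M F -> cube_bounded M dF ->
  (forall w, continuous (fun s => dF (tuple_upd w i s))) ->
  (forall w (s : R), is_derive s 1 (fun s => F (tuple_upd w i s)) (dF (tuple_upd w i s))) ->
  (\int[@lebesgue_tuple R n]_w (dF w)%:E = 0)%E.
Proof.
elim: n i F dF => [[]//|n IH] i F dF bF bdF cdF ddF.
have [-> iF'] := integral_cons bdF.
have [i0|i0] := eqVneq i ord0.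
  rewrite -integral21_prod_meas1//=.
  apply: integral0_eq => w _; rewrite /fubini_G.
  apply: (@integral_derive_line M (fun x => F (tuple_cons (x, w)))).
  - move=> s; have := ddF (tuple_cons (0, w)) s.
    rewrite i0 tuple_upd0; congr is_derive.
    by apply/funext => x; rewrite tuple_upd0.
  - have := cdF (tuple_cons (0, w)); rewrite i0.
    by under eq_fun do rewrite tuple_upd0.
  - by move=> s Ms; have [_ _ /(_ _ ord0)] := bF; apply.
  - by move=> s Ms; have [_ _ /(_ _ ord0)] := bdF; apply.
have [k ik] : exists k, i = lift ord0 k.
  by case: (unliftP ord0 i) i0 => [k ->|->]; [exists k|rewrite eqxx].
rewrite -integral12_prod_meas1//=.
apply: integral0_eq => x _; rewrite /fubini_F.
apply: (IH k (fun w => F (tuple_cons (x, w)))).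
- exact: cube_bounded_slicer.
- exact: cube_bounded_slicer.
- move=> w; have := cdF (tuple_cons (x, w)); rewrite ik.
  by under eq_fun do rewrite tuple_updS.
- move=> w s; have := ddF (tuple_cons (x, w)) s; rewrite ik tuple_updS.
  by under eq_fun do rewrite tuple_updS.
Qed.

End tuple_integrals.

(** * Integrals of locally bounded functions with bounded support *)

Section row_vector_integrals.
Context {R : realType} {n : nat}.
Implicit Types (F G : 'rV[R]_n -> R) (q : 'rV[R]_n) (M C : R).

Definition row_measurable F : Prop :=
  measurable_fun setT (fun w : n.-tuple R => F (\row_i tnth w i)).

Definition in_cube M q : Prop := forall i, `|q ord0 i| <= M.

(** Measurability with bounds on cubes, instead of continuity, accommodates the factor |grad
    u|^(p-2) of the flux directly. *)
Definition locally_bounded F : Prop :=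
  row_measurable F /\ forall M, exists C, forall q, in_cube M q -> `|F q| <= C.

Definition cube_supported M F : Prop := forall q, ~ in_cube M q -> F q = 0.

Lemma cube_supported_le M M' F : M <= M' -> cube_supported M F -> cube_supported M' F.
Proof.
move=> MM' sF q nq; apply: sF; apply: contra_not nq => qM i.
exact: le_trans (qM i) MM'.
Qed.

(** The topology lives on row vectors and the sigma-algebra on tuples. An open set is the union of
    the cubes with rational centre and radius 1 / (k + 1) that it contains; these are countably many
    and measurable. *)
Lemma continuous_row_measurable F : continuous F -> row_measurable F.
Proof.
move=> cF; apply: (measurability _ (RGenOpens.measurableE R)).
move=> _ [_ [a [b ->] <-]].
rewrite setTI.
pose U := F @^-1` `]a, b[%classic.
have oU : open U by apply: open_comp => //; exact: itv_open.
pose box (ck : 'rV[rat]_n * nat) := [set w : n.-tuple R |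
  forall i, `]ratr (ck.1 ord0 i) - ck.2.+1%:R^-1, ratr (ck.1 ord0 i) + ck.2.+1%:R^-1[%classic (tnth w i)].
rewrite (_ : _ @^-1` _ = \bigcup_ck
   (if pselect (forall w, box ck w -> U (\row_i tnth w i)) then box ck else set0)).
  apply: countable_bigcupT_measurable => [|[c k]]; first exact: countableP.
  case: pselect => [H|H] /=; last exact: measurable0.
  rewrite [X in measurable X](_ : _ = \bigcap_(i in [set: 'I_n])
    ((fun w => tnth w i) @^-1` `]ratr (c ord0 i) - k.+1%:R^-1, ratr (c ord0 i) + k.+1%:R^-1[%classic)).
    apply: fin_bigcap_measurable => // i _.
    by rewrite -[X in measurable X]setTI; exact: measurable_tnth.
  by apply/seteqP; split=> w /= wA i; [move=> _; exact: wA|exact: wA i I].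
apply/seteqP; split => w /=; last first.
  by move=> [ck _]; case: pselect => // H /H.
move=> Uw.
have /nbhs_ballP[e /= e0 eU] : nbhs (\row_i tnth w i) U by exact: open_nbhs_nbhs.
have [k ke] : exists k, k.+1%:R^-1 < e / 2.
  have [k _ /(_ k (leqnn k)) ke] := near_infty_natSinv_lt (PosNum (divr_gt0 e0 (ltr0Sn R 1))).
  by exists k.
have k0 : 0 < k.+1%:R^-1 :> R by rewrite invr_gt0 ltr0n.
have /choice[c cP] : forall i : 'I_n, exists c : rat,
    tnth w i - k.+1%:R^-1 < ratr c < tnth w i + k.+1%:R^-1.
  move=> i; have [|c cP] := @rat_in_itvoo R (tnth w i - k.+1%:R^-1) (tnth w i + k.+1%:R^-1).
    by rewrite ltrD2l gtrN.
  by exists c; move: cP; rewrite in_itv.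
exists (\row_i c i, k) => //; case: pselect => [H|H]; last first.
  exfalso; apply: H => v bv; apply: eU; split => // i j; rewrite /ball/= !mxE.
  have := bv j; rewrite /= in_itv/= mxE => /andP[].
  have /andP[] := cP j; move: ke k0; set d := k.+1%:R^-1; rewrite ltr_norml; lra.
move=> i; rewrite /= in_itv/= mxE; have /andP[] := cP i.
move: k0; set d := k.+1%:R^-1; lra.
Qed.

Lemma in_cube_compact M : compact [set q | in_cube M q].
Proof.
have -> : [set q | in_cube M q] =
    [set q : 'rV[R]_n | forall i, `[- M, M]%classic (q ord0 i)].
  apply/seteqP; split => q /= qM i; have := qM i; rewrite /= in_itv/= ler_norml//.
apply: (@rV_compact R n (fun=> `[- M, M]%classic)) => i.
exact: segment_compact.
Qed.

Lemma continuous_locally_bounded F : continuous F -> locally_bounded F.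
Proof.
move=> cF; split=> [|M]; first exact: continuous_row_measurable.
(* For M < 0 the cube is empty unless n = 0; in either case every point in it equals 0. *)
have [M0|M0] := leP 0 M; last first.
  exists `|F 0| => q qM; suff -> : q = 0 by [].
  apply/rowP => i; have := qM i; rewrite leNgt => /negP[].
  exact: lt_le_trans M0 _.
have [|||c _ Fc] := @EVT_max_rV R n (fun q => `|F q|) [set q | in_cube M q].
- by exists 0 => i /=; rewrite mxE normr0.
- exact: in_cube_compact.
- apply: continuous_subspaceT => q; exact: (continuous_comp (cF q) (@norm_continuous _ _ _)).
by exists `|F c| => q qM; apply: Fc; exact: mem_set.
Qed.

Lemma locally_bounded_cst (c : R) : locally_bounded (fun=> c).
Proof. by apply: continuous_locally_bounded; exact: cst_continuous. Qed.

Lemma locally_boundedD F G : locally_bounded F -> locally_bounded G ->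
  locally_bounded (fun q => F q + G q).
Proof.
move=> [mF bF] [mG bG]; split=> [|M]; first exact: measurable_funD.
have [C FC] := bF M; have [D GD] := bG M; exists (C + D) => q qM.
by rewrite (le_trans (ler_normD _ _))// lerD ?FC ?GD.
Qed.

Lemma locally_boundedM F G : locally_bounded F -> locally_bounded G ->
  locally_bounded (fun q => F q * G q).
Proof.
move=> [mF bF] [mG bG]; split=> [|M]; first exact: measurable_funM.
have [C FC] := bF M; have [D GD] := bG M; exists (C * D) => q qM.
by rewrite normrM ler_pM ?FC ?GD.
Qed.

Lemma locally_boundedN F : locally_bounded F -> locally_bounded (fun q => - F q).
Proof.
move=> bF; have := locally_boundedM (locally_bounded_cst (-1)) bF.
by under eq_fun do rewrite mulN1r.
Qed.

Definition integrand F : Prop :=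
  locally_bounded F /\ exists M, cube_supported M F.

Lemma integrand_cube_bounded F : integrand F ->
  exists M, cube_bounded M (fun w : n.-tuple R => F (\row_i tnth w i)).
Proof.
move=> [[mF bF] [M sF]]; have [C FC] := bF M.
exists (Num.max M `|C|); split => // [w|w i wM].
  have [wM|wM] := pselect (in_cube M (\row_i tnth w i)).
    by rewrite le_max (le_trans (FC _ wM) (ler_norm _)) orbT.
  by rewrite sF// normr0 le_max normr_ge0 orbT.
apply: sF => /(_ i); rewrite mxE => wM'.
by move: wM; rewrite ltNge le_max wM'.
Qed.

Lemma integrandD F G : integrand F -> integrand G ->
  integrand (fun q => F q + G q).
Proof.
move=> [bF [M sF]] [bG [N sG]]; split; first exact: locally_boundedD.
exists (Num.max M N) => q nq.
by rewrite sF ?sG ?addr0// => qM; apply: nq => i; rewrite le_max qM ?orbT.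
Qed.

Lemma integrandM F G : locally_bounded F -> integrand G ->
  integrand (fun q => F q * G q).
Proof.
move=> bF [bG [N sG]]; split; first exact: locally_boundedM.
by exists N => q nq; rewrite sG ?mulr0.
Qed.

Lemma integrandN F : integrand F -> integrand (fun q => - F q).
Proof.
move=> iF; have := integrandM (locally_bounded_cst (-1)) iF.
by under eq_fun do rewrite mulN1r.
Qed.

Lemma integrand_sum (I : Type) (r : seq I) (P : pred I) (F : I -> 'rV[R]_n -> R) :
  (forall i, integrand (F i)) -> integrand (fun q => \sum_(i <- r | P i) F i q).
Proof.
move=> bF; elim: r => [|i r IH].
  under eq_fun do rewrite big_nil.
  by split; [exact: locally_bounded_cst|exists 0].
under eq_fun do rewrite big_cons.
by case: (P i) => //; exact: integrandD.
Qed.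

Definition rVint F : R := fine (integral_Rn F).

Lemma integrand_integrable F : integrand F ->
  (@lebesgue_tuple R n).-integrable setT (fun w => (F (\row_i tnth w i))%:E).
Proof.
by move=> /integrand_cube_bounded[M bF]; exact: cube_bounded_integrable bF.
Qed.

Lemma rVint_EFin F : integrand F -> integral_Rn F = (rVint F)%:E.
Proof.
by move=> iF; rewrite /rVint fineK//; apply: integrable_fin_num => //; exact: integrand_integrable.
Qed.

Lemma rVintD F G : integrand F -> integrand G ->
  rVint (fun q => F q + G q) = rVint F + rVint G.
Proof.
move=> /integrand_integrable iF /integrand_integrable iG.
exact: (@RintegralD _ _ _ (@lebesgue_tuple R n) setT (fun w => F (\row_i tnth w i))
  (fun w => G (\row_i tnth w i)) measurableT iF iG).
Qed.

Lemma rVintN F : integrand F -> rVint (fun q => - F q) = - rVint F.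
Proof.
move=> iF; rewrite -mulN1r.
have := @RintegralZl _ _ _ (@lebesgue_tuple R n) setT (fun w => F (\row_i tnth w i)) (-1) measurableT (integrand_integrable iF).
by move=> <-; congr fine; apply: eq_integral => w _; rewrite mulN1r.
Qed.

Lemma rVintB F G : integrand F -> integrand G ->
  rVint (fun q => F q - G q) = rVint F - rVint G.
Proof. by move=> iF iG; rewrite rVintD ?rVintN//; exact: integrandN. Qed.

Lemma rVint_sum (I : Type) (r : seq I) (P : pred I) (F : I -> 'rV[R]_n -> R) :
  (forall i, integrand (F i)) ->
  rVint (fun q => \sum_(i <- r | P i) F i q) = \sum_(i <- r | P i) rVint (F i).
Proof.
move=> iF; elim: r => [|i r IH].
  rewrite big_nil /rVint /integral_Rn; under eq_integral do rewrite big_nil.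
  by rewrite integral0.
rewrite big_cons -IH; case: ifPn => Pi.
  rewrite -rVintD//; last exact: integrand_sum.
  by congr rVint; apply/funext => q; rewrite big_cons Pi.
by congr rVint; apply/funext => q; rewrite big_cons (negbTE Pi).
Qed.

Lemma le_rVint F G : integrand F -> integrand G -> (forall q, F q <= G q) ->
  rVint F <= rVint G.
Proof.
move=> /integrand_integrable iF /integrand_integrable iG FG.
exact: (@le_Rintegral _ _ _ (@lebesgue_tuple R n) setT (fun w => F (\row_i tnth w i))
  (fun w => G (\row_i tnth w i)) measurableT iF iG (fun w _ => FG _)).
Qed.

Lemma rVint_gt0 F q0 : continuous F -> integrand F -> (forall q, 0 <= F q) ->
  0 < F q0 -> 0 < rVint F.
Proof.
move=> cF iF F0 Fq0.
have e0 : 0 < F q0 / 2 by rewrite divr_gt0.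
have /cvgrPdist_lt/(_ _ e0)/nbhs_ballP[d /= d0 dF] := cF q0.
pose A (i : 'I_n) := `]q0 ord0 i - d, q0 ord0 i + d[%classic.
pose Q := [set w : n.-tuple R | forall i, A i (tnth w i)].
have mQ : measurable Q.
  rewrite [X in measurable X](_ : _ =
      \bigcap_(i in [set: 'I_n]) ((fun w => tnth w i) @^-1` A i)).
    apply: fin_bigcap_measurable => // i _.
    by rewrite -[X in measurable X]setTI; apply: measurable_tnth => //; exact: measurable_itv.
  by apply/seteqP; split=> w /= wA i; [move=> _; exact: wA|exact: wA i I].
have QE : lebesgue_tuple Q = ((2 * d) ^+ n)%:E.
  rewrite lebesgue_tuple_box; last by move=> i; exact: measurable_itv.
  rewrite (eq_bigr (fun=> (2 * d)%:E)) => [|i _].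
    by rewrite big_const_ord iter_mule EFin_expe mule1.
  rewrite /A lebesgue_measure_itv/= lte_fin ltrD2l gtrN// -EFinD.
  by congr EFin; ring.
have QF w : Q w -> F q0 / 2 <= F (\row_i tnth w i).
  move=> Qw; have qb : ball q0 d (\row_i tnth w i).
    split => // i j; rewrite ord1 mxE /ball/=.
    by have := Qw j; rewrite /A/= in_itv/= ltr_norml => /andP[]; lra.
  by have /= := dF _ qb; rewrite ltr_norml => /andP[]; lra.
rewrite -lte_fin -rVint_EFin//.
apply: (@lt_le_trans _ _ (\int[@lebesgue_tuple R n]_(w in Q) (F q0 / 2)%:E)%E).
  rewrite integral_cst// [X in (_ * X)%E](_ : _ = ((2 * d) ^+ n)%:E); last exact: QE.
  by rewrite -EFinM lte_fin mulr_gt0// exprn_gt0// mulr_gt0.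
have mF : measurable_fun setT (fun w : n.-tuple R => (F (\row_i tnth w i))%:E).
  by apply/measurable_EFinP; case: iF => -[].
apply: (@le_trans _ _ (\int[@lebesgue_tuple R n]_(w in Q) (F (\row_i tnth w i))%:E)%E).
  apply: ge0_le_integral => //.
  - by move=> w _; rewrite lee_fin ltW.
  - exact: measurable_funTS.
apply: ge0_subset_integral => //.
by move=> w _; rewrite lee_fin.
Qed.

Lemma rVint_dominated (Fk : nat -> 'rV[R]_n -> R) F M C :
  (forall k, integrand (Fk k)) -> (forall k, cube_supported M (Fk k)) ->
  (forall k q, in_cube M q -> `|Fk k q| <= C) ->
  (forall q, Fk ^~ q @ \oo --> F q) ->
  integrand F /\ (rVint (Fk k) @[k --> \oo] --> rVint F).
Proof.
move=> iFk sFk bFk cFk.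
have C0 : 0 <= `|C| by [].
have bFk' k q : `|Fk k q| <= `|C|.
  have [qM|qM] := pselect (in_cube M q).
    exact: le_trans (bFk _ _ qM) (ler_norm _).
  by rewrite sFk// normr0.
have mFk k : measurable_fun setT (fun w : n.-tuple R => Fk k (\row_i tnth w i)).
  by have [[]] := iFk k.
have mF : measurable_fun setT (fun w : n.-tuple R => F (\row_i tnth w i)).
  by apply: measurable_fun_cvg mFk _ => w _; exact: cFk.
have sF : cube_supported M F.
  move=> q qM; have /cvg_lim <- // := cFk q.
  under eq_fun do rewrite sFk//.
  by rewrite lim_cst.
have bF q : `|F q| <= `|C|.
  have cn : `|Fk k q| @[k --> \oo] --> `|F q| by apply: cvg_norm; exact: cFk.
  have /cvg_lim <- // := cn.
  apply: limr_le; last exact: nearW.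
  by apply/cvg_ex; exists (`|F q| : R).
have iF : integrand F.
  split; last by exists M.
  by split => // N; exists `|C| => q _.
split => //.
pose G (q : 'rV[R]_n) := `|C| * \1_[set q | in_cube M q] q.
pose w2q (w : n.-tuple R) : 'rV[R]_n := \row_i tnth w i.
have G0 q : 0 <= G q by rewrite mulr_ge0// indicE.
have mG : measurable_fun setT (G \o w2q).
  apply: measurable_funM; first exact: measurable_cst.
  have -> : (fun w => \1_[set q | in_cube M q] (w2q w)) =
      \1_[set w | in_cube M (w2q w)] :> (n.-tuple R -> R).
    by apply/funext => w; rewrite !indicE; congr (_%:R); apply/idP/idP; rewrite !inE.
  apply: measurable_indic.
  rewrite [X in measurable X](_ : _ =
      \bigcap_(i in [set: 'I_n]) ((fun w => tnth w i) @^-1` `[- M, M]%classic)).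
    apply: fin_bigcap_measurable => // i _.
    by rewrite -[X in measurable X]setTI; exact: measurable_tnth.
  apply/seteqP; split=> w /= wA i.
    by move=> _ /=; rewrite in_itv/= -ler_norml; have := wA i; rewrite mxE.
  by have := wA i I; rewrite /= in_itv/= -ler_norml mxE.
have iG : integrand G.
  split; last by exists M => q qM; rewrite /G indicE memNset// mulr0.
  split => // N; exists `|C| => q _.
  by rewrite ger0_norm// ler_piMr// indicE lern1 leq_b1.
have [] := @dominated_convergence _ _ R (@lebesgue_tuple R n) setT measurableT
  (fun k w => (Fk k (w2q w))%:E) (fun w => (F (w2q w))%:E) (fun w => (G (w2q w))%:E).
- by move=> k; exact/measurable_EFinP.
- exact/measurable_EFinP.
- apply: aeW => w _; apply/fine_cvgP; split; first exact: nearW.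
  exact: cFk.
- exact: integrand_integrable.
- apply: aeW => w k _; rewrite lee_fin.
  have [qM|qM] := pselect (in_cube M (w2q w)).
    by rewrite /G indicE mem_set// mulr1.
  by rewrite sFk// normr0.
move=> _ _ ifk.
have /fine_cvgP[_] : integral_Rn (Fk k) @[k --> \oo] --> (rVint F)%:E.
  by rewrite -rVint_EFin//; exact: ifk.
exact.
Qed.

Lemma rVint_derive0 F (dF : 'rV[R]_n -> R) (i : 'I_n) M : continuous F ->
  continuous dF -> cube_supported M F ->
  (forall q, is_derive q (delta_mx ord0 i : 'rV[R]_n) F (dF q)) ->
  rVint dF = 0.
Proof.
move=> cF cdF sF ddF.
have sdF : cube_supported M dF.
  move=> q /existsNP[j /negP]; rewrite -ltNge => qj.
  have [_ <-] := ddF q; rewrite (@near_eq_derive _ _ _ F (cst 0)) ?derive_cst//.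
  have : {for q, continuous (fun x : 'rV[R]_n => `|x ord0 j|)}.
    exact: (cvg_norm (@coord_continuous R 1 n ord0 j q)).
  move=> /cvgr_gt/(_ _ qj); apply: filterS => x xj; apply: sF => /(_ j).
  by rewrite leNgt xj.
have iF : integrand F by split; [exact: continuous_locally_bounded|exists M].
have idF : integrand dF by split; [exact: continuous_locally_bounded|exists M].
have [N bF] := integrand_cube_bounded iF.
have [N' bdF] := integrand_cube_bounded idF.
have NN : N <= Num.max N N' by rewrite le_max lexx.
have NN' : N' <= Num.max N N' by rewrite le_max lexx orbT.
(* Setting the i-th coordinate to [s] is a translation along the i-th unit vector from the point
   where it is 0, which links [tuple_upd] to directional derivatives. *)
have updE (w : n.-tuple R) s : \row_j tnth (tuple_upd w i s) j =
    (\row_j tnth (tuple_upd w i 0) j) + s *: (delta_mx ord0 i : 'rV[R]_n).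
  apply/rowP => j; rewrite !mxE !tnth_mktuple eqxx/=.
  by case: (j == i); rewrite /= ?mulr1 ?mulr0 ?add0r ?addr0.
have updE' (w : n.-tuple R) (G : 'rV[R]_n -> R) :
    (fun s => G (\row_j tnth (tuple_upd w i s) j)) =
    (fun s => G ((\row_j tnth (tuple_upd w i 0) j) + s *: (delta_mx ord0 i : 'rV[R]_n))).
  by apply/funext => s; rewrite updE.
have c1 (w : n.-tuple R) : continuous (fun s => dF (\row_j tnth (tuple_upd w i s) j)).
  rewrite updE' => s; apply: continuous_comp; last exact: cdF.
  by apply: continuousD; [exact: cst_continuous|exact: scalel_continuous].
have c2 (w : n.-tuple R) (s : R) : is_derive s 1
    (fun s => F (\row_j tnth (tuple_upd w i s) j)) (dF (\row_j tnth (tuple_upd w i s) j)).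
  by rewrite updE'; apply: isd_line; rewrite -updE.
by rewrite /rVint /integral_Rn (integral_derive_tuple (cube_bounded_le NN bF)
  (cube_bounded_le NN' bdF) c1 c2).
Qed.

End row_vector_integrals.

(** * Approximation of C^1 functions by test functions *)

Section smooth_functions_of_one_variable.
Context {R : realType}.
Implicit Types (f g : R -> R).

Fixpoint Ck (k : nat) f : Prop :=
  match k with
  | 0 => continuous f
  | k'.+1 => exists2 df : R -> R, (forall x : R, is_derive x 1 f (df x)) & Ck k' df
  end.

Lemma Ck_ext k f g : f =1 g -> Ck k f -> Ck k g.
Proof. by move=> /funext ->. Qed.

Lemma CkW k f : Ck k.+1 f -> Ck k f.
Proof.
elim: k f => [f [df dfP _] x|k IH f [df dfP cdf]].
  exact: is_derive1_continuous (dfP x).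
by exists df => //; exact: IH.
Qed.

Lemma Ck_cst k (c : R) : Ck k (fun=> c).
Proof.
elim: k c => [c|k IH c]; first exact: cst_continuous.
by exists (fun=> 0) => // x; exact: isd_cst.
Qed.

Lemma CkD k f g : Ck k f -> Ck k g -> Ck k (fun x => f x + g x).
Proof.
elim: k f g => [f g cf cg x|k IH f g [df dfP cdf] [dg dgP cdg]].
  exact: continuousD (cf x) (cg x).
by exists (fun x => df x + dg x); [move=> x; exact: isd_add|exact: IH].
Qed.

Lemma CkM k f g : Ck k f -> Ck k g -> Ck k (fun x => f x * g x).
Proof.
elim: k f g => [f g cf cg x|k IH f g Cf Cg].
  exact: continuousM (cf x) (cg x).
have [df dfP cdf] := Cf; have [dg dgP cdg] := Cg.
exists (fun x => f x * dg x + df x * g x); first by move=> x; exact: isd_mul.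
by apply: CkD; apply: IH => //; exact: CkW.
Qed.

Lemma Ck_affine k f (c d : R) : Ck k f -> Ck k (fun x => f (c * x + d)).
Proof.
elim: k f => [f cf x|k IH f [df dfP cdf]].
  apply: continuous_comp; last exact: cf.
  apply: continuousD; last exact: cst_continuous.
  by apply: continuousM; [exact: cst_continuous|exact: cvg_id].
exists (fun x => df (c * x + d) * c) => [x|].
  apply: (@isd_comp R _ f (fun x => c * x + d) x 1 _ _ (dfP _)).
  apply: is_derive_eq (isd_add (isd_scale c (is_derive_id x 1)) (isd_cst d x 1)) _.
  by rewrite mulr1 addr0.
by apply: CkM; [exact: IH|exact: Ck_cst].
Qed.

(* The functions x^-n e^(-1/x), extended by 0 to the left half line, are stable
   under differentiation. *)
Definition flat (n : nat) (x : R) : R :=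
  if x <= 0 then 0 else x^-1 ^+ n * expR (- x^-1).

Lemma flat_ge0 n x : 0 <= flat n x.
Proof.
rewrite /flat; case: (leP x 0) => [_|x0]; first exact: lexx.
by rewrite mulr_ge0 ?expR_ge0// exprn_ge0// invr_ge0 ltW.
Qed.

Lemma flat_gt0 n x : 0 < x -> 0 < flat n x.
Proof.
by move=> x0; rewrite /flat leNgt x0/= mulr_gt0 ?expR_gt0// exprn_gt0// invr_gt0.
Qed.

(** From e^y >= y^(n+1) / (n+1)! at y = 1 / x. It makes every [flat n] continuous at 0. *)
Lemma flat_le n x : `|flat n x| <= n.+1`!%:R * `|x|.
Proof.
rewrite ger0_norm ?flat_ge0// /flat; case: (leP x 0) => [_|x0]; first exact: mulr_ge0.
have y0 : 0 < x^-1 by rewrite invr_gt0.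
have := expR_ge1Dxn n (ltW y0); set y := x^-1 in y0 * => ye.
have ye' : y ^+ n.+1 <= n.+1`!%:R * expR y.
  rewrite mulrC -ler_pdivrMr ?ltr0n ?fact_gt0//.
  by apply: le_trans ye; rewrite lerDr.
rewrite expRN gtr0_norm// ler_pdivrMr ?expR_gt0//.
have -> : x = y^-1 by rewrite invrK.
by rewrite mulrAC ler_pdivlMr// -exprSr.
Qed.

Lemma flat_derive n (x : R) :
  is_derive x 1 (flat n) (flat n.+2 x - n%:R * flat n.+1 x).
Proof.
have [x0|x0|->] := ltgtP x 0.
- have -> : flat n.+2 x - n%:R * flat n.+1 x = 0 by rewrite /flat ltW// mulr0 subr0.
  apply: near_eq_is_derive (isd_cst 0 x 1).
  near=> z; rewrite /flat ifT//; apply: ltW; near: z; exact: lt_nbhsl.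
- have xN0 : x != 0 by rewrite gt_eqF.
  have dV : is_derive x 1 (fun y : R => y^-1) (- x^-2).
    apply: is_derive_eq (is_deriveV xN0 (is_derive_id x 1)) _.
    by rewrite /GRing.scale/= mulr1.
  have dE := @isd_comp R _ expR (fun y : R => - y^-1) x 1 _ _ (is_derive_expR _) (isd_opp dV).
  have := isd_mul (isd_exp n dV) dE.
  have -> : x^-1 ^+ n * (expR (- x^-1) * - - x^-2) + n%:R * x^-1 ^+ n.-1 * - x^-2 * expR (- x^-1)
     = flat n.+2 x - n%:R * flat n.+1 x.
    rewrite /flat leNgt x0/= -exprVn; case: n => [|n]; rewrite /= ?exprS; ring.
  apply: near_eq_is_derive.
  near=> z; rewrite /flat ifF//; apply/negbTE; rewrite -ltNge; near: z.
  exact: lt_nbhsr.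
have f0 k : flat k 0 = 0 by rewrite /flat lexx.
rewrite !f0 mulr0 subr0; apply/is_derive1_caratheodory.
(* On the right half line flat_n(z) = flat_(n+1)(z) z, so the difference quotient at 0 is again a
   flat function, which tends to 0. *)
exists (flat n.+1); split => //.
  move=> z; rewrite f0 !subr0 /flat; case: (leP z 0) => z0; first by rewrite mul0r.
  by rewrite exprS; field; rewrite gt_eqF.
apply/cvgrPdist_lt => e e0; rewrite f0; near=> z.
rewrite sub0r normrN (le_lt_trans (flat_le _ _))// mulrC -ltr_pdivlMr ?ltr0n ?fact_gt0//.
near: z; apply: cvgr0_norm_lt => //; by rewrite divr_gt0// ltr0n fact_gt0.
Unshelve. all: by end_near. Qed.

Lemma Ck_flat k n : Ck k (flat n).
Proof.
elim: k n => [n x|k IH n]; first exact: is_derive1_continuous (flat_derive n x).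
exists (fun x => flat n.+2 x + (- n%:R) * flat n.+1 x).
  by move=> x; rewrite mulNr; exact: flat_derive.
by apply: CkD => //; apply: CkM => //; exact: Ck_cst.
Qed.

(* A smooth primitive of a smooth step from 0 on ]-oo, 0] to 1 on [1, +oo[. *)
Lemma smooth_step : exists S P : R -> R,
  [/\ forall k, Ck k S /\ Ck k P, forall x : R, is_derive x 1 P (S x),
      {homo S : x y / x <= y}, forall x, x <= 0 -> S x = 0 /\ P x = 0
    & forall x, 1 <= x -> S x = 1].
Proof.
(* A bump that is positive exactly on (0, 1); its normalised primitive is the step. *)
pose e x := flat 0 x * flat 0 (- 1 * x + 1).
have Ce k : Ck k e by apply: CkM; [|apply: Ck_affine]; exact: Ck_flat.
have e_ge0 x : 0 <= e x by rewrite mulr_ge0 ?flat_ge0.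
have [I [I0 dI]] := continuous_primitive (Ce 0%N).
have ndI : {homo I : x y / x <= y} by exact: derive_ge0_ndecr dI e_ge0.
have e_out x : x <= 0 \/ 1 <= x -> e x = 0.
  rewrite /e /flat => -[x0|x1]; first by rewrite x0 mul0r.
  by rewrite [X in _ * X]ifT ?mulr0//; lra.
have cstI a b : a <= b -> (forall x, a <= x <= b -> e x = 0) -> I b = I a.
  by move=> ab; exact: (derive0_cst ab (fun x _ => dI x)).
have I1 : 0 < I 1.
  have h01 : 4^-1 <= 3 / 4 :> R by lra.
  have I3 : I (3 / 4) <= I 1 by apply: ndI; lra.
  have I4 : 0 <= I 4^-1 by rewrite -I0; apply: ndI; lra.
  have [|c] := @MVT_segment R I e 4^-1 (3 / 4) h01 (fun x _ => dI x).
    by apply: continuous_subspaceT => x; exact: is_derive1_continuous (dI x).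
  rewrite in_itv/= => /andP[c1 c2] Ic.
  have : 0 < e c * (3 / 4 - 4^-1).
    by rewrite mulr_gt0//; [rewrite mulr_gt0// flat_gt0//; lra|lra].
  by rewrite -Ic; lra.
pose S x := (I 1)^-1 * I x.
have dS (x : R) : is_derive x 1 S ((I 1)^-1 * e x) by exact: isd_scale.
have CS k : Ck k S.
  by apply: CkW; exists (fun x => (I 1)^-1 * e x) => //; apply: CkM => //; exact: Ck_cst.
have [P [P0 dP]] := continuous_primitive (CS 0%N).
have S0 x : x <= 0 -> S x = 0.
  move=> x0; rewrite /S -(cstI x 0 x0) ?I0 ?mulr0// => y /andP[_ y0].
  by apply: e_out; left.
exists S, P; split => //.
- by move=> k; split; [exact: CS|apply: CkW; exists S].
- by move=> x y xy; rewrite ler_wpM2l ?invr_ge0 ?(ltW I1)// ndI.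
- move=> x x0; split; first exact: S0.
  rewrite -(@derive0_cst R P S x 0 x0 (fun y _ => dP y)) ?P0// => y /andP[_ y0].
  exact: S0.
- move=> x x1; rewrite /S (cstI 1 x x1) ?mulVf ?gt_eqF// => y /andP[y1 _].
  by apply: e_out; right.
Qed.

End smooth_functions_of_one_variable.

Section spline.
Context {R : realType}.

(* The second difference of the smooth primitive of a smooth step plays the role of a
   quadratic B-spline: its integer translates form a partition of unity that
   reproduces affine functions, so that quasi-interpolation converges in C^1. *)
Lemma smooth_spline : exists r dr : R -> R,
  [/\ (forall k, Ck k r) /\ (forall x : R, is_derive x 1 r (dr x)),
      forall x, 0 <= r x,
      forall x, ~ (0 < x < 3) -> r x = 0 /\ dr x = 0
    & forall (N : nat) x, 2 <= x <= N%:R ->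
      [/\ \sum_(j < N) r (x - j%:R) = 1,
          \sum_(j < N) dr (x - j%:R) = 0,
          \sum_(j < N) (j%:R * dr (x - j%:R)) = 1 &
          \sum_(j < N) `|dr (x - j%:R)| <= 2]].
Proof.
have [S [P [CSP dP ndS SP0 S1]]] := @smooth_step R.
have CP k : Ck k P by have [] := CSP k.
have S_ge0 (x : R) : 0 <= S x.
  have [x0|x0] := leP x 0; first by rewrite (SP0 _ x0).1.
  by rewrite -(SP0 0 (lexx _)).1 ndS// ltW.
have P1 (x : R) : 1 <= x -> P x - x = P 1 - 1.
  move=> x1; apply: (@derive0_cst R (fun x => P x - x) (fun x => S x - 1) 1 x x1).
  by move=> y /andP[y1 _]; rewrite S1 ?subrr.
(* [D] rises from 0 to 1 on [0, 2], and its difference [r] below lives on [0, 3]. The shift is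
   spelled [1 * x + - 1] to match [Ck_affine]. *)
pose D x := P x - P (1 * x + - 1); pose s x := S x - S (1 * x + - 1).
have dshift (f df : R -> R) : (forall x : R, is_derive x 1 f (df x)) ->
    forall x : R, is_derive x 1 (fun x => f (1 * x + -1)) (df (1 * x + -1)).
  move=> fdf x.
  have Da := isd_add (isd_scale 1 (is_derive_id x (1 : R))) (isd_cst (-1) x 1).
  apply: is_derive_eq (@isd_comp R _ f (fun x : R => 1 * x + -1) x 1 _ _ (fdf _) Da) _.
  by rewrite mulr1 addr0 mulr1.
have dD (x : R) : is_derive x 1 D (s x) by apply: isd_sub (dP x) _; exact: dshift.
have D2 (x : R) : 2 <= x -> D x = 1.
  move=> x2; have := P1 x; have := P1 (1 * x + -1); rewrite /D; lra.
have D0 (x : R) : x <= 0 -> D x = 0.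
  move=> x0; rewrite /D (SP0 _ x0).2 (SP0 (1 * x + -1) _).2 ?subrr//; lra.
have s2 (x : R) : 2 <= x -> s x = 0.
  move=> x2; rewrite /s !S1 ?subrr//; lra.
have s0 (x : R) : x <= 0 -> s x = 0.
  move=> x0; rewrite /s (SP0 _ x0).1 (SP0 (1 * x + -1) _).1 ?subrr//; lra.
have s_ge0 (x : R) : 0 <= s x by rewrite subr_ge0 ndS//; lra.
have ndD : {homo D : x y / x <= y} by exact: derive_ge0_ndecr dD s_ge0.
pose r x := D x - D (1 * x + - 1); pose dr x := s x - s (1 * x + - 1).
have CD k : Ck k D.
  apply: (@Ck_ext _ _ (fun x => P x + (- 1) * P (1 * x + - 1))).
    by move=> x; rewrite mulN1r.
  by apply: CkD => //; apply: CkM; [exact: Ck_cst|exact: Ck_affine].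
exists r, dr; split.
- split=> [k|x]; last by apply: isd_sub (dD x) _; exact: dshift.
  apply: (@Ck_ext _ _ (fun x => D x + (- 1) * D (1 * x + - 1))).
    by move=> x; rewrite mulN1r.
  by apply: CkD => //; apply: CkM; [exact: Ck_cst|exact: Ck_affine].
- by move=> x; rewrite subr_ge0 ndD//; lra.
- move=> x /negP; rewrite negb_and -!leNgt => /orP[x0|x3]; rewrite /r /dr.
    by rewrite !D0 ?s0 ?subrr//; lra.
  by rewrite !D2 ?s2 ?subrr//; lra.
move=> N x /andP[x2 xN].
have xNj : x - N%:R <= 0 by lra.
have shiftE j : 1 * (x - j%:R) + - 1 = x - j.+1%:R :> R.
  by rewrite mul1r -addrA -opprD -natr1.
have tel (a : nat -> R) : \sum_(j < N) (a j - a j.+1) = a 0%N - a N.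
  rewrite -(big_mkord xpredT (fun j => a j - a j.+1)).
  rewrite (@telescope_sumr_eq R 0 N (fun j => - a j))// => [|j _].
    by rewrite opprK addrC.
  by rewrite opprK addrC.
have telS : \sum_(j < N) (S (x - j%:R) - S (x - j.+1%:R)) = 1.
  rewrite (tel (fun j => S (x - j%:R))) (SP0 _ xNj).1 !subr0 S1//; lra.
have telS1 : \sum_(j < N) (S (x - j.+1%:R) - S (x - j.+2%:R)) = 1.
  rewrite (tel (fun j => S (x - j.+1%:R))) (SP0 (x - N.+1%:R) _).1; last first.
    by rewrite -natr1; lra.
  rewrite subr0 S1//; lra.
split.
- under eq_bigr do rewrite /r shiftE.
  by rewrite (tel (fun j => D (x - j%:R))) subr0 D2// D0// subr0.
- under eq_bigr do rewrite /dr shiftE.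
  by rewrite (tel (fun j => s (x - j%:R))) subr0 s2// s0// subr0.
(* Summation by parts: j dr(x - j) is a telescoping difference plus s(x - (j + 1)). The latter sums
   to S(x - 1) - S(x - N - 1) = 1, which is where x >= 2 enters. *)
- rewrite (eq_bigr (fun j : 'I_N => (j%:R * s (x - j%:R) - j.+1%:R * s (x - j.+1%:R)) +
     s (x - j.+1%:R))) => [|j _]; last first.
    by rewrite /dr shiftE -natr1; ring.
  rewrite big_split/= (tel (fun j => j%:R * s (x - j%:R))).
  rewrite (s0 _ xNj) mul0r mulr0 subr0 add0r -[RHS]telS1.
  by apply: eq_bigr => j _; rewrite /s shiftE.
- apply: (@le_trans _ _ (\sum_(j < N) (s (x - j%:R) + s (x - j.+1%:R)))).
    apply: ler_sum => j _; rewrite /dr shiftE.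
    by rewrite (le_trans (ler_normB _ _))// !ger0_norm.
  rewrite big_split/= -[leRHS]/(1 + 1); apply: lerD.
    by rewrite -[leRHS]telS; apply: ler_sum => j _; rewrite /s shiftE.
  by rewrite -[leRHS]telS1; apply: ler_sum => j _; rewrite /s shiftE.
Qed.

End spline.

(** * Calculus of [class_C] functions of several variables *)

Section class_C.
Context {R : realType} {n : nat}.
Implicit Types (f g u : 'rV[R]_n -> R) (q v : 'rV[R]_n).

Lemma class_C_continuous k u : class_C k u -> continuous u.
Proof. by case: k => // k [du _] q; exact: differentiable_continuous. Qed.

Lemma class_CW k u : class_C k.+1 u -> class_C k u.
Proof.
elim: k u => [u Cu|k IH u [du Cu]]; first exact: class_C_continuous Cu.
by split => // v; exact: IH.
Qed.

Lemma class_C_le k l u : (k <= l)%N -> class_C l u -> class_C k u.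
Proof.
move=> /subnK <-; elim: (l - k)%N => [//|j IH] Cu.
by apply: IH; apply: class_CW; rewrite -addSn.
Qed.

Lemma class_C1P u : class_C 1 u -> forall q v, is_derive q v u ('D_v u q).
Proof. by move=> [du _] q v; apply/derivableP/diff_derivable. Qed.

Lemma derive_funE u (du : 'rV[R]_n -> R) v :
  (forall q, is_derive q v u (du q)) -> 'D_v u = du.
Proof. by move=> H; apply/funext => q; have [_ ->] := H q. Qed.

Lemma derive_partial u q v : differentiable u q ->
  'D_v u q = \sum_i v ord0 i * 'D_(delta_mx ord0 i) u q.
Proof.
move=> du; rewrite deriveE// [in LHS](row_sum_delta v) linear_sum.
by apply: eq_bigr => i _; rewrite linearZ/= deriveE.
Qed.

Lemma class_C_cst k (c : R) : class_C k (fun _ : 'rV[R]_n => c).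
Proof.
elim: k c => [c|k IH c]; first exact: cst_continuous.
split=> [q|v]; first exact: differentiable_cst.
by rewrite (derive_funE (fun q => isd_cst c q v)); exact: IH.
Qed.

Lemma class_CD k f g : class_C k f -> class_C k g -> class_C k (fun q => f q + g q).
Proof.
elim: k f g => [f g cf cg x|k IH f g Cf Cg].
  exact: continuousD (cf x) (cg x).
have [df cdf] := Cf; have [dg cdg] := Cg; split=> [q|v].
  exact: differentiableD.
have C1f := class_C1P (class_C_le (ltn0Sn k) Cf).
have C1g := class_C1P (class_C_le (ltn0Sn k) Cg).
by rewrite (derive_funE (fun q => isd_add (C1f q v) (C1g q v))); exact: IH (cdf v) (cdg v).
Qed.

Lemma class_CM k f g : class_C k f -> class_C k g -> class_C k (fun q => f q * g q).
Proof.
elim: k f g => [f g cf cg x|k IH f g Cf Cg].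
  exact: continuousM (cf x) (cg x).
have [df cdf] := Cf; have [dg cdg] := Cg; split=> [q|v].
  exact: differentiableM.
have C1f := class_C1P (class_C_le (ltn0Sn k) Cf).
have C1g := class_C1P (class_C_le (ltn0Sn k) Cg).
rewrite (derive_funE (fun q => isd_mul (C1f q v) (C1g q v))).
apply: class_CD; first exact: IH (class_CW Cf) (cdg v).
exact: IH (cdf v) (class_CW Cg).
Qed.

Lemma class_C_comp k (phi : R -> R) u : Ck k phi -> class_C k u ->
  class_C k (fun q => phi (u q)).
Proof.
elim: k phi u => [phi u cphi cu q|k IH phi u Cphi Cu].
  by apply: continuous_comp; [exact: cu|exact: cphi].
have [dphi dphiP cdphi] := Cphi; have [du cdu] := Cu; split=> [q|v].
  apply: (@differentiable_comp _ _ _ _ u phi) => //.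
  by apply/derivable1_diffP; exact: isd_derivable (dphiP _).
have C1u := class_C1P (class_C_le (ltn0Sn k) Cu).
rewrite (derive_funE (fun q => isd_comp (dphiP (u q)) (C1u q v))).
by apply: class_CM (cdu v); exact: IH cdphi (class_CW Cu).
Qed.

Lemma isd_coord (i : 'I_n) q v : is_derive q v (fun q : 'rV[R]_n => q ord0 i) (v ord0 i).
Proof.
have dc := differentiable_coord q ord0 i; apply: DeriveDef.
  exact: diff_derivable.
rewrite deriveE//.
have lin : linear (fun q : 'rV[R]_n => q ord0 i : R^o).
  by move=> a x y; rewrite !mxE.
pose L := GRing.isLinear.Build _ _ _ _ (fun q : 'rV[R]_n => q ord0 i : R^o) lin.
pose LL : {linear 'rV[R]_n -> R^o} := HB.pack (fun q : 'rV[R]_n => q ord0 i : R^o) L.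
have -> : 'd (fun q0 : 'rV[R]_n => q0 ord0 i) q = 'd LL q :> (_ -> _) by [].
rewrite diff_lin//; exact: coord_continuous.
Qed.

Lemma class_C_coord k (i : 'I_n) : class_C k (fun q : 'rV[R]_n => q ord0 i).
Proof.
case: k => [|k]; first exact: coord_continuous.
split=> [q|v]; first exact: differentiable_coord.
by rewrite (derive_funE (fun q => isd_coord i q v)); exact: class_C_cst.
Qed.

Lemma class_C_sum (I : Type) (r : seq I) (P : pred I) k (F : I -> 'rV[R]_n -> R) :
  (forall i, class_C k (F i)) -> class_C k (fun q => \sum_(i <- r | P i) F i q).
Proof.
move=> CF; elim: r => [|i r IH].
  by under eq_fun do rewrite big_nil; exact: class_C_cst.
under eq_fun do rewrite big_cons.
by case: (P i) => //; exact: class_CD.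
Qed.

Lemma class_C_prod (I : Type) (r : seq I) (P : pred I) k (F : I -> 'rV[R]_n -> R) :
  (forall i, class_C k (F i)) -> class_C k (fun q => \prod_(i <- r | P i) F i q).
Proof.
move=> CF; elim: r => [|i r IH].
  by under eq_fun do rewrite big_nil; exact: class_C_cst.
under eq_fun do rewrite big_cons.
by case: (P i) => //; exact: class_CM.
Qed.

Lemma isd_sum (I : Type) (r : seq I) (F dF : I -> 'rV[R]_n -> R) q v :
  (forall i, is_derive q v (F i) (dF i q)) ->
  is_derive q v (fun q => \sum_(i <- r) F i q) (\sum_(i <- r) dF i q).
Proof.
move=> DF; elim: r => [|i r IH].
  by rewrite big_nil; under eq_fun do rewrite big_nil; exact: isd_cst.
by rewrite big_cons; under eq_fun do rewrite big_cons; exact: isd_add.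
Qed.

(* The increment along the segment [x, y] is a value of the directional derivative. *)
Lemma class_C1_lipschitz u M : class_C 1 u ->
  exists L, forall x y d, 0 <= d -> in_cube M x -> in_cube M y ->
    (forall i, `|y ord0 i - x ord0 i| <= d) -> `|u y - u x| <= L * d.
Proof.
move=> Cu; have [du cdu] := Cu.
have /choice[C CP] : forall i : 'I_n, exists C, forall q, in_cube M q ->
    `|'D_(delta_mx ord0 i) u q| <= C.
  by move=> i; have [_ /(_ M)] := continuous_locally_bounded (cdu (delta_mx ord0 i)).
exists (\sum_i C i) => x y d d0 xM yM xyd.
have dline (s : R) : is_derive s 1 (fun s => u (x + s *: (y - x))) ('D_(y - x) u (x + s *: (y - x))).
  by apply: isd_line; exact: class_C1P.
have [|s] := @MVT_segment R (fun s => u (x + s *: (y - x))) _ 0 1 ler01 (fun s _ => dline s).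
  by apply: continuous_subspaceT => s; exact: is_derive1_continuous (dline s).
rewrite in_itv/= scale1r scale0r addr0 (addrC x (y - x)) subrK subr0 mulr1 => /andP[s0 s1] ->.
rewrite derive_partial// mulr_suml (le_trans (ler_norm_sum _ _ _))//.
apply: ler_sum => i _; rewrite normrM mulrC ler_pM//; last by rewrite !mxE.
apply: CP => j; rewrite !mxE.
have -> : x ord0 j + s * (y ord0 j - x ord0 j) = (1 - s) * x ord0 j + s * y ord0 j by ring.
rewrite (le_trans (ler_normD _ _))// !normrM (ger0_norm s0) ger0_norm ?subr_ge0//.
have -> : M = (1 - s) * M + s * M by ring.
by rewrite lerD// ler_wpM2l ?subr_ge0.
Qed.

End class_C.

Section support_of_derivatives.
Context {R : realType} {n : nat}.

(** The complement of the cube is open, so [F] vanishes in a neighbourhood of each of its points. *)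
Lemma cube_supported_derive (F : 'rV[R]_n -> R) M v :
  cube_supported M F -> cube_supported M ('D_v F).
Proof.
move=> sF q /existsNP[j /negP]; rewrite -ltNge => qj.
rewrite (@near_eq_derive _ _ _ F (cst 0)) ?derive_cst//.
have : {for q, continuous (fun x : 'rV[R]_n => `|x ord0 j|)}.
  exact: (cvg_norm (@coord_continuous R 1 n ord0 j q)).
move=> /cvgr_gt/(_ _ qj); apply: filterS => x xj; apply: sF => /(_ j).
by rewrite leNgt xj.
Qed.

Lemma cube_supported_compact (F : 'rV[R]_n -> R) M :
  cube_supported M F -> compactly_supported F.
Proof.
move=> sF; apply: (@subclosed_compact _ _ [set q : 'rV[R]_n | in_cube M q]).
- exact: closed_closure.
- exact: in_cube_compact.
have cC : closed [set q : 'rV[R]_n | in_cube M q].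
  apply: compact_closed; last exact: in_cube_compact.
  exact: norm_hausdorff.
rewrite [X in _ `<=` X](closure_id _).1//; apply: closure_subset => q /= Fq.
by apply: contrapT => /sF; move/eqP: Fq.
Qed.

End support_of_derivatives.

(** * Quasi-interpolation by tensor products of the spline *)

Section quasi_interpolation.
Context {R : realType} {n : nat}.
Implicit Types (q v : 'rV[R]_n).
Variables (r dr : R -> R).
Hypotheses (Cr : forall k, Ck k r) (dr_r : forall x : R, is_derive x 1 r (dr x))
  (r_ge0 : forall x : R, 0 <= r x)
  (r_out : forall x : R, ~ (0 < x < 3) -> r x = 0 /\ dr x = 0)
  (r_sum : forall (N : nat) (x : R), 2 <= x <= N%:R ->
      [/\ \sum_(j < N) r (x - j%:R) = 1,
          \sum_(j < N) dr (x - j%:R) = 0,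
          \sum_(j < N) (j%:R * dr (x - j%:R)) = 1 &
          \sum_(j < N) `|dr (x - j%:R)| <= 2]).
Variables (zeta : 'rV[R]_n -> R) (M0 M h A : R) (N : nat).
Implicit Types (J : {ffun 'I_n -> 'I_N}).
Hypotheses (zeta_ge0 : forall q, 0 <= zeta q) (zeta_supp : cube_supported M0 zeta).
Hypotheses (h_gt0 : 0 < h) (h_le : 3 * h <= 1) (M0M : M0 + 1 <= M).
Let x (q : 'rV[R]_n) (i : 'I_n) : R := h^-1 * q ord0 i + A / h.
Hypothesis x_bounds : forall q, in_cube M q -> forall i, 2 <= x q i <= N%:R.

(** A lattice of step [h], shifted by [A] so that natural indices cover the cube; [x q i] above is
    the position of q_i measured in these indices. *)
Definition node (J : {ffun 'I_n -> 'I_N}) : 'rV[R]_n := \row_i (h * (J i)%:R - A).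

Let node_dist q J i : node J ord0 i - q ord0 i = - (h * (x q i - (J i)%:R)).
Proof. by rewrite mxE /x; field; rewrite gt_eqF. Qed.

Definition weight (J : {ffun 'I_n -> 'I_N}) (q : 'rV[R]_n) : R :=
  \prod_i r (h^-1 * q ord0 i + A / h - (J i)%:R).

Definition dweight (i : 'I_n) (J : {ffun 'I_n -> 'I_N}) (q : 'rV[R]_n) : R :=
  h^-1 * \prod_l (if l == i then dr (h^-1 * q ord0 l + A / h - (J l)%:R)
    else r (h^-1 * q ord0 l + A / h - (J l)%:R)).

Definition interp (q : 'rV[R]_n) : R :=
  \sum_(J : {ffun 'I_n -> 'I_N}) zeta (node J) * weight J q.

Let close (q : 'rV[R]_n) J := forall l, `|node J ord0 l - q ord0 l| <= 3 * h.

Let factor_close (q : 'rV[R]_n) J l :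
  0 < x q l - (J l)%:R < 3 -> `|node J ord0 l - q ord0 l| <= 3 * h.
Proof.
move=> /andP[x0 x3]; rewrite node_dist normrN normrM (gtr0_norm h_gt0) gtr0_norm//.
by rewrite mulrC ler_pM2r// ltW.
Qed.

Let weight_close q J : weight J q != 0 -> close q J.
Proof.
move=> W0 l; apply: factor_close; apply: contrapT => /r_out[r0 _].
by move/negP: W0; apply; rewrite /weight (bigD1 l)//= r0 mul0r.
Qed.

Let dweight_close i q J : dweight i J q != 0 -> close q J.
Proof.
move=> W0 l; apply: factor_close; apply: contrapT => /r_out[r0 dr0].
move/negP: W0; apply; rewrite /dweight (bigD1 l)//=.
by case: (l == i); [rewrite [dr _]dr0|rewrite [r _]r0]; rewrite mul0r mulr0.
Qed.

Let isd_prod0 (I : Type) (s : seq I) (P : pred I) (F : I -> 'rV[R]_n -> R) q v :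
  (forall i, P i -> is_derive q v (F i) 0) ->
  is_derive q v (fun q => \prod_(i <- s | P i) F i q) 0.
Proof.
move=> dF; elim: s => [|i s IH].
  by under eq_fun do rewrite big_nil; exact: isd_cst.
under eq_fun do rewrite big_cons; case: (boolP (P i)) => // Pi.
by apply: is_derive_eq (isd_mul (dF _ Pi) IH) _; rewrite mulr0 mul0r addr0.
Qed.

Let isd_factor (l : 'I_n) (c : R) q v : is_derive q v
  (fun q : 'rV[R]_n => r (h^-1 * q ord0 l + A / h - c))
  (dr (h^-1 * q ord0 l + A / h - c) * (h^-1 * v ord0 l)).
Proof.
have D := isd_sub (isd_add (isd_scale h^-1 (isd_coord l q v)) (isd_cst (A / h) q v))
  (isd_cst c q v).
apply: is_derive_eq (@isd_comp R _ r
  (fun q : 'rV[R]_n => h^-1 * q ord0 l + A / h - c) q v _ _ (dr_r _) D) _.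
by rewrite addr0 subr0.
Qed.

Lemma isd_weight i J q : is_derive q (delta_mx ord0 i) (weight J) (dweight i J q).
Proof.
have -> : weight J = (fun q => r (h^-1 * q ord0 i + A / h - (J i)%:R) *
    \prod_(l | l != i) r (h^-1 * q ord0 l + A / h - (J l)%:R)).
  by apply/funext => q'; rewrite /weight (bigD1 i).
apply: is_derive_eq.
  apply: isd_mul (isd_factor _ _ _ _) _; apply: isd_prod0 => l li.
  apply: is_derive_eq (isd_factor _ _ _ _) _.
  by rewrite mxE eqxx (negbTE li) !mulr0.
rewrite mulr0 add0r /dweight [in RHS](bigD1 i)//= eqxx mxE !eqxx/= mulr1.
rewrite mulrAC mulrC; congr (_ * _); congr (_ * _).
by apply: eq_bigr => l /negbTE ->.
Qed.

Lemma isd_interp i q : is_derive q (delta_mx ord0 i) interp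
  (\sum_(J : {ffun 'I_n -> 'I_N}) zeta (node J) * dweight i J q).
Proof.
apply: (@isd_sum _ _ _ _ (fun J q => zeta (node J) * weight J q)
  (fun J q => zeta (node J) * dweight i J q)) => J.
exact: isd_scale (isd_weight i J q).
Qed.

Lemma class_C_interp k : class_C k interp.
Proof.
apply: class_C_sum => J; apply: class_CM; first exact: class_C_cst.
apply: class_C_prod => i.
have CA : class_C k (fun q => q ord0 i) by exact: class_C_coord.
have CR : Ck k (fun y => r (h^-1 * y + (A / h - (J i)%:R))) by exact: Ck_affine.
have := class_C_comp CR CA.
by under eq_fun do rewrite addrA.
Qed.

Lemma weight_sum q : in_cube M q -> \sum_(J : {ffun 'I_n -> 'I_N}) weight J q = 1.
Proof.
move=> qM; rewrite /weight -(bigA_distr_bigA (fun i (j : 'I_N) => r (x q i - j%:R))).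
by rewrite big1// => i _; have [] := r_sum (x_bounds qM i).
Qed.

Lemma dweight_sum i q : in_cube M q ->
  \sum_(J : {ffun 'I_n -> 'I_N}) dweight i J q = 0.
Proof.
move=> qM; rewrite /dweight -mulr_sumr.
rewrite -(bigA_distr_bigA (fun l (j : 'I_N) => if l == i then dr (x q l - j%:R) else r (x q l - j%:R))).
rewrite (bigD1 i)//= eqxx.
by have [_ -> _ _] := r_sum (x_bounds qM i); rewrite mul0r mulr0.
Qed.

(** Differentiated reproduction of affine functions. The sum over [J] factors into one-dimensional
    sums: for k = i the i-th factor is that of j dr(x - j), equal to 1 up to scaling; for k <> i it
    is that of dr, which is 0. *)
Lemma dweight_sum_coord i k q : in_cube M q ->
  \sum_(J : {ffun 'I_n -> 'I_N}) (node J - q) ord0 k * dweight i J q = (k == i)%:R.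
Proof.
move=> qM; pose G l (j : 'I_N) := (if l == k then h * j%:R - A - q ord0 l else 1) *
  (if l == i then dr (x q l - j%:R) else r (x q l - j%:R)).
rewrite (eq_bigr (fun J : {ffun 'I_n -> 'I_N} => h^-1 * \prod_l G l (J l))) => [|J _]; last first.
  rewrite /dweight /G big_split/= mulrCA; congr (_ * (_ * _)).
  by rewrite (bigD1 k)//= eqxx !mxE big1 ?mulr1// => l /negbTE ->.
rewrite -mulr_sumr -(bigA_distr_bigA G) (bigD1 i)//=.
have [s1 s2 s3 _] := r_sum (x_bounds qM i).
have [ki|ki] := eqVneq k i.
  rewrite [X in _ * (_ * X)](_ : _ = 1) ?mulr1; last first.
    apply: big1 => l /negbTE li; rewrite /G ki li.
    have [s1' _ _ _] := r_sum (x_bounds qM l).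
    by rewrite -[RHS]s1'; apply: eq_bigr => j _; rewrite mul1r.
  rewrite (eq_bigr (fun j : 'I_N => h * (j%:R * dr (x q i - j%:R)) -
      (A + q ord0 i) * dr (x q i - j%:R))) => [|j _]; last first.
    by rewrite /G ki eqxx; ring.
  rewrite sumrB -!mulr_sumr s3 s2 mulr0 subr0 mulr1.
  by rewrite mulVf// gt_eqF.
rewrite /G eqxx eq_sym (negbTE ki).
by under eq_bigr do rewrite mul1r; rewrite s2 mul0r mulr0.
Qed.

Lemma dweight_sum_norm i q : in_cube M q ->
  \sum_(J : {ffun 'I_n -> 'I_N}) `|dweight i J q| <= 2 / h.
Proof.
move=> qM.
rewrite (eq_bigr (fun J : {ffun 'I_n -> 'I_N} => h^-1 * \prod_l
  (if l == i then `|dr (x q l - (J l)%:R)| else r (x q l - (J l)%:R)))) => [|J _]; last first.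
  rewrite /dweight normrM gtr0_norm ?invr_gt0// normr_prod; congr (_ * _).
  by apply: eq_bigr => l _; case: eqP => // _; rewrite ger0_norm.
rewrite -mulr_sumr.
rewrite -(bigA_distr_bigA (fun l (j : 'I_N) => if l == i then `|dr (x q l - j%:R)| else r (x q l - j%:R))).
rewrite (bigD1 i)//= eqxx [X in _ * (_ * X)](_ : _ = 1); last first.
  apply: big1 => l /negbTE li.
  by rewrite li; have [] := r_sum (x_bounds qM l).
by rewrite mulr1 mulrC ler_pM2r ?invr_gt0//; have [] := r_sum (x_bounds qM i).
Qed.

Lemma weight_ge0 J q : 0 <= weight J q.
Proof. by apply: prodr_ge0 => i _. Qed.

Lemma interp_ge0 q : 0 <= interp q.
Proof. by apply: sumr_ge0 => J _; rewrite mulr_ge0 ?weight_ge0. Qed.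

Lemma interp_near q : interp q != 0 ->
  exists2 q', zeta q' != 0 & forall l, `|q' ord0 l - q ord0 l| <= 3 * h.
Proof.
move=> Iq; have [J JP] : exists J, zeta (node J) * weight J q != 0.
  apply: contrapT => /forallNP H; move/eqP: Iq; apply.
  by rewrite /interp big1// => J _; apply: contrapT => /eqP; exact: (H J).
move: JP; rewrite mulf_eq0 negb_or => /andP[zJ /weight_close wJ].
by exists (node J).
Qed.

Lemma interp_supported : cube_supported M interp.
Proof.
move=> q qM; apply/eqP; apply: contrapT => /negP/interp_near[q' zq' qq'].
apply: qM => l; have q'l : `|q' ord0 l| <= M0.
  by apply: contrapT => H; move/eqP: zq'; apply; apply: zeta_supp => /(_ l).
have := qq' l; have := ler_normB (q' ord0 l) (q' ord0 l - q ord0 l).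
have -> : q' ord0 l - (q' ord0 l - q ord0 l) = q ord0 l by ring.
move=> h1 h2; apply: le_trans h1 (le_trans (lerD q'l h2) (le_trans _ M0M)).
by rewrite lerD2l.
Qed.

(** The weights sum to 1 and their derivatives to 0, so zeta(q) can be subtracted from every sample;
    only nodes within 3 h of [q] contribute. *)
Lemma interp_dist L q : in_cube M q ->
  (forall q', (forall l, `|q' ord0 l - q ord0 l| <= 3 * h) ->
     `|zeta q' - zeta q| <= L) ->
  `|interp q - zeta q| <= L /\
  (forall i, `|\sum_(J : {ffun 'I_n -> 'I_N}) zeta (node J) * dweight i J q| <= L * (2 / h)).
Proof.
move=> qM zL; split.
  rewrite -[X in _ - X]mulr1 -(weight_sum qM) mulr_sumr -sumrB.
  apply: (le_trans (ler_norm_sum _ _ _)).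
  apply: (@le_trans _ _ (\sum_(J : {ffun 'I_n -> 'I_N}) L * weight J q)); last first.
    by rewrite -mulr_sumr weight_sum// mulr1.
  apply: ler_sum => J _; rewrite -mulrBl normrM (ger0_norm (weight_ge0 _ _)).
  have [->|w0] := eqVneq (weight J q) 0; first by rewrite !mulr0.
  by rewrite ler_wpM2r ?weight_ge0// zL//; exact: weight_close.
move=> i; have -> : \sum_(J : {ffun 'I_n -> 'I_N}) zeta (node J) * dweight i J q =
    \sum_(J : {ffun 'I_n -> 'I_N}) (zeta (node J) - zeta q) * dweight i J q.
  under [RHS]eq_bigr do rewrite mulrBl.
  by rewrite sumrB -mulr_sumr dweight_sum// mulr0 subr0.
have L0 : 0 <= L.
  apply: le_trans (zL q _) => // l.
  by rewrite subrr normr0 mulr_ge0// ltW.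
apply: (le_trans (ler_norm_sum _ _ _)).
apply: (@le_trans _ _ (\sum_(J : {ffun 'I_n -> 'I_N}) L * `|dweight i J q|)); last first.
  by rewrite -mulr_sumr ler_wpM2l// dweight_sum_norm.
apply: ler_sum => J _; rewrite normrM.
have [->|w0] := eqVneq (dweight i J q) 0; first by rewrite normr0 !mulr0.
by rewrite ler_wpM2r// zL//; exact: dweight_close w0.
Qed.

(** Constants are killed and linear functions are reproduced, so the error is the same sum taken
    over the first-order Taylor remainder. That remainder is at most e h at the contributing nodes,
    and the derivatives of the weights sum to at most 2 / h in absolute value. *)
Lemma interp_derive_dist (e : R) (D : 'I_n -> R) i q : in_cube M q ->
  (forall q', (forall l, `|q' ord0 l - q ord0 l| <= 3 * h) ->
     `|zeta q' - zeta q - \sum_l (q' - q) ord0 l * D l| <= e * h) ->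
  `|\sum_(J : {ffun 'I_n -> 'I_N}) zeta (node J) * dweight i J q - D i| <= e * 2.
Proof.
move=> qM ze.
have -> : \sum_(J : {ffun 'I_n -> 'I_N}) zeta (node J) * dweight i J q - D i =
    \sum_(J : {ffun 'I_n -> 'I_N})
      (zeta (node J) - zeta q - \sum_l (node J - q) ord0 l * D l) * dweight i J q.
  under [RHS]eq_bigr do rewrite !mulrBl.
  rewrite !sumrB -(mulr_sumr _ _ _ (zeta q)) dweight_sum// mulr0 subr0; congr (_ - _).
  under eq_bigr do rewrite mulr_suml.
  have E l : \sum_J (node J - q) ord0 l * D l * dweight i J q = (l == i)%:R * D l.
    rewrite -(dweight_sum_coord i l qM) mulr_suml.
    by apply: eq_bigr => J _; rewrite mulrAC.
  rewrite exchange_big/= (eq_bigr _ (fun l _ => E l)) (bigD1 i)//= eqxx mul1r.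
  by rewrite [X in _ = _ + X]big1 ?addr0// => l /negbTE ->; rewrite mul0r.
have e0 : 0 <= e * h.
  apply: le_trans (ze q _) => // l.
  by rewrite subrr normr0 mulr_ge0// ltW.
apply: (le_trans (ler_norm_sum _ _ _)).
apply: (@le_trans _ _ (\sum_(J : {ffun 'I_n -> 'I_N}) (e * h) * `|dweight i J q|)); last first.
  rewrite -mulr_sumr.
  apply: le_trans (ler_wpM2l e0 (dweight_sum_norm i qM)) _.
  by rewrite (_ : e * h * (2 / h) = e * 2)//; field; rewrite gt_eqF.
apply: ler_sum => J _; rewrite normrM.
have [->|w0] := eqVneq (dweight i J q) 0; first by rewrite normr0 !mulr0.
by rewrite ler_wpM2r// ze//; exact: dweight_close w0.
Qed.

End quasi_interpolation.

Section test_approximation.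
Context {R : realType} {n : nat}.
Implicit Types (q v : 'rV[R]_n).

Lemma row_norm_le q (c : R) : 0 <= c -> (forall l, `|q ord0 l| <= c) -> `|q| <= c.
Proof.
move=> c0 qc; rewrite -[`|q|]/(mx_norm q).
have [->//|/mx_norm_neq0[[i j] ->]] := eqVneq (mx_norm q) 0.
by rewrite /= ord1.
Qed.

Lemma differentiable_first_order (u : 'rV[R]_n -> R) q : differentiable u q ->
  forall e : R, 0 < e -> exists2 d, 0 < d & forall q', `|q' - q| < d ->
    `|u q' - u q - \sum_l (q' - q) ord0 l * 'D_(delta_mx ord0 l) u q| <= e * `|q' - q|.
Proof.
move=> du e e0.
have /eqaddoP/(_ e e0)/nbhs_norm0P[d /= d0 dP] := diff_locally du.
exists d => // q' qd; have := dP (q' - q) qd.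
rewrite /= !fctE /= subrK opprD addrA -derive_partial// deriveE//.
Qed.

(** The third clause keeps the approximants near the support of [zeta], hence where [u] stays away
    from 0 and from a possible singularity of [h]. *)
Lemma test_approximation (zeta : 'rV[R]_n -> R) (M0 : R) :
  0 <= M0 -> class_C 1 zeta -> (forall q, 0 <= zeta q) -> cube_supported M0 zeta ->
  exists (Z : nat -> 'rV[R]_n -> R) (C : R),
   [/\ forall k, test_function (Z k) /\ (forall q, 0 <= Z k q),
       forall k, cube_supported (M0 + 1) (Z k),
       forall k q, Z k q != 0 ->
         exists2 q', zeta q' != 0 & forall l, `|q' ord0 l - q ord0 l| <= 3 / k.+3%:R,
       forall k q, `|Z k q| <= C /\ forall i, `|'D_(delta_mx ord0 i) (Z k) q| <= C
     & forall q, (Z k q @[k --> \oo] --> zeta q) /\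
        forall i, 'D_(delta_mx ord0 i) (Z k) q @[k --> \oo] --> 'D_(delta_mx ord0 i) zeta q].
Proof.
move=> M00 Czeta zeta_ge0 zeta_supp.
have [r [dr [[Cr drr] r_ge0 r_out r_sum]]] := @smooth_spline R.
have [dzeta cdzeta] := Czeta.
(* With A = M + 1, a point of the cube has q_i + A >= 1, so its index position is at least 1 / h >=
   3. The bound 3 h <= 1 also keeps contributing nodes in the cube of radius M + 1. *)
pose M := M0 + 1; pose A := M + 1; pose h k : R := k.+3%:R^-1.
have h0 k : 0 < h k by rewrite invr_gt0 ltr0n.
have h3 k : 3 * h k <= 1 by rewrite ler_pdivrMr ?ltr0n// mul1r ler_nat.
have M0M : M0 + 1 <= M by [].
have MA : 0 <= M + A by rewrite /A /M; lra.
pose N k := Num.bound ((M + A) / h k).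
have NP k : (M + A) / h k <= (N k)%:R by rewrite ltW// archi_boundP// divr_ge0// ltW.
have xb k q : in_cube M q -> forall i, 2 <= (h k)^-1 * q ord0 i + A / h k <= (N k)%:R.
  move=> qM i; have := qM i; rewrite ler_norml => /andP[q1 q2].
  have -> : (h k)^-1 * q ord0 i + A / h k = (q ord0 i + A) / h k by ring.
  apply/andP; split; last first.
    by apply: le_trans (NP k); rewrite ler_pM2r ?invr_gt0// lerD2r.
  rewrite ler_pdivlMr//; have := h3 k; have : 1 <= q ord0 i + A by rewrite /A; lra.
  by have := h0 k; lra.
pose Z k : 'rV[R]_n -> R := interp r zeta (h k) A (N k).
pose DZ i k q := \sum_(J : {ffun 'I_n -> 'I_(N k)})
   zeta (node (h k) A J) * dweight r dr (h k) A i J q.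
have dZ i k q : is_derive q (delta_mx ord0 i) (Z k) (DZ i k q).
  exact: isd_interp.
have DZE i k q : 'D_(delta_mx ord0 i) (Z k) q = DZ i k q by have [_ ->] := dZ i k q.
have sZ k : cube_supported M (Z k).
  exact: (interp_supported r_out A (N k) zeta_supp (h0 k) (h3 k) M0M).
have [L LP] := class_C1_lipschitz (M + 1) Czeta.
have [_ /(_ M)[Cz CzP]] := continuous_locally_bounded (class_C_continuous Czeta).
have zL k q : in_cube M q -> forall q', (forall l, `|q' ord0 l - q ord0 l| <= 3 * h k) ->
    `|zeta q' - zeta q| <= L * (3 * h k).
  move=> qM q' qq'; apply: LP => //; first by rewrite mulr_ge0// ltW.
    by move=> i; apply: le_trans (qM i) _; rewrite lerDl.
  move=> i; have -> : q' ord0 i = q ord0 i + (q' ord0 i - q ord0 i) by ring.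
  rewrite (le_trans (ler_normD _ _))// lerD ?qM//.
  exact: le_trans (qq' i) (h3 k).
have ID k q (qM : in_cube M q) := interp_dist r_ge0 r_out r_sum (h0 k) (xb k) qM (zL k q qM).
have h_small (e : R) : 0 < e -> \forall k \near \oo, h k < e.
  move=> e0; near=> k; apply: (@le_lt_trans _ _ k.+1%:R^-1).
    by rewrite lef_pV2 ?posrE ?ltr0n// ler_nat -addn2 leq_addr.
  by near: k; exact: (near_infty_natSinv_lt (PosNum e0)).
(* Values differ from those of [zeta] by at most 3 h L, and derivatives are bounded by (3 h L) (2 /
   h) = 6 L. *)
exists Z, (Num.max (Cz + `|L|) (6 * `|L|)); split => //.
- move=> k; split; last by move=> q; exact: interp_ge0.
  split; last exact: cube_supported_compact (sZ k).
  by move=> j; exact: class_C_interp.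
- move=> k q /(interp_near r_out (h0 k))[q' zq' qq'].
  by exists q' => // l; exact: qq'.
- move=> k q.
  have [qM|qM] := pselect (in_cube M q); last first.
    have C0 : 0 <= Num.max (Cz + `|L|) (6 * `|L|).
      by rewrite le_max [X in _ || X]mulr_ge0 ?orbT.
    rewrite (sZ k) ?normr0//; split => // i.
    by rewrite (cube_supported_derive _ (sZ k))// normr0.
  have [I1 I2] := ID k q qM; split.
    rewrite le_max; apply/orP; left.
    have -> : Z k q = zeta q + (Z k q - zeta q) by ring.
    rewrite (le_trans (ler_normD _ _))// lerD ?CzP//.
    apply: le_trans I1 _; apply: le_trans (ler_norm _) _.
    rewrite normrM ler_piMr// ger0_norm// mulr_ge0// ltW//.
  move=> i; rewrite DZE le_max; apply/orP; right.
  apply: le_trans (I2 i) _.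
  have -> : L * (3 * h k) * (2 / h k) = 6 * L by field; rewrite gt_eqF.
  by rewrite ler_pM2l// ler_norm.
- move=> q; have [qM|qM] := pselect (in_cube M q); last first.
    have sz : cube_supported M zeta by apply: cube_supported_le zeta_supp; rewrite lerDl.
    split=> [|i].
      by rewrite sz//; under eq_fun do rewrite sZ//; exact: cvg_cst.
    rewrite (cube_supported_derive _ sz)//.
    by under eq_fun do rewrite (cube_supported_derive _ (sZ _))//; exact: cvg_cst.
  split.
    apply/cvgrPdist_le => e e0; near=> k; rewrite distrC.
    apply: le_trans (ID k q qM).1 _.
    apply: (@le_trans _ _ ((`|L| * 3 + 1) * h k)).
      by rewrite mulrA ler_pM2r//; have := ler_norm L; lra.
    rewrite mulrC -ler_pdivlMr; last by rewrite ltr_pwDr// mulr_ge0.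
    by apply: ltW; near: k; apply: h_small; rewrite divr_gt0// ltr_pwDr// mulr_ge0.
  move=> i; apply/cvgrPdist_le => e e0.
  (* A remainder of (e / 6) 3 h against a total derivative mass of 2 / h leaves exactly e.
     Differentiability at the point [q] suffices for this. *)
  have e6 : 0 < e / 6 by rewrite divr_gt0.
  have [d d0 dP] := differentiable_first_order (dzeta q) e6.
  near=> k; rewrite distrC DZE.
  have -> : e = (e / 6 * 3) * 2 by field.
  apply: (interp_derive_dist r_ge0 r_out r_sum (h0 k) (xb k) i qM (D := fun l => 'D_(delta_mx ord0 l) zeta q)).
  move=> q' qq'.
  have nq : `|q' - q| <= 3 * h k.
    by apply: row_norm_le => [|l]; [rewrite mulr_ge0// ltW|rewrite !mxE].
  apply: le_trans (dP _ _) _; last by rewrite -(mulrA (e / 6)) ler_pM2l.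
  apply: le_lt_trans nq _; rewrite mulrC -ltr_pdivlMr//.
  by near: k; apply: h_small; rewrite divr_gt0.
Unshelve. all: by end_near. Qed.

End test_approximation.

(** * Horizontal vector fields and the p-Laplacian flux *)

Section horizontal_frame.
Context {R : realType} {m : nat}.
Implicit Types (u v zeta : heis R m -> R) (q : heis R m) (k : 'I_(m + m)).

(* The X_j and Y_j as a single family: (hZ k) is hX j for k = lshift m j and hY j for
   k = rshift m j. *)
Definition hcoef k q : R :=
  match fintype.split k with
  | inl j => 2 * q ord0 (iy j)
  | inr j => - (2 * q ord0 (ix j))
  end.

Definition hvec k q : heis R m :=
  delta_mx ord0 (lshift 1 k) + hcoef k q *: delta_mx ord0 it.

Definition hZ k u q : R :=
  partial (lshift 1 k) u q + hcoef k q * partial it u q.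

Lemma hgrad_dotE u v q : hgrad_dot u v q = \sum_k hZ k u q * hZ k v q.
Proof.
rewrite /hgrad_dot big_split_ord big_split/=; congr (_ + _); apply: eq_bigr => j _.
  by rewrite /hZ /hcoef (unsplitK (inl j : 'I_m + 'I_m)).
by rewrite /hZ /hcoef (unsplitK (inr j : 'I_m + 'I_m)) !mulNr.
Qed.

Lemma hgrad_dot_ge0 u q : 0 <= hgrad_dot u u q.
Proof. by rewrite hgrad_dotE sumr_ge0// => k _; rewrite -expr2 sqr_ge0. Qed.

Lemma hgrad_norm_ge0 u q : 0 <= hgrad_norm u q.
Proof. exact: sqrtr_ge0. Qed.

Lemma hgrad_norm_sqr u q : hgrad_norm u q ^+ 2 = hgrad_dot u u q.
Proof. by rewrite sqr_sqrtr// hgrad_dot_ge0. Qed.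

Lemma hZ_derive k u q : differentiable u q -> is_derive q (hvec k q) u (hZ k u q).
Proof.
move=> du; apply: DeriveDef; first exact: diff_derivable.
rewrite deriveE// /hvec linearD linearZ/= -!deriveE//.
Qed.

(** Freezing the vector field at [q] turns [hZ] into one directional derivative, to which the
    product and chain rules apply. *)
Lemma hZE k u q d : differentiable u q -> is_derive q (hvec k q) u d -> hZ k u q = d.
Proof. by move=> /(hZ_derive k)[_ <-] [_ <-]. Qed.

Lemma class_C_hcoef j k : class_C j (hcoef k).
Proof.
rewrite /hcoef; case: (fintype.split k) => i.
  by apply: class_CM; [exact: class_C_cst|exact: class_C_coord].
rewrite (_ : (fun q : heis R m => _) = (fun q : heis R m => (- 2) * q ord0 (ix i))).
  by apply: class_CM; [exact: class_C_cst|exact: class_C_coord].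
by apply/funext => q; rewrite mulNr.
Qed.

Lemma hcoef_continuous k : continuous (hcoef k).
Proof. exact: class_C_continuous (class_C_hcoef 0 k). Qed.

Lemma hZ_continuous k u : class_C 1 u -> continuous (hZ k u).
Proof.
move=> [du cu] q.
exact: (cvgD (cu _ q) (cvgM (@hcoef_continuous k q) (cu (delta_mx ord0 it) q))).
Qed.

Lemma hcoef_t k q : is_derive q (delta_mx ord0 it) (hcoef k) 0.
Proof.
rewrite /hcoef; case: (fintype.split k) => j.
  apply: is_derive_eq (isd_scale 2 (isd_coord (iy j) q (delta_mx ord0 it))) _.
  by rewrite mxE eqxx/= eq_lrshift mulr0.
apply: is_derive_eq (isd_opp (isd_scale 2 (isd_coord (ix j) q (delta_mx ord0 it)))) _.
by rewrite mxE eqxx/= eq_lrshift mulr0 oppr0.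
Qed.

(* X_j and Y_j are divergence free. *)
Lemma rVint_hZ k u M : class_C 1 u -> cube_supported M u -> rVint (hZ k u) = 0.
Proof.
move=> Cu su; have [du cu] := Cu.
have integ (w : heis R m) : cube_supported M ('D_w u).
  exact: cube_supported_derive su.
rewrite rVintD.
- rewrite (rVint_derive0 (class_C_continuous Cu) (cu (delta_mx ord0 (lshift 1 k))) su
    (fun q => class_C1P Cu q _)) add0r.
  (* The coefficient of the t-derivative does not depend on t, so this term is itself a
     t-derivative. *)
  have Cc := class_CM (class_C_hcoef 1 k) Cu.
  have dc q : is_derive q (delta_mx ord0 it) (fun q => hcoef k q * u q)
      (hcoef k q * partial it u q).
    apply: is_derive_eq (isd_mul (hcoef_t k q) (class_C1P Cu _ _)) _.
    by rewrite mul0r addr0.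
  apply: (rVint_derive0 (class_C_continuous Cc) _ _ dc (M := M)).
  + by move=> q; exact: (cvgM (@hcoef_continuous k q) (cu (delta_mx ord0 it) q)).
  + by move=> q qM; rewrite su// mulr0.
- split; first exact: continuous_locally_bounded (cu _).
  by exists M; exact: integ.
- apply: integrandM; first exact: continuous_locally_bounded (@hcoef_continuous k).
  split; first exact: continuous_locally_bounded (cu _).
  by exists M; exact: integ.
Qed.

Lemma cube_supported_hZ k u M : cube_supported M u -> cube_supported M (hZ k u).
Proof.
move=> su q qM; rewrite /hZ /partial !(cube_supported_derive _ su)//.
by rewrite mulr0 addr0.
Qed.

Lemma integrand_hZ k u M : class_C 1 u -> cube_supported M u -> integrand (hZ k u).
Proof.
move=> Cu su; split; last by exists M; exact: cube_supported_hZ.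
by apply: continuous_locally_bounded; exact: hZ_continuous.
Qed.

Lemma compact_cube_supported u : compactly_supported u -> exists M, cube_supported M u.
Proof.
move=> /compact_bounded[M [Mr MP]]; exists (M + 1) => q qM.
apply: contrapT => /eqP uq; apply: qM => i.
have M1 : M < M + 1 by rewrite ltrDl.
have uq' : closure [set q | u q != 0] q by exact: subset_closure.
apply: le_trans (MP (M + 1) M1 q uq').
rewrite [leRHS]/Num.norm /= mx_normrE; apply/bigmax_geP; right => /=.
by exists (ord0, i).
Qed.

End horizontal_frame.

(** * Solutions depending on x_1 only *)

Section existence.
Context {R : realType} {m : nat}.
Variables (p : R) (f h g : R -> R).
Hypotheses (m_ge1 : (1 <= m)%N) (p_gt1 : 1 < p)
  (f_cont : {within `[0, +oo[, continuous f})
  (f_incr : {in `[0, +oo[ &, {homo f : s t / s < t}})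
  (f_pos : forall t : R, 0 < t -> 0 < f t)
  (h_cont : {within `]0, +oo[, continuous h})
  (h_ge0 : forall t : R, 0 < t -> 0 <= h t)
  (g_cont : {within `[0, +oo[, continuous g})
  (g_ge0 : forall t : R, 0 <= t -> 0 <= g t).
Let q := p / (p - 1).

(** Since (q - 1)(p - 1) = 1, the maps y -> sg(y) |y|^(q-1) and t -> |t|^(p-2) t are inverse to each
    other; the flux of the profile is therefore its momentum. *)
Lemma sg_normr_powR (b : R) :
  `|Num.sg b * `|b| `^ (q - 1)| `^ (p - 2) * (Num.sg b * `|b| `^ (q - 1)) = b.
Proof.
have [->|b0] := eqVneq b 0; first by rewrite sgr0 mul0r mulr0.
have nb : 0 < `|b| by rewrite normr_gt0.
rewrite normrM normr_sg b0 mul1r ger0_norm ?powR_ge0// mulrCA.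
rewrite -powRrM -powRD; last by rewrite (gt_eqF nb) implybT.
have -> : (q - 1) * (p - 2) + (q - 1) = 1.
  by rewrite /q; field; rewrite gt_eqF// subr_gt0.
by rewrite powRr1// -numEsg.
Qed.

Lemma existence : ~ L1_at_pinfty (fun t => (KO_Kinv p (primitive0 f t))^-1) ->
  exists u : heis R m -> R,
    [/\ forall z, 0 <= u z, ~ (exists c : R, forall z, u z = c)
      & weak_solution p f h g u].
Proof.
move=> nKO.
have cf0 : continuous (fun s : R => f (Num.max s 0)).
  by apply: continuous_truncation f_cont => s; rewrite /= in_itv/= andbT.
have [F [F0 dF]] := continuous_primitive cf0.
(* The starting height 1 gives u >= 1, so that h(u) is continuous. *)
have [b [al [b0 al1 db dal]]] :=
  global_profile p_gt1 f_cont f_incr f_pos F0 dF ltr01 nKO.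
pose j0 : 'I_m := Ordinal m_ge1; pose k0 := lshift m j0.
pose i0 : 'I_(m + m + 1) := ix j0.
pose u (z : heis R m) := al (z ord0 i0).
pose dal' (x : R) := Num.sg (b x) * `|b x| `^ (q - 1).
have cb : continuous b by move=> x; exact: is_derive1_continuous (db x).
have al_gt0 x : 0 < al x := lt_le_trans ltr01 (al1 x).
have cal : continuous al by move=> x; exact: is_derive1_continuous (dal x).
have cfal : continuous (fun x => f (al x)).
  have -> : (fun x => f (al x)) = (fun x => f (Num.max (al x) 0)).
    by apply/funext => x; rewrite (max_idPl _)// ltW.
  move=> x; apply: (@continuous_comp R R R al (fun s : R => f (Num.max s 0))); [exact: cal|exact: cf0].
have q1 : 1 < q by exact: conjugate_gt1.
have cdal : continuous dal'.
  move=> x; apply: (@continuous_comp R R R b (fun y => Num.sg y * `|y| `^ (q - 1))).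
    exact: cb.
  by apply: continuous_sg_powR; rewrite subr_gt0.
have Cal : Ck 1 al by exists dal'.
have Cb : Ck 1 b by exists (fun x => f (al x)).
have Ccoord k : class_C k (fun z : heis R m => z ord0 i0) by exact: class_C_coord.
have Cu : class_C 1 u by exact: class_C_comp Cal (Ccoord 1%N).
have hvec0 k (z : heis R m) : hvec k z ord0 i0 = (k == k0)%:R.
  rewrite /hvec !mxE eqxx/= (inj_eq (@lshift_inj _ _)) eq_sym.
  by rewrite /i0 /ix eq_lrshift mulr0 addr0.
have du (z : heis R m) k : is_derive z (hvec k z) u (dal' (z ord0 i0) * (k == k0)%:R).
  by rewrite -(hvec0 k z); apply: isd_comp (dal _) _; exact: isd_coord.
have hZu k (z : heis R m) : hZ k u z = dal' (z ord0 i0) * (k == k0)%:R.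
  by apply: hZE; case: Cu.
have dotu v (z : heis R m) : hgrad_dot u v z = dal' (z ord0 i0) * hZ k0 v z.
  rewrite hgrad_dotE (bigD1 k0)//= hZu eqxx mulr1 big1 ?addr0// => k /negbTE kk0.
  by rewrite hZu kk0 mulr0 mul0r.
have normu (z : heis R m) : hgrad_norm u z = `|dal' (z ord0 i0)|.
  by rewrite /hgrad_norm dotu hZu eqxx mulr1 -expr2 sqrtr_sqr.
have b_gt0 x : 0 < x -> 0 < b x.
  move=> x0; rewrite -b0 (leW_mono (derive_gt0_incr db _))// => y.
  exact: f_pos.
exists u; split => [z||].
- exact: ltW (al_gt0 _).
- move=> [c uc].
  have dal0 : dal' 1 = 0.
    pose z := delta_mx ord0 i0 : heis R m.
    have := du z k0; have -> : u = (fun=> c) by apply/funext.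
    move=> [_]; rewrite derive_cst => /esym.
    by rewrite eqxx mulr1 /z mxE !eqxx.
  move: dal0; rewrite /dal' gtr0_sg ?b_gt0// mul1r => /powR_eq0_eq0/eqP.
  by rewrite normr_eq0 gt_eqF// b_gt0.
split => // zeta [Czeta szeta] zeta_ge0.
have [M zM] := compact_cube_supported szeta.
have iz : integrand zeta.
  by split; [exact: continuous_locally_bounded (Czeta 0%N)|exists M].
have lb (phi : R -> R) : continuous phi -> locally_bounded (fun z : heis R m => phi (z ord0 i0)).
  move=> cphi; apply: continuous_locally_bounded => z.
  by apply: (continuous_comp (Ccoord 0%N z)); exact: cphi.
have i1 : integrand (fun z : heis R m => f (u z) * zeta z).
  by apply: integrandM => //; exact: (lb _ cfal).
have chal : continuous (fun x => h (al x)).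
  have ch : continuous (fun s : R => h (Num.max s 1)).
    apply: continuous_truncation h_cont => s; rewrite /= in_itv/= andbT.
    exact: lt_le_trans.
  have -> : (fun x => h (al x)) = (fun x => h (Num.max (al x) 1)).
    by apply/funext => x; rewrite (max_idPl _).
  move=> x; apply: (@continuous_comp R R R al (fun s : R => h (Num.max s 1))); [exact: cal|exact: ch].
have cgal : continuous (fun x => g `|dal' x|).
  have cg : continuous (fun s : R => g (Num.max s 0)).
    by apply: continuous_truncation g_cont => s; rewrite /= in_itv/= andbT.
  have -> : (fun x => g `|dal' x|) = (fun x => g (Num.max `|dal' x| 0)).
    by apply/funext => x; rewrite (max_idPl _).
  move=> x; apply: (@continuous_comp R R R (fun x => `|dal' x|) (fun s : R => g (Num.max s 0))); last exact: cg.
  exact: (continuous_comp (cdal x) (@norm_continuous _ _ _)).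
have i2 : integrand (fun z : heis R m => (f (u z) - h (u z) * g (hgrad_norm u z)) * zeta z).
  apply: integrandM => //; apply: locally_boundedD; first exact: (lb _ cfal).
  apply: locally_boundedN; apply: locally_boundedM; first exact: (lb _ chal).
  by under eq_fun do rewrite normu; exact: (lb _ cgal).
have E (z : heis R m) : hgrad_norm u z `^ (p - 2) * hgrad_dot u zeta z = b (z ord0 i0) * hZ k0 zeta z.
  by rewrite normu dotu mulrA sg_normr_powR.
have Cbz : class_C 1 (fun z : heis R m => b (z ord0 i0) * zeta z).
  by apply: class_CM (Czeta 1%N); exact: class_C_comp Cb (Ccoord 1%N).
have dbz (z : heis R m) : hZ k0 (fun z : heis R m => b (z ord0 i0) * zeta z) z =
    b (z ord0 i0) * hZ k0 zeta z + f (u z) * zeta z.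
  apply: hZE; first by case: Cbz.
  have dz : is_derive z (hvec k0 z) zeta (hZ k0 zeta z).
    by apply: hZ_derive; case: (Czeta 1%N).
  have dbc := isd_comp (db (z ord0 i0)) (isd_coord i0 z (hvec k0 z)).
  apply: is_derive_eq (isd_mul dbc dz) _.
  by rewrite hvec0 eqxx mulr1.
have i3 : integrand (fun z : heis R m => b (z ord0 i0) * hZ k0 zeta z).
  apply: integrandM; first exact: lb.
  exact: integrand_hZ (Czeta 1%N) zM.
(* The integral of X_1(b zeta) vanishes, which gives equality with source f(u); the term h g is then
   dropped by its sign. *)
have I0 : rVint (fun z : heis R m => b (z ord0 i0) * hZ k0 zeta z) + rVint (fun z : heis R m => f (u z) * zeta z) = 0.
  rewrite -rVintD// -(rVint_hZ k0 Cbz (M := M)).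
    by congr rVint; apply/funext => z; rewrite dbz.
  by move=> z zM'; rewrite zM ?mulr0.
rewrite (_ : (fun z : heis R m => hgrad_norm u z `^ (p - 2) * _) = (fun z : heis R m => b (z ord0 i0) * hZ k0 zeta z)); last exact/funext.
rewrite !rVint_EFin// -EFinN lee_fin.
apply: le_trans (le_rVint i2 i1 _) _; last by lra.
move=> z; rewrite ler_wpM2r// gerBl mulr_ge0 ?h_ge0 ?g_ge0// ?hgrad_norm_ge0//.
exact: al_gt0.
Qed.

End existence.

(** * The p-Laplacian flux: bounds and monotonicity *)

Section flux.
Context {R : realType} {m : nat}.
Variables (p : R) (p_gt1 : 1 < p).
Implicit Types (u v zeta : heis R m -> R) (q : heis R m) (k : 'I_(m + m)).

Definition flux k u q : R := hgrad_norm u q `^ (p - 2) * hZ k u q.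

Lemma flux_dotE u v q :
  hgrad_norm u q `^ (p - 2) * hgrad_dot u v q = \sum_k flux k u q * hZ k v q.
Proof.
by rewrite hgrad_dotE mulr_sumr; apply: eq_bigr => k _; rewrite /flux mulrA.
Qed.

Lemma hZ_le_hgrad_norm k u q : `|hZ k u q| <= hgrad_norm u q.
Proof.
rewrite -sqrtr_sqr ler_wsqrtr// hgrad_dotE (bigD1 k)//= expr2 lerDl.
by apply: sumr_ge0 => j _; rewrite -expr2 sqr_ge0.
Qed.

Lemma hgrad_norm0_hZ k u q : hgrad_norm u q = 0 -> hZ k u q = 0.
Proof.
by move=> u0; apply/eqP; rewrite -normr_eq0 eq_le normr_ge0 -u0 hZ_le_hgrad_norm.
Qed.

(** At t = 0 the factor [t] absorbs the value of 0 to the power p - 2, so degenerate points need no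
    separate treatment. *)
Lemma powR_pred2 (t : R) : 0 <= t -> t `^ (p - 2) * t = t `^ (p - 1).
Proof.
move=> t0; rewrite mulrC (_ : p - 2 = p - 1 - 1); last by ring.
by rewrite mulr_powRB1// subr_gt0.
Qed.

Lemma flux_le k u q : `|flux k u q| <= hgrad_norm u q `^ (p - 1).
Proof.
rewrite /flux normrM (ger0_norm (powR_ge0 _ _)) -powR_pred2 ?hgrad_norm_ge0//.
by rewrite ler_wpM2l ?powR_ge0// hZ_le_hgrad_norm.
Qed.

Lemma flux_self u q : \sum_k flux k u q * hZ k u q = hgrad_norm u q `^ p.
Proof.
rewrite -flux_dotE -hgrad_norm_sqr expr2 mulrA powR_pred2 ?hgrad_norm_ge0//.
by rewrite mulrC mulr_powRB1 ?hgrad_norm_ge0// (lt_trans ltr01).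
Qed.

Lemma hgrad_norm_continuous u : class_C 1 u -> continuous (hgrad_norm u).
Proof.
move=> Cu; have cs : continuous (fun q => \sum_k hZ k u q * hZ k u q).
  apply: (class_C_continuous (k := 0)); apply: class_C_sum => k.
  by apply: class_CM; exact: hZ_continuous.
rewrite (_ : hgrad_norm u = (@Num.sqrt R) \o (fun q => \sum_k hZ k u q * hZ k u q)); last first.
  by apply/funext => q; rewrite /hgrad_norm hgrad_dotE.
by move=> q; apply: continuous_comp; [exact: cs|exact: sqrt_continuous].
Qed.

Lemma flux_locally_bounded k u : class_C 1 u -> locally_bounded (flux k u).
Proof.
move=> Cu; have cn := hgrad_norm_continuous Cu.
split=> [|M].
  apply: measurable_funM.
    apply: (@measurableT_comp _ _ _ _ _ _ ((@powR R) ^~ (p - 2)) _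
      (fun w : (m + m + 1).-tuple R => hgrad_norm u (\row_i tnth w i))).
      exact: measurable_powR.
    exact: continuous_row_measurable cn.
  exact: continuous_row_measurable (@hZ_continuous _ _ k _ Cu).
have [_ /(_ M)[C CP]] := continuous_locally_bounded cn.
exists (`|C| `^ (p - 1)) => q qM; apply: le_trans (flux_le _ _ _) _.
apply: ge0_ler_powR; rewrite ?nnegrE ?hgrad_norm_ge0 ?subr_ge0 ?(ltW p_gt1)//.
by apply: le_trans (ler_norm _) (le_trans (CP q qM) (ler_norm _)).
Qed.

Lemma hgrad_dot_le u v q : hgrad_dot u v q <= hgrad_norm u q * hgrad_norm v q.
Proof.
have [u0|u0] := eqVneq (hgrad_norm u q) 0.
  rewrite u0 mul0r hgrad_dotE big1// => k _.
  by rewrite (hgrad_norm0_hZ k u0) mul0r.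
have [v0|v0] := eqVneq (hgrad_norm v q) 0.
  rewrite v0 mulr0 hgrad_dotE big1// => k _.
  by rewrite (hgrad_norm0_hZ k v0) mulr0.
have uv : 0 < hgrad_norm u q * hgrad_norm v q.
  by rewrite mulr_gt0// lt_neqAle eq_sym ?u0 ?v0 hgrad_norm_ge0.
(* With A, B the norms of the gradients of u, v, multiplying by 2 A B reduces the claim to the
   nonnegativity of the sum of the squares (B Z_k u - A Z_k v)^2. *)
rewrite -(ler_pM2l (mulr_gt0 (ltr0Sn R 1) uv)).
have -> : (1 + 1) * (hgrad_norm u q * hgrad_norm v q) * (hgrad_norm u q * hgrad_norm v q) =
    hgrad_norm v q ^+ 2 * hgrad_dot u u q + hgrad_norm u q ^+ 2 * hgrad_dot v v q.
  by rewrite -!hgrad_norm_sqr; ring.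
rewrite !hgrad_dotE !mulr_sumr -big_split/=; apply: ler_sum => k _.
rewrite -subr_ge0.
have -> : hgrad_norm v q ^+ 2 * (hZ k u q * hZ k u q) + hgrad_norm u q ^+ 2 * (hZ k v q * hZ k v q) -
  (1 + 1) * (hgrad_norm u q * hgrad_norm v q) * (hZ k u q * hZ k v q) =
  (hgrad_norm v q * hZ k u q - hgrad_norm u q * hZ k v q) ^+ 2 by ring.
exact: sqr_ge0.
Qed.

Lemma hgrad_dotC u v q : hgrad_dot u v q = hgrad_dot v u q.
Proof. by rewrite !hgrad_dotE; apply: eq_bigr => k _; rewrite mulrC. Qed.

(** The coefficient of the inner product is nonpositive, so Cauchy-Schwarz reduces the claim to
    (A^(p-1) - B^(p-1)) (A - B) >= 0 for the two norms. *)
Lemma flux_monotone u v q :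
  0 <= \sum_k (flux k u q - flux k v q) * (hZ k u q - hZ k v q).
Proof.
have -> : \sum_k (flux k u q - flux k v q) * (hZ k u q - hZ k v q) =
  hgrad_norm u q `^ (p - 2) * hgrad_norm u q ^+ 2 + hgrad_norm v q `^ (p - 2) * hgrad_norm v q ^+ 2
  - (hgrad_norm u q `^ (p - 2) + hgrad_norm v q `^ (p - 2)) * hgrad_dot u v q.
  rewrite (eq_bigr (fun k => (flux k u q * hZ k u q + flux k v q * hZ k v q) -
      (flux k u q * hZ k v q + flux k v q * hZ k u q))) => [|k _]; last first.
    by move: (flux k u q) (flux k v q) (hZ k u q) (hZ k v q) => A B x y; ring.
  rewrite sumrB !big_split/= -!flux_dotE (hgrad_dotC v u) -!hgrad_norm_sqr.
  by rewrite mulrDl.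
have := hgrad_dot_le u v q.
have := hgrad_norm_ge0 v q; have := hgrad_norm_ge0 u q.
move: (hgrad_norm u q) (hgrad_norm v q) (hgrad_dot u v q) => A B d A0 B0 AB.
have pAB : 0 <= A `^ (p - 2) + B `^ (p - 2) by rewrite addr_ge0 ?powR_ge0.
apply: le_trans (_ : 0 <= (A `^ (p - 1) - B `^ (p - 1)) * (A - B)) _.
  have mono (s t : R) : 0 <= s -> s <= t -> s `^ (p - 1) <= t `^ (p - 1).
    move=> s0 st; apply: ge0_ler_powR; rewrite ?nnegrE ?subr_ge0 ?(ltW p_gt1)//.
    exact: le_trans st.
  have [AB'|/ltW BA'] := leP A B.
    by apply: mulr_le0; rewrite subr_le0//; exact: mono.
  by apply: mulr_ge0; rewrite subr_ge0//; exact: mono.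
have := ler_wpM2l pAB AB; rewrite -!powR_pred2//.
have -> : (A `^ (p - 2) * A - B `^ (p - 2) * B) * (A - B) =
  A `^ (p - 2) * A ^+ 2 + B `^ (p - 2) * B ^+ 2 - (A `^ (p - 2) + B `^ (p - 2)) * (A * B) by ring.
lra.
Qed.

End flux.

Lemma cvg_sumR {R : realType} {T I : Type} (G : set_system T) {FG : Filter G}
    (r : seq I) (f : I -> T -> R) (l : I -> R) :
  (forall i, f i x @[x --> G] --> l i) ->
  \sum_(i <- r) f i x @[x --> G] --> \sum_(i <- r) l i.
Proof.
move=> fl; elim: r => [|i r IH].
  by rewrite big_nil; under eq_fun do rewrite big_nil; exact: cvg_cst.
by rewrite big_cons; under eq_fun do rewrite big_cons; exact: cvgD (fl i) IH.
Qed.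

(** * The weak inequality for C^1 test functions supported where u is positive *)

Section weak_inequality_C1.
Context {R : realType} {m : nat}.
Variables (p : R) (f h g : R -> R).
Hypotheses (p_gt1 : 1 < p)
  (f_cont : {within `[0, +oo[, continuous f})
  (h_cont : {within `]0, +oo[, continuous h})
  (g_cont : {within `[0, +oo[, continuous g}).
Variable u : heis R m -> R.
Hypotheses (u_ge0 : forall z, 0 <= u z) (u_sol : weak_solution p f h g u).

Let Cu : class_C 1 u. Proof. by case: u_sol. Qed.

(** [h] may be unbounded near 0; truncating its argument restores local bounds and changes nothing
    where u >= c. *)
Lemma source_locally_bounded (c : R) : 0 < c ->
  locally_bounded (fun z => f (u z) - h (Num.max (u z) c) * g (hgrad_norm u z)).
Proof.
move=> c0; have cu := class_C_continuous Cu.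
have cfu : continuous (fun z => f (u z)).
  have cf : continuous (fun s : R => f (Num.max s 0)).
    by apply: continuous_truncation f_cont => s; rewrite /= in_itv/= andbT.
  rewrite (_ : (fun z => f (u z)) = (fun s => f (Num.max s 0)) \o u).
    by move=> z; apply: continuous_comp; [exact: cu|exact: cf].
  by apply/funext => z /=; rewrite (max_idPl _).
have cgu : continuous (fun z => g (hgrad_norm u z)).
  have cg : continuous (fun s : R => g (Num.max s 0)).
    by apply: continuous_truncation g_cont => s; rewrite /= in_itv/= andbT.
  rewrite (_ : (fun z => g (hgrad_norm u z)) = (fun s => g (Num.max s 0)) \o hgrad_norm u).
    by move=> z; apply: continuous_comp; [exact: hgrad_norm_continuous|exact: cg].
  by apply/funext => z /=; rewrite (max_idPl _)// hgrad_norm_ge0.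
have chu : continuous (fun z => h (Num.max (u z) c)).
  have ch : continuous (fun s : R => h (Num.max s c)).
    apply: continuous_truncation h_cont => s; rewrite /= in_itv/= andbT.
    exact: lt_le_trans.
  by move=> z; exact: (@continuous_comp _ R R u (fun s => h (Num.max s c)) z (cu z) (ch (u z))).
apply: locally_boundedD; first exact: continuous_locally_bounded.
apply: locally_boundedN; apply: locally_boundedM; exact: continuous_locally_bounded.
Qed.

Lemma rVint_limit_le (S : heis R m -> R) (W : 'I_(m + m) -> heis R m -> R)
    (zeta : heis R m -> R) (Z : nat -> heis R m -> R) (M C : R) :
  locally_bounded S -> (forall k, locally_bounded (W k)) ->
  (forall j, class_C 1 (Z j)) -> (forall j, cube_supported M (Z j)) ->
  (forall j q, `|Z j q| <= C /\ forall i, `|'D_(delta_mx ord0 i) (Z j) q| <= C) ->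
  (forall q, (Z j q @[j --> \oo] --> zeta q) /\
     forall i, 'D_(delta_mx ord0 i) (Z j) q @[j --> \oo] --> 'D_(delta_mx ord0 i) zeta q) ->
  (forall j, rVint (fun q => S q * Z j q) <= - rVint (fun q => \sum_k W k q * hZ k (Z j) q)) ->
  rVint (fun q => S q * zeta q) <= - rVint (fun q => \sum_k W k q * hZ k zeta q).
Proof.
move=> bS bW CZ sZ bZ cZ ineq.
have C0 : 0 <= C by apply: le_trans (bZ 0%N 0).1.
have [_ /(_ M)[CS CSP]] := bS.
have hb k := continuous_locally_bounded (@hcoef_continuous R m k).
have /choice[CW CWP] : forall k : 'I_(m + m), exists CW : R, forall q, in_cube M q -> `|W k q| <= CW.
  by move=> k; have [_ /(_ M)] := bW k.
have /choice[CH CHP] : forall k : 'I_(m + m), exists CH : R, forall q, in_cube M q -> `|hcoef k q| <= CH.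
  by move=> k; have [_ /(_ M)] := hb k.
have iZ j : integrand (Z j).
  split; last by exists M.
  by apply: continuous_locally_bounded; exact: class_C_continuous (CZ j).
have [i1 l1] : integrand (fun q => S q * zeta q) /\
    (rVint (fun q => S q * Z j q) @[j --> \oo] --> rVint (fun q => S q * zeta q)).
  apply: (@rVint_dominated _ _ _ _ M (CS * C)).
  - by move=> j; exact: integrandM.
  - by move=> j q qM; rewrite sZ// mulr0.
  - by move=> j q qM; rewrite normrM ler_pM// ?CSP// (bZ j q).1.
  - by move=> q; apply: cvgMl_tmp; exact: (cZ q).1.
have hZb j k q : in_cube M q -> `|hZ k (Z j) q| <= C + CH k * C.
  move=> qM; rewrite /hZ (le_trans (ler_normD _ _))// lerD ?(bZ j q).2//.
  by rewrite normrM ler_pM// ?CHP// (bZ j q).2.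
have i2' j : integrand (fun q => \sum_k W k q * hZ k (Z j) q).
  by apply: integrand_sum => k; apply: integrandM => //; exact: integrand_hZ (CZ j) (sZ j).
have [i2 l2] : integrand (fun q => \sum_k W k q * hZ k zeta q) /\
    (rVint (fun q => \sum_k W k q * hZ k (Z j) q) @[j --> \oo] -->
     rVint (fun q => \sum_k W k q * hZ k zeta q)).
  apply: (@rVint_dominated _ _ _ _ M (\sum_k CW k * (C + CH k * C))) => //.
  - move=> j q qM; apply: big1 => k _.
    by rewrite (cube_supported_hZ k (sZ j))// mulr0.
  - move=> j q qM; rewrite (le_trans (ler_norm_sum _ _ _))//.
    by apply: ler_sum => k _; rewrite normrM ler_pM// ?CWP// hZb.
  - move=> q; apply: cvg_sumR => k; apply: cvgMl_tmp.
    by apply: cvgD; [exact: (cZ q).2|apply: cvgMl_tmp; exact: (cZ q).2].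
apply: (ler_cvg_to l1 (cvgN l2)).
by apply: nearW.
Qed.

Lemma weak_inequality_C1 (a M0 : R) (zeta : heis R m -> R) : 0 < a -> 0 <= M0 ->
  class_C 1 zeta -> (forall q, 0 <= zeta q) -> cube_supported M0 zeta ->
  (forall q, zeta q != 0 -> a <= u q) ->
  rVint (fun q => (f (u q) - h (Num.max (u q) (a / 2)) * g (hgrad_norm u q)) * zeta q) <=
  - rVint (fun q => \sum_k flux p k u q * hZ k zeta q).
Proof.
move=> a0 M00 Cz z0 sz za; have a20 : 0 < a / 2 by rewrite divr_gt0.
have [Z [C [tZ sZ nZ bZ cZ]]] := test_approximation M00 Cz z0 sz.
have [L LP] := class_C1_lipschitz (M0 + 2) Cu.
(* Dropping the first [K] approximants makes their supports so close to that of [zeta] that, by the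
   Lipschitz bound, [u] loses at most a / 2 and stays above a / 2. *)
have [K KP] : exists K : nat, forall j : nat, L * (3 / (j + K).+3%:R) <= a / 2.
  have [K KP] : exists K : nat, 6 * `|L| / a < K%:R.
    exists (Num.bound (6 * `|L| / a)).
    by apply: archi_boundP; rewrite divr_ge0 ?(ltW a0)// mulr_ge0.
  exists K => j; have jK : (K%:R : R) <= (j + K).+3%:R by rewrite ler_nat (leq_trans (leq_addl j K))// -addn3 leq_addr.
  have j0 : 0 < (j + K).+3%:R :> R by rewrite ltr0n.
  rewrite mulrA ler_pdivrMr//.
  have := ler_wpM2l (ltW a0) jK; have := ler_norm L.
  move: KP; rewrite ltr_pdivrMr//; lra.
have uZ j q : Z (j + K)%N q != 0 -> a / 2 <= u q.
  move=> Zq; have [q' zq' qq'] := nZ _ _ Zq.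
  have q'M : in_cube M0 q' by apply: contrapT => H; move/eqP: zq'; apply; exact: sz.
  have qM : in_cube (M0 + 1) q by apply: contrapT => H; move/eqP: Zq; apply; exact: sZ.
  have c1 : in_cube (M0 + 2) q.
    by move=> i; rewrite (le_trans (qM i))// lerD2l ler1n.
  have c2 : in_cube (M0 + 2) q' by move=> i; rewrite (le_trans (q'M i))// lerDl.
  have d0 : 0 <= 3 / (j + K).+3%:R :> R by rewrite divr_ge0.
  have := le_trans (ler_norm _) (LP q q' _ d0 c1 c2 qq').
  have := za _ zq'; have := KP j; move: (L * _) (u q) (u q') => X s t; lra.
apply: (@rVint_limit_le _ _ zeta (fun j => Z (j + K)%N) (M0 + 1) C) => //.
- exact: source_locally_bounded.
- by move=> k; exact: flux_locally_bounded.
- by move=> j; exact: (tZ _).1.1 1%N.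
- by move=> q; have [c1 c2] := cZ q; split => [|i]; [have := c1|have := c2 i]; rewrite -(cvg_shiftn K).
move=> j; have [[CZ _] Z0] := tZ (j + K)%N.
have iZ : integrand (Z (j + K)%N).
  split; last by exists (M0 + 1).
  by apply: continuous_locally_bounded; exact: class_C_continuous (CZ 0%N).
have i1 : integrand (fun q => (f (u q) - h (Num.max (u q) (a / 2)) * g (hgrad_norm u q)) * Z (j + K)%N q).
  by apply: integrandM => //; exact: source_locally_bounded.
have i2 : integrand (fun q => \sum_k flux p k u q * hZ k (Z (j + K)%N) q).
  apply: integrand_sum => k; apply: integrandM; first exact: flux_locally_bounded.
  exact: integrand_hZ (CZ 1%N) (sZ _).
have [_ /(_ _ (tZ (j + K)%N).1 Z0)] := u_sol.
rewrite (_ : (fun q => (f (u q) - h (u q) * g (hgrad_norm u q)) * _) =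
  (fun q => (f (u q) - h (Num.max (u q) (a / 2)) * g (hgrad_norm u q)) * Z (j + K)%N q)); last first.
  apply/funext => q; have [->|/uZ uq] := eqVneq (Z (j + K)%N q) 0; first by rewrite !mulr0.
  by rewrite (max_idPl uq).
rewrite (_ : (fun q => hgrad_norm u q `^ (p - 2) * _) =
  (fun q => \sum_k flux p k u q * hZ k (Z (j + K)%N) q)); last first.
  by apply/funext => q; exact: flux_dotE.
by rewrite !rVint_EFin// -EFinN lee_fin.
Qed.

End weak_inequality_C1.

(** * Removal of the gradient term *)

Section gradient_term_removal.
Context {R : realType} {m : nat}.
Variables (p : R) (f h g : R -> R).
Hypotheses (p_gt1 : 1 < p)
  (f_cont : {within `[0, +oo[, continuous f})
  (f_incr : {in `[0, +oo[ &, {homo f : s t / s < t}})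
  (f_pos : forall t : R, 0 < t -> 0 < f t)
  (h_cont : {within `]0, +oo[, continuous h})
  (h_ge0 : forall t : R, 0 < t -> 0 <= h t)
  (h_L1 : lebesgue_measure.-integrable `]0, +oo[ (EFin \o h))
  (g_cont : {within `[0, +oo[, continuous g})
  (g_bound : exists2 D : R, 0 < D &
    forall s t : R, 0 <= s <= 1 -> 0 < t ->
      g (s * t) <= D * s * t ^+ 2 * derive1 (phi p) t).

(** The case s = 1 of [g_bound] covers t > 0; the case s = 0 gives g(0) <= 0. *)
Lemma gradient_bound : exists2 D, 0 <= D & forall t, 0 <= t -> g t <= (p - 1) * D * t `^ p.
Proof.
have [D D0 gD] := g_bound; exists D => [|t]; first exact: ltW.
rewrite le_eqVlt => /predU1P[<-|t0].
  have := gD 0 1; rewrite lexx ler01 ltr01 !mul0r mulr0 !mul0r => /(_ isT isT) g0.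
  by rewrite powR0 ?mulr0// gt_eqF// (lt_trans ltr01).
have := gD 1 t; rewrite ler01 lexx t0 mul1r mulr1 => /(_ isT isT) /le_trans; apply.
rewrite phi_derive1// le_eqVlt; apply/orP; left; apply/eqP.
have -> : D * t ^+ 2 * ((p - 1) * t `^ (p - 2)) = (p - 1) * D * (t * (t * t `^ (p - 1 - 1))).
  by rewrite (_ : p - 1 - 1 = p - 2); ring.
by rewrite !mulr_powRB1 ?(ltW t0) ?subr_gt0// (lt_trans ltr01).
Qed.

Variable u : heis R m -> R.
Hypotheses (u_ge0 : forall z, 0 <= u z) (u_sol : weak_solution p f h g u).
Variables (a : R) (a_gt0 : 0 < a).

Let Cu : class_C 1 u. Proof. by case: u_sol. Qed.

Lemma potential_bounded (D : R) : 0 <= D -> exists (H : R -> R) (B : R),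
  [/\ H a = 0, forall s, H s <= B, {homo H : x y / x <= y} &
      forall s : R, is_derive s 1 H (D * h (Num.max s a))].
Proof.
move=> D0; have ch : continuous (fun s : R => h (Num.max s a)).
  apply: continuous_truncation h_cont => s; rewrite /= in_itv/= andbT.
  exact: lt_le_trans.
have h0 s : 0 <= h (Num.max s a) by rewrite h_ge0// lt_max a_gt0 orbT.
have [I [_ dI]] := continuous_primitive ch.
have [B IB] : exists B, forall s, I s <= B.
  apply/(integrable_pinfty_boundedP a ch h0 dI).
  have : lebesgue_measure.-integrable `[a, +oo[ (EFin \o h).
    apply: integrableS h_L1 => //.
    by apply: subset_itvr; rewrite bnd_simp.
  apply: eq_integrable => //.
  by move=> s; rewrite inE/= in_itv/= andbT => as_; rewrite (max_idPl as_).
have dH (s : R) : is_derive s 1 (fun s => D * (I s - I a)) (D * h (Num.max s a)).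
  apply: isd_scale; apply: is_derive_eq (isd_sub (dI s) (isd_cst (I a) s 1)) _.
  by rewrite subr0.
exists (fun s => D * (I s - I a)), (D * (B - I a)); split => //.
- by rewrite subrr mulr0.
- by move=> s; rewrite ler_wpM2l// lerB.
- by apply: derive_ge0_ndecr dH _ => s; rewrite mulr_ge0.
Qed.

(* Substituting [v = psi u] with [psi' = exp (H - H(oo))], [H' = D h], turns the
   gradient term into a nonnegative one. *)
Lemma gradient_term_removal : exists (psi : R -> R) (sigma : R),
  [/\ 0 < sigma, Ck 1 psi, psi a = a /\ (forall s, a <= s -> psi s <= s),
      {mono psi : x y / x <= y} &
    forall (eta : heis R m -> R) (M0 : R), 0 <= M0 -> class_C 1 eta ->
      (forall z, 0 <= eta z) -> cube_supported M0 eta ->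
      (forall z, eta z != 0 -> a <= u z) ->
      rVint (fun z => sigma * f (Num.max (psi (u z)) 0) * eta z +
         \sum_k flux p k (fun z => psi (u z)) z * hZ k eta z) <= 0].
Proof.
have [D D0 gD] := gradient_bound.
have [H [B [Ha HB ndH dH]]] := potential_bounded D0.
pose hb s := h (Num.max s a).
(* [lam] is psi', and [om] = lam^(p-1) is the factor by which the flux scales when [u] is replaced
   by psi(u). *)
pose lam s := expR (H s - B); pose om s := expR ((p - 1) * (H s - B)).
have p10 : 0 < p - 1 by rewrite subr_gt0.
have dlam (s : R) : is_derive s 1 lam (lam s * (D * hb s)).
  apply: (@isd_comp R _ expR (fun s => H s - B)).
  by apply: is_derive_eq (isd_sub (dH s) (isd_cst B s 1)) _; rewrite subr0.
have dom (s : R) : is_derive s 1 om (om s * ((p - 1) * (D * hb s))).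
  apply: (@isd_comp R _ expR (fun s => (p - 1) * (H s - B))).
  apply: isd_scale.
  by apply: is_derive_eq (isd_sub (dH s) (isd_cst B s 1)) _; rewrite subr0.
have ch : continuous hb.
  apply: continuous_truncation h_cont => s; rewrite /= in_itv/= andbT.
  exact: lt_le_trans.
have hb0 s : 0 <= hb s by rewrite /hb h_ge0// lt_max a_gt0 orbT.
have clam : continuous lam by move=> s; exact: is_derive1_continuous (dlam s).
have com : continuous om by move=> s; exact: is_derive1_continuous (dom s).
have [P [_ dP]] := continuous_primitive clam.
pose psi s := P s + (a - P a).
have dpsi (s : R) : is_derive s 1 psi (lam s).
  by apply: is_derive_eq (isd_add (dP s) (isd_cst (a - P a) s 1)) _; rewrite addr0.
have Cpsi : Ck 1 psi by exists lam.
have Com : Ck 1 om.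
  exists (fun s => om s * ((p - 1) * (D * hb s))) => // s.
  by apply: cvgM (com s) _; do 2 apply: cvgMl_tmp; exact: ch.
have lam1 s : lam s <= 1 by rewrite /lam expR_le1 subr_le0.
have psia : psi a = a by rewrite /psi addrC subrK.
have psi_le s : a <= s -> psi s <= s.
  move=> as_; have := derive_le_sub as_ (fun x _ => dpsi x) (fun x _ => is_derive_id x 1) (fun x _ => lam1 x).
  by rewrite psia lerD2r.
have mpsi : {mono psi : x y / x <= y}.
  by apply: derive_gt0_incr dpsi _ => s; exact: expR_gt0.
(* Since H(a) = 0 and H is nondecreasing, this is the least value of [om] on {u >= a}. *)
exists psi, (expR ((p - 1) * (0 - B))); split => //; first exact: expR_gt0.
move=> eta M0 M00 Ce e0 se ea.
pose v z := psi (u z); pose N z := hgrad_norm u z.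
have Cv : class_C 1 v by exact: class_C_comp.
have [[du _] [[dv _] [de _]]] := conj Cu (conj Cv Ce).
have hZv k z : hZ k v z = lam (u z) * hZ k u z.
  apply: hZE; first exact: dv.
  exact: isd_comp (dpsi _) (hZ_derive k (du z)).
have Nv z : hgrad_norm v z = lam (u z) * N z.
  rewrite /N /hgrad_norm -[X in X * _](@ger0_norm R (lam (u z))) ?expR_ge0//.
  rewrite -sqrtr_sqr -sqrtrM ?sqr_ge0// !hgrad_dotE mulr_sumr; congr Num.sqrt.
  by apply: eq_bigr => k _; rewrite !hZv; ring.
have fluxv k z : flux p k v z = om (u z) * flux p k u z.
  rewrite /flux Nv hZv powRM ?expR_ge0 ?hgrad_norm_ge0//.
  have -> : om (u z) = lam (u z) `^ (p - 1) by rewrite /om mulrC expRM.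
  rewrite -(powR_pred2 p_gt1 (expR_ge0 (H (u z) - B))) -/(lam (u z)) -/(N z).
  by ring.
(* With this test function, differentiating om(u) produces (p - 1) D h(u) |grad u|^p om(u) eta,
   which dominates the term with h g. *)
pose zeta z := om (u z) * eta z.
have Cz : class_C 1 zeta by apply: class_CM => //; exact: class_C_comp.
have z0 z : 0 <= zeta z by rewrite mulr_ge0 ?expR_ge0.
have sz : cube_supported M0 zeta by move=> z zM; rewrite /zeta se ?mulr0.
have za z : zeta z != 0 -> a <= u z.
  by rewrite mulf_eq0 negb_or => /andP[_]; exact: ea.
have hZz k z : hZ k zeta z = om (u z) * hZ k eta z +
    om (u z) * ((p - 1) * (D * hb (u z))) * hZ k u z * eta z.
  apply: hZE; first by case: Cz.
  have dou : is_derive z (hvec k z) (fun z => om (u z))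
      (om (u z) * ((p - 1) * (D * hb (u z))) * hZ k u z).
    exact: isd_comp (dom _) (hZ_derive k (du z)).
  exact: isd_mul dou (hZ_derive k (de z)).
have ineq := weak_inequality_C1 p_gt1 f_cont h_cont g_cont u_ge0 u_sol a_gt0 M00 Cz z0 sz za.
have i1 : integrand (fun z => (f (u z) - h (Num.max (u z) (a / 2)) * g (hgrad_norm u z)) * zeta z).
  apply: integrandM; first exact: (source_locally_bounded f_cont h_cont g_cont u_ge0 u_sol (divr_gt0 a_gt0 (ltr0n _ 2))).
  split; last by exists M0.
  by apply: continuous_locally_bounded; exact: class_C_continuous Cz.
have i2 : integrand (fun z => \sum_k flux p k u z * hZ k zeta z).
  apply: integrand_sum => k; apply: integrandM; first exact: flux_locally_bounded.
  exact: integrand_hZ Cz sz.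
have i3 : integrand (fun z => expR ((p - 1) * (0 - B)) * f (Num.max (psi (u z)) 0) * eta z).
  apply: integrandM; last first.
    split; last by exists M0.
    by apply: continuous_locally_bounded; exact: class_C_continuous Ce.
  apply: locally_boundedM; first exact: locally_bounded_cst.
  apply: continuous_locally_bounded.
  have cf : continuous (fun s : R => f (Num.max s 0)).
    by apply: continuous_truncation f_cont => s; rewrite /= in_itv/= andbT.
  have cv := class_C_continuous Cv.
  rewrite (_ : (fun z => f _) = (fun s : R => f (Num.max s 0)) \o v)//.
  by move=> z; apply: continuous_comp; [exact: cv|exact: cf].
have i4 : integrand (fun z => \sum_k flux p k v z * hZ k eta z).
  apply: integrand_sum => k; apply: integrandM; first exact: flux_locally_bounded.
  exact: integrand_hZ Ce se.
have le0 : rVint (fun z => (f (u z) - h (Num.max (u z) (a / 2)) * g (hgrad_norm u z)) * zeta z +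
    \sum_k flux p k u z * hZ k zeta z) <= 0.
  by rewrite rVintD//; move: ineq; lra.
apply: le_trans _ le0.
apply: le_rVint; [exact: integrandD|exact: integrandD|move=> z].
have -> : \sum_k flux p k u z * hZ k zeta z = \sum_k flux p k v z * hZ k eta z +
    om (u z) * ((p - 1) * (D * hb (u z))) * eta z * N z `^ p.
  rewrite -(flux_self p_gt1) mulr_sumr -big_split/=; apply: eq_bigr => k _.
  rewrite hZz fluxv.
  move: (flux p k u z) (hZ k u z) (hZ k eta z) => A A' A''; ring.
rewrite addrCA [leLHS]addrC lerD2l.
have [e0z|eN0] := eqVneq (eta z) 0; first by rewrite /zeta e0z !(mulr0, mul0r) addr0.
have au := ea _ eN0; have uz0 : 0 < u z by exact: lt_le_trans au.
have -> : Num.max (u z) (a / 2) = u z by apply/max_idPl; lra.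
have hbE : hb (u z) = h (u z) by rewrite /hb (max_idPl au).
have vz0 : 0 < psi (u z) by apply: lt_le_trans a_gt0 _; rewrite -psia mpsi.
rewrite (max_idPl (ltW vz0)) hbE.
have fv : f (psi (u z)) <= f (u z) by apply: (source_ndecr f_incr (ltW vz0)); exact: psi_le.
have fv0 := f_pos vz0.
have omB : expR ((p - 1) * (0 - B)) <= om (u z).
  by rewrite /om ler_expR ler_pM2l// lerB// -Ha ndH.
have gN := gD (N z) (hgrad_norm_ge0 u z); rewrite -/(N z).
have om0 : 0 < om (u z) by exact: expR_gt0.
have hu := h_ge0 uz0.
have -> : (f (u z) - h (u z) * g (N z)) * zeta z + om (u z) * ((p - 1) * (D * h (u z))) * eta z * N z `^ p =
  (f (u z) + h (u z) * ((p - 1) * D * N z `^ p - g (N z))) * om (u z) * eta z.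
  by rewrite /zeta; ring.
rewrite ler_wpM2r//.
apply: (@le_trans _ _ (om (u z) * f (psi (u z)))); first by rewrite ler_wpM2r// ltW.
rewrite mulrC ler_wpM2r ?(ltW om0)//.
by rewrite (le_trans fv)// lerDl mulr_ge0// subr_ge0.
Qed.

End gradient_term_removal.

(** * The barrier *)

Section positive_part.
Context {R : realType}.

(** Truncating the argument makes no corner at 0 since the derivative vanishes there. The composite
    is identified with a primitive of [d (max s 0)], which avoids one-sided derivatives. *)
Lemma derive_pos_part (beta d : R -> R) :
  (forall x : R, is_derive x 1 beta (d x)) -> continuous d -> d 0 = 0 ->
  forall x : R, is_derive x 1 (fun s => beta (Num.max s 0)) (d (Num.max x 0)).
Proof.
move=> db cd d0.
have cd' : continuous (fun s : R => d (Num.max s 0)).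
  by move=> s; apply: (@continuous_comp R R R (fun s => Num.max s 0) d); [exact: continuous_max_cst|exact: cd].
have [G [G0 dG]] := continuous_primitive cd'.
have E s : beta (Num.max s 0) = G s + beta 0.
  have [s0|s0] := lerP s 0.
    rewrite -(@derive0_cst R G _ s 0 s0 (fun x _ => dG x)) ?G0 ?add0r// => x /andP[_ x0].
    by rewrite (max_idPr x0).
  have [E1 E2] : G s - G 0 <= beta s - beta 0 /\ beta s - beta 0 <= G s - G 0.
    have E x : 0 <= x <= s -> d (Num.max x 0) = d x by move=> /andP[x0 _]; rewrite (max_idPl x0).
    split.
      by apply: (derive_le_sub (ltW s0) (fun x _ => dG x) (fun x _ => db x)) => x /E ->.
    by apply: (derive_le_sub (ltW s0) (fun x _ => db x) (fun x _ => dG x)) => x /E ->.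
  by move: E1 E2; rewrite G0; lra.
move=> x; rewrite (funext E).
by apply: is_derive_eq (isd_add (dG x) (isd_cst _ x 1)) _; rewrite addr0.
Qed.

Lemma Ck1_pos_part (beta d : R -> R) :
  (forall x : R, is_derive x 1 beta (d x)) -> continuous d -> d 0 = 0 ->
  Ck 1 (fun s => beta (Num.max s 0)).
Proof.
move=> db cd d0; exists (fun x => d (Num.max x 0)); first exact: derive_pos_part.
move=> s; apply: (@continuous_comp R R R (fun s => Num.max s 0) d); last exact: cd.
exact: continuous_max_cst.
Qed.

End positive_part.

(** * The gauge and its horizontal derivatives *)

Section homogeneous_gauge.
Context {R : realType} {m : nat}.
Implicit Types (q : heis R m) (k : 'I_(m + m)).

Definition zcoord k q : R := q ord0 (lshift 1 k).
Definition tcoord q : R := q ord0 it.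
Definition zsq q : R := \sum_k zcoord k q ^+ 2.
(** The fourth power of the Koranyi norm, a polynomial and hence smooth also at the origin. *)
Definition gauge q : R := zsq q ^+ 2 + tcoord q ^+ 2.

Lemma zsq_ge0 q : 0 <= zsq q.
Proof. by apply: sumr_ge0 => k _; exact: sqr_ge0. Qed.

Lemma gauge_ge0 q : 0 <= gauge q.
Proof. by rewrite addr_ge0// sqr_ge0. Qed.

Lemma hvec_lshift k j q : hvec k q ord0 (lshift 1 j) = (j == k)%:R.
Proof.
rewrite /hvec !mxE eqxx/= eq_lshift.
by rewrite [it]/(rshift (m + m) ord0) eq_lrshift mulr0 addr0.
Qed.

Lemma hvec_it k q : hvec k q ord0 it = hcoef k q.
Proof.
by rewrite /hvec !mxE eqxx/= [it]/(rshift (m + m) ord0) eq_rlshift eqxx mulr1 add0r.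
Qed.

Lemma isd_zcoord k j q : is_derive q (hvec k q) (zcoord j) (j == k)%:R.
Proof. by rewrite -(hvec_lshift k j q); exact: isd_coord. Qed.

Lemma isd_tcoord k q : is_derive q (hvec k q) tcoord (hcoef k q).
Proof. by rewrite -(hvec_it k q); exact: isd_coord. Qed.

(** The coefficient in X_j involves y_j only and the one in Y_j involves x_j only; each is constant
    along its own field. *)
Lemma isd_hcoef k q : is_derive q (hvec k q) (hcoef k) 0.
Proof.
rewrite {1}/hcoef; case E: (fintype.split k) => [j|j].
  apply: is_derive_eq (isd_scale 2 (isd_zcoord k (rshift m j) q)) _.
  have -> : k = lshift m j by rewrite -(splitK k) E.
  by rewrite eq_rlshift mulr0.
apply: is_derive_eq (isd_opp (isd_scale 2 (isd_zcoord k (lshift m j) q))) _.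
have -> : k = rshift m j by rewrite -(splitK k) E.
by rewrite eq_lrshift mulr0 oppr0.
Qed.

Lemma sum_zcoord_hcoef q : \sum_k zcoord k q * hcoef k q = 0.
Proof.
rewrite big_split_ord/= -big_split/= big1// => j _.
rewrite /hcoef (unsplitK (inl j : 'I_m + 'I_m)) (unsplitK (inr j : 'I_m + 'I_m)).
by rewrite /zcoord; ring.
Qed.

Lemma sum_hcoef_sqr q : \sum_k hcoef k q ^+ 2 = 4 * zsq q.
Proof.
rewrite /zsq !big_split_ord/= mulrDr !mulr_sumr -!big_split/=; apply: eq_bigr => j _.
rewrite /hcoef (unsplitK (inl j : 'I_m + 'I_m)) (unsplitK (inr j : 'I_m + 'I_m)).
by rewrite /zcoord; ring.
Qed.

Lemma isd_zsq k q : is_derive q (hvec k q) zsq (2 * zcoord k q).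
Proof.
apply: is_derive_eq (isd_sum (F := fun j q => zcoord j q ^+ 2)
  (dF := fun j q => 2 * zcoord j q * (j == k)%:R) _ _) _.
  by move=> j; apply: is_derive_eq (isd_exp 2 (isd_zcoord k j q)) _; rewrite expr1.
by rewrite (bigD1 k)//= eqxx mulr1 big1 ?addr0// => j /negPf ->; rewrite mulr0.
Qed.

Definition hgauge k q : R := 4 * zsq q * zcoord k q + 2 * tcoord q * hcoef k q.

Lemma isd_gauge k q : is_derive q (hvec k q) gauge (hgauge k q).
Proof.
apply: is_derive_eq (isd_add (isd_exp 2 (isd_zsq k q)) (isd_exp 2 (isd_tcoord k q))) _.
by rewrite /hgauge !expr1; ring.
Qed.

Lemma isd_hgauge k q : is_derive q (hvec k q) (hgauge k)
  (8 * zcoord k q ^+ 2 + 4 * zsq q + 2 * hcoef k q ^+ 2).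
Proof.
apply: is_derive_eq (isd_add
  (isd_mul (isd_scale 4 (isd_zsq k q)) (isd_zcoord k k q))
  (isd_mul (isd_scale 2 (isd_tcoord k q)) (isd_hcoef k q))) _.
by rewrite eqxx/=; ring.
Qed.

Lemma class_C_zcoord j k : class_C j (zcoord k).
Proof. exact: class_C_coord. Qed.

Lemma class_C_sqr j (u : heis R m -> R) : class_C j u -> class_C j (fun q => u q ^+ 2).
Proof. by move=> Cu; under eq_fun do rewrite expr2; exact: class_CM. Qed.

Lemma class_C_zsq j : class_C j zsq.
Proof. by apply: class_C_sum => k; apply: class_C_sqr; exact: class_C_zcoord. Qed.

Lemma class_C_gauge j : class_C j gauge.
Proof.
by apply: class_CD; apply: class_C_sqr; [exact: class_C_zsq|exact: class_C_coord].
Qed.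

Lemma class_C_hgauge j k : class_C j (hgauge k).
Proof.
apply: class_CD; (apply: class_CM; [apply: class_CM; [exact: class_C_cst|]|]).
- exact: class_C_zsq.
- exact: class_C_zcoord.
- exact: class_C_coord.
- exact: class_C_hcoef.
Qed.

Lemma sum_zcoord_hgauge q : \sum_k zcoord k q * hgauge k q = 4 * zsq q ^+ 2.
Proof.
rewrite (eq_bigr (fun k => 4 * zsq q * zcoord k q ^+ 2 +
  2 * tcoord q * (zcoord k q * hcoef k q))) => [|k _]; last by rewrite /hgauge; ring.
by rewrite big_split/= -!mulr_sumr sum_zcoord_hcoef -/(zsq q); ring.
Qed.

Lemma sum_hgauge_sqr q : \sum_k hgauge k q ^+ 2 = 16 * zsq q * gauge q.
Proof.
rewrite (eq_bigr (fun k => 4 * zsq q * (zcoord k q * hgauge k q) +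
  (8 * tcoord q * zsq q * (zcoord k q * hcoef k q) + 4 * tcoord q ^+ 2 * hcoef k q ^+ 2))).
  rewrite !big_split/= -!mulr_sumr sum_zcoord_hcoef sum_zcoord_hgauge sum_hcoef_sqr.
  by rewrite /gauge; ring.
by move=> k _; rewrite /hgauge; ring.
Qed.

(** The trace of the second horizontal derivatives, that is, the sub-Laplacian of the gauge. *)
Lemma sum_isd_hgauge q :
  \sum_k (8 * zcoord k q ^+ 2 + 4 * zsq q + 2 * hcoef k q ^+ 2) = 8 * (m%:R + 2) * zsq q.
Proof.
rewrite !big_split/= -!mulr_sumr sum_hcoef_sqr -/(zsq q) sumr_const card_ord.
move: (zsq q) => z; rewrite -(mulr_natl _ (m + m)) natrD; ring.
Qed.

(* [gsq] is the squared horizontal gradient of the gauge. *)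
Definition gsq q : R := 16 * zsq q * gauge q.

Lemma gsq_ge0 q : 0 <= gsq q.
Proof. by rewrite !mulr_ge0 ?zsq_ge0 ?gauge_ge0. Qed.

Lemma class_C_gsq j : class_C j gsq.
Proof.
apply: class_CM; last exact: class_C_gauge.
by apply: class_CM; [exact: class_C_cst|exact: class_C_zsq].
Qed.

Definition hgsq k q : R := 16 * (zsq q * hgauge k q + 2 * zcoord k q * gauge q).

Lemma isd_gsq k q : is_derive q (hvec k q) gsq (hgsq k q).
Proof.
apply: is_derive_eq (isd_mul (isd_scale 16 (isd_zsq k q)) (isd_gauge k q)) _.
by rewrite /hgsq; ring.
Qed.

(** The term that arises when the weight |grad rho|^(p-2) of the p-Laplacian is differentiated along
    grad rho. *)
Lemma sum_hgsq_hgauge q : \sum_k hgsq k q * hgauge k q = 24 * zsq q * gsq q.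
Proof.
rewrite (eq_bigr (fun k => 16 * zsq q * hgauge k q ^+ 2 +
   32 * gauge q * (zcoord k q * hgauge k q))).
  rewrite big_split/= -!mulr_sumr sum_hgauge_sqr sum_zcoord_hgauge.
  by rewrite /gsq; ring.
by move=> k _; rewrite /hgsq; ring.
Qed.

Lemma hgauge_le k q : `|hgauge k q| <= Num.sqrt (gsq q).
Proof.
rewrite -sqrtr_sqr ler_wsqrtr// /gsq -sum_hgauge_sqr (bigD1 k)//= lerDl.
by apply: sumr_ge0 => j _; exact: sqr_ge0.
Qed.

Lemma gsq_le q : gsq q ^+ 2 <= 256 * gauge q ^+ 3.
Proof.
have -> : gsq q ^+ 2 = 256 * (gauge q ^+ 2 * zsq q ^+ 2) by rewrite /gsq; ring.
rewrite ler_pM2l// [leRHS]exprSr ler_wpM2l ?sqr_ge0//.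
by rewrite lerDl sqr_ge0.
Qed.

End homogeneous_gauge.

Section regularisation.
Context {R : realType}.
Implicit Types (e y s : R).

(* [kap e] and [pow_reg r e] are C^1 replacements of [y] and [(s ^+ 2) `^ r] on the
   half line; with them the flux of the barrier becomes differentiable where the
   p-Laplacian degenerates. *)
Definition kap e y : R := y - e * (y * (y ^+ 2 + e)^-1).
Definition dkap e y : R := 1 - e * ((e - y ^+ 2) / (y ^+ 2 + e) ^+ 2).

Lemma sqrD_gt0 e y : 0 < e -> 0 < y ^+ 2 + e.
Proof. by move=> e0; rewrite ltr_wpDl ?sqr_ge0. Qed.

Lemma isd_inv e y : 0 < e -> is_derive y 1 (fun y : R => (y ^+ 2 + e)^-1)
  (- (2 * y / (y ^+ 2 + e) ^+ 2)).
Proof.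
move=> e0; pose F (y : R) := y ^+ 2 + e.
have D : is_derive y 1 F (2 * y).
  apply: is_derive_eq (isd_add (isd_exp 2 (is_derive_id y 1)) (isd_cst e y 1)) _.
  by rewrite expr1 addr0 mulr1.
have N0 : F y != 0 by rewrite gt_eqF// sqrD_gt0.
have [D1 D2] := D.
apply: DeriveDef; first exact: (@derivableV R R F y 1 N0 D1).
have := @deriveV R R F y 1 N0 D1; rewrite D2 => ->.
by rewrite scaleNr; congr (- _); exact: mulrC.
Qed.

Lemma isd_kap e y : 0 < e -> is_derive y 1 (kap e) (dkap e y).
Proof.
move=> e0; apply: is_derive_eq (isd_sub (is_derive_id y 1)
  (isd_scale e (isd_mul (is_derive_id y 1) (isd_inv y e0)))) _.
by rewrite /dkap; field; rewrite gt_eqF// sqrD_gt0.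
Qed.

Lemma kap_cube e y : 0 < e -> kap e y = y ^+ 3 / (y ^+ 2 + e).
Proof. by move=> e0; rewrite /kap; field; rewrite gt_eqF// sqrD_gt0. Qed.

Lemma dkapE e y : 0 < e -> dkap e y = (y ^+ 4 + 3 * e * y ^+ 2) / (y ^+ 2 + e) ^+ 2.
Proof. by move=> e0; rewrite /dkap; field; rewrite gt_eqF// sqrD_gt0. Qed.

Lemma dkap_ge0 e y : 0 < e -> 0 <= dkap e y.
Proof.
move=> e0; rewrite dkapE// (_ : y ^+ 4 = (y ^+ 2) ^+ 2); last by ring.
have H1 := sqr_ge0 (y ^+ 2); have H2 := sqr_ge0 y.
by rewrite divr_ge0 ?sqr_ge0// addr_ge0// mulr_ge0// mulr_ge0// ltW.
Qed.

Lemma dkap_le2 e y : 0 < e -> dkap e y <= 2.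
Proof.
move=> e0; rewrite dkapE// ler_pdivrMr ?exprn_gt0 ?sqrD_gt0// -subr_ge0.
rewrite (_ : _ - _ = (y ^+ 2) ^+ 2 + e * y ^+ 2 + 2 * e ^+ 2); last by ring.
by move: (sqr_ge0 (y ^+ 2)) (mulr_ge0 (ltW e0) (sqr_ge0 y)) (sqr_ge0 e); lra.
Qed.

Lemma kap_ge0 e y : 0 < e -> 0 <= y -> 0 <= kap e y.
Proof.
by move=> e0 y0; rewrite kap_cube// divr_ge0 ?exprn_ge0// ltW// sqrD_gt0.
Qed.

Lemma kap_le e y : 0 < e -> 0 <= y -> kap e y <= y.
Proof.
move=> e0 y0; rewrite /kap lerBlDr lerDl mulr_ge0 ?(ltW e0)// mulr_ge0// invr_ge0.
exact/ltW/sqrD_gt0.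
Qed.

Lemma kap0 e : kap e 0 = 0.
Proof. by rewrite /kap mul0r mulr0 subrr. Qed.

(** As b' > 0 at the start, the momentum of the truncated radius has a corner where the radius
    vanishes. This zero removes it, by [derive_pos_part]. *)
Lemma dkap0 e : 0 < e -> dkap e 0 = 0.
Proof. by move=> e0; rewrite dkapE// !expr0n/= mulr0 addr0 mul0r. Qed.

Lemma continuous_dkap e : 0 < e -> continuous (dkap e).
Proof.
move=> e0 y.
have csq : (fun y : R => y ^+ 2) x @[x --> y] --> y ^+ 2 by exact: exprn_continuous.
have ci := is_derive1_continuous (isd_inv y e0).
rewrite /dkap; under eq_fun do rewrite expr2 invfM.
apply: cvgB; first exact: cvg_cst.
apply: cvgMl_tmp; apply: cvgM; last exact: cvgM.
by apply: cvgB; [exact: cvg_cst|].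
Qed.

Lemma cvg_kap y (e : nat -> R) : (forall n, 0 < e n) -> e @ \oo --> 0 ->
  kap (e n) y @[n --> \oo] --> y.
Proof.
move=> e0 ce; have [->|yN0] := eqVneq y 0.
  by under eq_fun do rewrite kap0; exact: cvg_cst.
rewrite -[X in _ --> X]subr0; apply: cvgB; first exact: cvg_cst.
rewrite -[X in _ --> X](mul0r (y * (y ^+ 2 + 0)^-1)); apply: cvgM => //.
apply: cvgMl_tmp; apply: cvgV; first by rewrite addr0 expf_neq0.
by apply: cvgD => //; exact: cvg_cst.
Qed.

Definition pow_reg (r e s : R) : R := (s ^+ 2 + e) `^ r.

Lemma isd_pow_reg r e s : 0 < e ->
  is_derive s 1 (pow_reg r e) (r * pow_reg (r - 1) e s * (2 * s)).
Proof.
move=> e0; apply: (@isd_comp R _ ((@powR R) ^~ r) (fun s => s ^+ 2 + e)).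
  by apply: is_derive1_powR; exact: sqrD_gt0.
apply: is_derive_eq (isd_add (isd_exp 2 (is_derive_id s 1)) (isd_cst e s 1)) _.
by rewrite expr1 addr0 mulr1.
Qed.

Lemma pow_reg_ge0 r e s : 0 <= pow_reg r e s. Proof. exact: powR_ge0. Qed.

Lemma continuous_pow_reg r e : 0 < e -> continuous (pow_reg r e).
Proof. by move=> e0 s; exact: is_derive1_continuous (isd_pow_reg r s e0). Qed.

Lemma Ck1_pow_reg r e : 0 < e -> Ck 1 (pow_reg r e).
Proof.
move=> e0; exists (fun s => r * pow_reg (r - 1) e s * (2 * s)) => [s|s].
  exact: isd_pow_reg.
apply: cvgM; first by apply: cvgMl_tmp; exact: continuous_pow_reg.
by apply: cvgMl_tmp; exact: cvg_id.
Qed.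

Lemma pow_regD r r' e s : 0 < e -> pow_reg (r + r') e s = pow_reg r e s * pow_reg r' e s.
Proof.
by move=> e0; rewrite /pow_reg powRD// (gt_eqF (sqrD_gt0 s e0)) implybT.
Qed.

Lemma pow_reg1 e s : 0 < e -> pow_reg 1 e s = s ^+ 2 + e.
Proof. by move=> e0; rewrite /pow_reg powRr1// ltW// sqrD_gt0. Qed.

Lemma pow_reg_half e s : 0 < e -> s <= pow_reg 2^-1 e s.
Proof.
move=> e0; rewrite /pow_reg powR12_sqrt ?(ltW (sqrD_gt0 s e0))//.
by apply: le_trans (ler_norm s) _; rewrite -sqrtr_sqr ler_wsqrtr// lerDl ltW.
Qed.

Lemma pow_reg_quarter e s : 0 < e -> 0 <= s -> Num.sqrt s <= pow_reg 4^-1 e s.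
Proof.
move=> e0 s0; rewrite /pow_reg (_ : 4^-1 = 2^-1 * 2^-1 :> R); last by field.
by rewrite powRrM [leRHS]powR12_sqrt ?powR_ge0// ler_wsqrtr// pow_reg_half.
Qed.

Lemma pow_reg_le r e s B : 0 <= r -> 0 < e -> s ^+ 2 + e <= B -> pow_reg r e s <= B `^ r.
Proof.
move=> r0 e0 sB; have s0 := sqrD_gt0 s e0.
by apply: ge0_ler_powR; rewrite ?nnegrE// ?(ltW s0)// (le_trans (ltW s0)).
Qed.

Lemma cvg_pow_reg r s (e : nat -> R) : s != 0 -> e @ \oo --> 0 ->
  pow_reg r (e n) s @[n --> \oo] --> (s ^+ 2) `^ r.
Proof.
move=> sN0 ce; apply: (@continuous_cvg nat R R \oo _ (fun n => s ^+ 2 + e n) ((@powR R) ^~ r) (s ^+ 2)).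
  have s0 : 0 < s ^+ 2 by rewrite lt_neqAle sqr_ge0 eq_sym expf_neq0.
  exact: is_derive1_continuous (is_derive1_powR r s0).
by rewrite -[X in _ --> X]addr0; apply: cvgD => //; exact: cvg_cst.
Qed.

End regularisation.

(** * The barrier as a weak supersolution *)

Section barrier.
Context {R : realType} {m : nat}.
Variables (p T : R) (p_gt1 : 1 < p) (T_gt0 : 0 < T).
Implicit Types (q : heis R m) (k : 'I_(m + m)) (e s : R).

Let p0 : 0 < p. Proof. exact: lt_trans p_gt1. Qed.
Let p10 : 0 < p - 1. Proof. by rewrite subr_gt0. Qed.
Let delta : R := (p - 2) / 4.

(** The coefficient 48 is 2 * 24: the factor 2 comes from differentiating s^2 in [pow_reg], 24 from
    [sum_hgsq_hgauge]. The second summand is the sub-Laplacian of the gauge. *)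
Definition div_const : R := 48 * `|delta| + 8 * (m%:R + 2).

(* [barrier_const * L `^ (- (p / 4))] bounds the divergence of the regularised flux
   relative to [g (alpha _)], uniformly in the regularisation. *)
Definition barrier_const : R :=
  (257 * (1 + T) ^+ 3) `^ (p / 4) * ((32 * (1 + T) + T * div_const) / 16).

Lemma div_const_ge0 : 0 <= div_const.
Proof. by rewrite addr_ge0 ?mulr_ge0// addr_ge0. Qed.

Lemma barrier_const_ge0 : 0 <= barrier_const.
Proof.
have T0 := ltW T_gt0; have d0 := div_const_ge0.
have H : 0 <= 32 * (1 + T) + T * div_const.
  by rewrite addr_ge0// mulr_ge0// addr_ge0.
by rewrite mulr_ge0 ?powR_ge0// divr_ge0.
Qed.

Variables (L sigma : R) (b alpha g : R -> R).
Hypotheses (L_ge1 : 1 <= L) (L_large : barrier_const * L `^ (- (p / 4)) <= sigma)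
  (g_cont : continuous g) (g_incr : {homo g : x y / x <= y}) (g_gt0 : forall x, 0 < g x)
  (b0 : b 0 = 0)
  (db : forall x : R, is_derive x 1 b (g (alpha x)))
  (dalpha : forall x : R,
    is_derive x 1 alpha (Num.sg (b x) * `|b x| `^ (p / (p - 1) - 1))).

Let L0 : 0 < L. Proof. exact: lt_le_trans L_ge1. Qed.

Definition gradius q : R := gauge q / L - 1.
Definition gradius_pos q : R := Num.max (gradius q) 0.
Definition barrier_fun q : R := alpha (gradius_pos q).

Lemma conjugate_pred : p / (p - 1) - 1 = (p - 1)^-1.
Proof. by field; rewrite gt_eqF. Qed.

Lemma conjugate_pred_gt0 : 0 < p / (p - 1) - 1.
Proof. by rewrite conjugate_pred invr_gt0. Qed.

Lemma momentum_continuous : continuous b.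
Proof. by move=> x; exact: is_derive1_continuous (db x). Qed.

Lemma profile_continuous : continuous alpha.
Proof. by move=> x; exact: is_derive1_continuous (dalpha x). Qed.

Lemma momentum_ge0 x : 0 <= x -> 0 <= b x.
Proof.
move=> x0; rewrite -b0.
by apply: (derive_ge0_le x0 (fun x _ => db x)) => y _; exact: ltW.
Qed.

Lemma profile_ndecr x y : 0 <= x -> x <= y -> alpha x <= alpha y.
Proof.
move=> x0 xy; apply: (derive_ge0_le xy (fun x _ => dalpha x)) => s /andP[xs _].
by rewrite mulr_ge0 ?powR_ge0// sgr_ge0 momentum_ge0// (le_trans x0).
Qed.

(** On [0, x] the derivative of [b] is at most its final value g(alpha(x)). The divergence terms
    that carry b itself are thereby controlled by the source. *)
Lemma momentum_le x : 0 <= x <= T -> b x <= T * g (alpha x).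
Proof.
move=> /andP[x0 xT].
apply: (@le_trans _ _ (g (alpha x) * x)); last first.
  by rewrite mulrC ler_wpM2r// ltW.
have := derive_le_sub x0 (fun y _ => db y)
  (fun y _ => isd_scale (g (alpha x)) (is_derive_id y 1)).
rewrite b0 subr0 mulr0 subr0; apply => y /andP[y0 yx].
by rewrite mulr1 g_incr// profile_ndecr.
Qed.

Lemma gradius_pos_ge0 q : 0 <= gradius_pos q.
Proof. by rewrite le_max lexx orbT. Qed.

Lemma class_C_radius j : class_C j gradius.
Proof.
apply: class_CD; last exact: class_C_cst.
by apply: class_CM; [exact: class_C_gauge|exact: class_C_cst].
Qed.

Lemma isd_radius k q : is_derive q (hvec k q) gradius (hgauge k q / L).
Proof.
apply: is_derive_eq (isd_sub (isd_mul (isd_gauge k q) (isd_cst L^-1 q (hvec k q)))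
  (isd_cst 1 q (hvec k q))) _.
by rewrite mulr0 add0r subr0.
Qed.

Lemma gradius_pos_continuous : continuous gradius_pos.
Proof.
move=> q; apply: (@continuous_comp _ R R gradius (fun s => Num.max s 0)).
  exact: class_C_continuous (class_C_radius 0) q.
exact: continuous_max_cst.
Qed.

Let dal x := Num.sg (b x) * `|b x| `^ (p / (p - 1) - 1).

Let cdal : continuous dal.
Proof.
move=> x; apply: (@continuous_comp R R R b (fun y => Num.sg y * `|y| `^ _)); first exact: momentum_continuous.
by apply: continuous_sg_powR; exact: conjugate_pred_gt0.
Qed.

Let dal0 : dal 0 = 0. Proof. by rewrite /dal b0 sgr0 mul0r. Qed.

Lemma class_C_barrier : class_C 1 barrier_fun.
Proof.
apply: (@class_C_comp _ _ 1 (fun s => alpha (Num.max s 0))); last exact: class_C_radius.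
exact: Ck1_pos_part dalpha cdal dal0.
Qed.

Let dbar q : R := dal (gradius_pos q) / L.

Lemma hZ_barrier k q : hZ k barrier_fun q = dbar q * hgauge k q.
Proof.
apply: hZE; first by case: class_C_barrier.
apply: is_derive_eq (isd_comp (f := gradius) (derive_pos_part dalpha cdal dal0 _)
  (isd_radius k q)) _.
by rewrite /dbar /dal mulrA [RHS]mulrAC.
Qed.

Let field0 k q : R :=
  L `^ (1 - p) * (b (gradius_pos q) * (gsq q ^+ 2) `^ delta * hgauge k q).

(** As alpha' = b^(1/(p-1)), the power p - 1 of the slope is linear in [b]. Writing |grad rho|^(p-2)
    as (gsq^2)^delta gives the form that [pow_reg] regularises. *)
Lemma flux_barrier k q : flux p k barrier_fun q = field0 k q.
Proof.
have br := momentum_ge0 (gradius_pos_ge0 q); rewrite /flux hZ_barrier.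
have [b0'|bN0] := eqVneq (b (gradius_pos q)) 0.
  by rewrite /field0 b0' /dbar /dal b0' sgr0 !mul0r !mulr0.
have bg0 : 0 < b (gradius_pos q) by rewrite lt_neqAle eq_sym bN0.
have dbarE : dbar q = b (gradius_pos q) `^ (p - 1)^-1 / L.
  by rewrite /dbar /dal gtr0_sg// gtr0_norm// mul1r conjugate_pred.
have d0 : 0 <= dbar q by rewrite dbarE divr_ge0 ?powR_ge0// ltW.
have NE : hgrad_norm barrier_fun q = dbar q * gsq q `^ 2^-1.
  rewrite /hgrad_norm hgrad_dotE powR12_sqrt ?gsq_ge0//.
  rewrite -[X in X * _](@ger0_norm R)// -sqrtr_sqr -sqrtrM ?sqr_ge0//; congr Num.sqrt.
  rewrite /gsq -sum_hgauge_sqr mulr_sumr; apply: eq_bigr => j _.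
  by rewrite !hZ_barrier; ring.
rewrite NE powRM ?powR_ge0// -powRrM.
have -> : gsq q `^ (2^-1 * (p - 2)) = (gsq q ^+ 2) `^ delta.
  rewrite -powR_mulrn ?gsq_ge0// -powRrM; congr (_ `^ _).
  by rewrite /delta; field.
have dp : dbar q `^ (p - 2) * dbar q = L `^ (1 - p) * b (gradius_pos q).
  rewrite powR_pred2// dbarE powRM ?powR_ge0 ?invr_ge0 ?(ltW L0)//.
  rewrite -powRrM mulVf ?gt_eqF// powRr1// mulrC; congr (_ * _).
  by rewrite -powR_inv1 ?(ltW L0)// -powRrM; congr (_ `^ _); ring.
rewrite /field0; move: ((gsq q ^+ 2) `^ delta) (hgauge k q) => A B.
by rewrite mulrACA dp mulrA [RHS]mulrA -!mulrA.
Qed.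

Let fieldB e q : R := kap e (b (gradius_pos q)).
Let field e k q : R := L `^ (1 - p) * (fieldB e q * pow_reg delta e (gsq q) * hgauge k q).

Let dB e q : R := dkap e (b (gradius_pos q)) * g (barrier_fun q).

Lemma isd_kap_momentum e (s : R) : 0 < e ->
  is_derive s 1 (fun s => kap e (b s)) (dkap e (b s) * g (alpha s)).
Proof. by move=> e0; exact: isd_comp (isd_kap _ e0) (db s). Qed.

Lemma continuous_dkap_momentum e : 0 < e -> continuous (fun s => dkap e (b s) * g (alpha s)).
Proof.
move=> e0 s; apply: cvgM.
  by apply: (@continuous_comp R R R b (dkap e)); [exact: momentum_continuous|exact: continuous_dkap].
by apply: (@continuous_comp R R R alpha g); [exact: profile_continuous|exact: g_cont].
Qed.

Lemma dkap_momentum0 e : 0 < e -> dkap e (b 0) * g (alpha 0) = 0.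
Proof. by move=> e0; rewrite b0 dkap0// mul0r. Qed.

Lemma class_C_field e k : 0 < e -> class_C 1 (field e k).
Proof.
move=> e0; apply: class_CM; first exact: class_C_cst.
apply: class_CM; last exact: class_C_hgauge.
apply: class_CM.
  apply: (@class_C_comp _ _ 1 (fun s => kap e (b (Num.max s 0)))); last exact: class_C_radius.
  exact: (Ck1_pos_part (fun s => isd_kap_momentum s e0) (continuous_dkap_momentum e0) (dkap_momentum0 e0)).
by apply: class_C_comp; [exact: Ck1_pow_reg|exact: class_C_gsq].
Qed.

Let dfield e k q : R := L `^ (1 - p) *
  (dB e q / L * pow_reg delta e (gsq q) * hgauge k q ^+ 2 +
   fieldB e q * (2 * delta * pow_reg (delta - 1) e (gsq q) * gsq q) * (hgsq k q * hgauge k q) +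
   fieldB e q * pow_reg delta e (gsq q) *
     (8 * zcoord k q ^+ 2 + 4 * zsq q + 2 * hcoef k q ^+ 2)).

Lemma isd_field e k q : 0 < e -> is_derive q (hvec k q) (field e k) (dfield e k q).
Proof.
move=> e0.
have D1 : is_derive q (hvec k q) (fieldB e) (dB e q * (hgauge k q / L)).
  exact: (isd_comp (f := gradius)
    (derive_pos_part (fun s => isd_kap_momentum s e0) (continuous_dkap_momentum e0) (dkap_momentum0 e0) _) (isd_radius k q)).
have D2 := isd_comp (isd_pow_reg delta (gsq q) e0) (isd_gsq k q).
apply: is_derive_eq (isd_scale (L `^ (1 - p)) (isd_mul (isd_mul D1 D2) (isd_hgauge k q))) _.
rewrite /dfield; congr (_ * _).
move: (fieldB e q) (dB e q) (pow_reg delta e (gsq q)) (pow_reg (delta - 1) e (gsq q)) => A B C D.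
move: (gsq q) (hgsq k q) (hgauge k q) (zcoord k q) (zsq q) (hcoef k q) => g1 g2 g3 g4 g5 g6.
by ring.
Qed.

Lemma sum_dfield e q : \sum_k dfield e k q = L `^ (1 - p) *
  (dB e q / L * pow_reg delta e (gsq q) * gsq q +
   fieldB e q * (48 * delta * pow_reg (delta - 1) e (gsq q) * gsq q ^+ 2) * zsq q +
   fieldB e q * pow_reg delta e (gsq q) * (8 * (m%:R + 2) * zsq q)).
Proof.
rewrite -mulr_sumr; congr (_ * _); rewrite !big_split/= -!mulr_sumr.
rewrite sum_hgauge_sqr sum_hgsq_hgauge sum_isd_hgauge -/(gsq q).
move: (fieldB e q) (dB e q) (pow_reg delta e (gsq q)) (pow_reg (delta - 1) e (gsq q)) => A B C D.
move: (gsq q) (zsq q) => g1 g2.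
by ring.
Qed.

Lemma sigma_ge0 : 0 <= sigma.
Proof. by apply: le_trans L_large; rewrite mulr_ge0 ?barrier_const_ge0 ?powR_ge0. Qed.

(** For p < 2 the exponent delta is negative and the factor [zsq] has to compensate. Where the gauge
    exceeds L, zsq <= gsq / (16 L), and this gsq raises the exponent to delta + 1/2 = p / 4 > 0, so
    that an upper bound for gsq is enough. The constant 257 is 256 from [gsq_le] plus 1 from e <=
    1. *)
Lemma pow_reg_zsq_le e q : 0 < e <= 1 -> 0 < gradius q <= T ->
  pow_reg delta e (gsq q) * zsq q <=
  (257 * (1 + T) ^+ 3) `^ (p / 4) * L `^ (3 * (p / 4)) / (16 * L).
Proof.
move=> /andP[e0 e1] /andP[r0 rT].
have T1 : 1 <= 1 + T by rewrite lerDl ltW.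
have gE : gauge q = L * (1 + gradius q) by rewrite /gradius; field; rewrite gt_eqF.
have LT1 : 1 <= L * (1 + T) by rewrite -[leLHS]mulr1 ler_pM.
have gL : L <= gauge q by rewrite gE -[leLHS]mulr1 ler_pM2l// lerDl ltW.
have gLT : gauge q <= L * (1 + T) by rewrite gE ler_pM2l// lerD2l.
have zN : zsq q <= gsq q / (16 * L).
  rewrite ler_pdivlMr ?mulr_gt0// /gsq mulrA (mulrC _ 16) ler_wpM2l//.
  by rewrite mulr_ge0 ?zsq_ge0.
apply: (@le_trans _ _ (pow_reg delta e (gsq q) * (gsq q / (16 * L)))).
  by rewrite ler_wpM2l ?pow_reg_ge0.
rewrite mulrA ler_wpM2r ?invr_ge0 ?mulr_ge0 ?(ltW L0)//.
apply: (@le_trans _ _ (pow_reg (p / 4) e (gsq q))).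
  have -> : p / 4 = delta + 2^-1 by rewrite /delta; field.
  by rewrite pow_regD// ler_wpM2l ?pow_reg_ge0// pow_reg_half.
have -> : (257 * (1 + T) ^+ 3) `^ (p / 4) * L `^ (3 * (p / 4)) =
    (257 * (L * (1 + T)) ^+ 3) `^ (p / 4).
  rewrite (powRrM L 3) (powR_mulrn 3) ?(ltW L0)// -powRM ?exprn_ge0 ?(ltW L0)//.
    by congr (_ `^ _); ring.
  by rewrite mulr_ge0// exprn_ge0// (le_trans ler01).
apply: pow_reg_le => //; first by rewrite divr_ge0// ltW.
have H1 : gauge q ^+ 3 <= (L * (1 + T)) ^+ 3.
  by rewrite lerXn2r// nnegrE ?gauge_ge0// (le_trans ler01).
have H2 : 1 <= (L * (1 + T)) ^+ 3 by rewrite exprn_ege1.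
move: (gsq_le q) H1 H2 e1; move: (gsq q ^+ 2) (gauge q ^+ 3) ((L * (1 + T)) ^+ 3).
by move=> x y z; lra.
Qed.

Lemma sum_dfield_le e q : 0 < e <= 1 -> gradius q <= T ->
  \sum_k dfield e k q <= sigma * g (barrier_fun q).
Proof.
move=> e01 rT; have /andP[e0 e1] := e01; rewrite sum_dfield.
(* In the core the barrier is constant and the regularised flux vanishes together with its
   divergence. *)
have [r0|r0] := lerP (gradius q) 0.
  have rp : gradius_pos q = 0 by apply/max_idPr.
  have -> : dB e q = 0 by rewrite /dB /barrier_fun rp b0 dkap0// mul0r.
  have -> : fieldB e q = 0 by rewrite /fieldB rp b0 kap0.
  by rewrite !mul0r !addr0 mulr0 mulr_ge0 ?sigma_ge0// ltW.
have rp : gradius_pos q = gradius q by apply/max_idPl/ltW.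
have g0 : 0 < g (barrier_fun q) by [].
have b_ : 0 <= b (gradius_pos q) by rewrite momentum_ge0// gradius_pos_ge0.
have B0 : 0 <= fieldB e q by exact: kap_ge0.
have BT : fieldB e q <= T * g (barrier_fun q).
  by apply: le_trans (kap_le e0 b_) _; rewrite momentum_le// gradius_pos_ge0 rp.
have dB0' : 0 <= dB e q by rewrite mulr_ge0 ?dkap_ge0// ltW.
have dB2 : dB e q <= 2 * g (barrier_fun q) by rewrite ler_wpM2r ?dkap_le2// ltW.
have Az := pow_reg_zsq_le e01 (introT andP (conj r0 rT)).
have NE : gsq q / L = 16 * (1 + gradius q) * zsq q.
  by rewrite /gsq /gradius; field; rewrite gt_eqF.
have A0 : 0 <= pow_reg delta e (gsq q) by exact: pow_reg_ge0.
have A'0 : 0 <= pow_reg (delta - 1) e (gsq q) by exact: pow_reg_ge0.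
have AE : pow_reg delta e (gsq q) = pow_reg (delta - 1) e (gsq q) * (gsq q ^+ 2 + e).
  by rewrite -(pow_reg1 _ e0) -pow_regD//; congr pow_reg; ring.
have z0 := zsq_ge0 q.
have T0 := ltW T_gt0.
have r1 : 0 <= 16 * (1 + gradius q) by rewrite mulr_ge0// addr_ge0// ltW.
have r2 : 16 * (1 + gradius q) <= 16 * (1 + T) by rewrite ler_pM2l// lerD2l.
(* The factor 32 is 2 from [dkap_le2] times 16 from gsq / L = 16 (1 + gradius) zsq. *)
have H1 : dB e q / L * pow_reg delta e (gsq q) * gsq q <=
    pow_reg delta e (gsq q) * zsq q * (32 * (1 + T) * g (barrier_fun q)).
  rewrite (_ : _ * gsq q = pow_reg delta e (gsq q) * (dB e q * (gsq q / L))); last first.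
    by move: (dB e q) (gsq q) (pow_reg _ _ _) => x y z; ring.
  rewrite NE (_ : pow_reg delta e (gsq q) * _ =
     pow_reg delta e (gsq q) * zsq q * (dB e q * (16 * (1 + gradius q)))); last first.
    by move: (dB e q) (zsq q) (gradius q) (pow_reg _ _ _) => x y z t; ring.
  rewrite ler_wpM2l ?mulr_ge0//.
  rewrite (_ : 32 * (1 + T) * _ = 2 * g (barrier_fun q) * (16 * (1 + T))); last by ring.
  exact: ler_pM.
(* The exponent delta - 1 is raised back to delta by gsq^2 <= gsq^2 + e, so no negative power of e
   appears. *)
have H2 : 48 * delta * pow_reg (delta - 1) e (gsq q) * gsq q ^+ 2 <=
    pow_reg delta e (gsq q) * (48 * `|delta|).
  rewrite AE -mulrA.
  apply: (@le_trans _ _ (48 * `|delta| * (pow_reg (delta - 1) e (gsq q) * gsq q ^+ 2))).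
    by rewrite ler_wpM2r ?(mulr_ge0 A'0 (sqr_ge0 _))// ler_pM2l// ler_norm.
  by rewrite mulrC ler_wpM2r ?mulr_ge0// ler_wpM2l// lerDl ltW.
have H3 : fieldB e q * (48 * delta * pow_reg (delta - 1) e (gsq q) * gsq q ^+ 2) * zsq q +
    fieldB e q * pow_reg delta e (gsq q) * (8 * (m%:R + 2) * zsq q) <=
    pow_reg delta e (gsq q) * zsq q * (T * div_const * g (barrier_fun q)).
  apply: (@le_trans _ _ (fieldB e q * (pow_reg delta e (gsq q) * (48 * `|delta|)) * zsq q +
    fieldB e q * pow_reg delta e (gsq q) * (8 * (m%:R + 2) * zsq q))).
    by rewrite lerD2r ler_wpM2r// ler_wpM2l.
  rewrite (_ : _ + _ = pow_reg delta e (gsq q) * zsq q * (fieldB e q * div_const)); last first.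
    rewrite /div_const; move: (fieldB e q) (zsq q) (pow_reg _ _ _) => x y z; ring.
  rewrite ler_wpM2l ?mulr_ge0// mulrAC ler_wpM2r//; exact: div_const_ge0.
apply: (@le_trans _ _ (L `^ (1 - p) * (pow_reg delta e (gsq q) * zsq q *
    ((32 * (1 + T) + T * div_const) * g (barrier_fun q))))).
  rewrite ler_wpM2l ?powR_ge0// -addrA.
  rewrite (mulrDl (32 * (1 + T))) (mulrDr (_ * zsq q)); exact: lerD.
have C0 : 0 <= (32 * (1 + T) + T * div_const) * g (barrier_fun q).
  rewrite mulr_ge0 ?(ltW g0)// addr_ge0 ?mulr_ge0// ?addr_ge0//; exact: div_const_ge0.
apply: (@le_trans _ _ (L `^ (1 - p) * ((257 * (1 + T) ^+ 3) `^ (p / 4) * L `^ (3 * (p / 4)) / (16 * L) *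
    ((32 * (1 + T) + T * div_const) * g (barrier_fun q))))).
  by rewrite ler_wpM2l ?powR_ge0// ler_wpM2r.
apply: le_trans (ler_wpM2r (ltW g0) L_large); rewrite le_eqVlt; apply/orP; left; apply/eqP.
have -> : L `^ (- (p / 4)) = L `^ (1 - p) * L `^ (3 * (p / 4)) / L.
  rewrite -(powR_inv1 (ltW L0)) -!powRD ?(gt_eqF L0) ?implybT//.
  by congr (_ `^ _); field.
rewrite /barrier_const; move: ((257 * _) `^ _) (L `^ (1 - p)) (L `^ (3 * _)) (g _) div_const.
by move=> x y z t d; field; rewrite gt_eqF.
Qed.

(** A majorant independent of [e], for dominated convergence. The factor |hgauge| <= sqrt(gsq) lifts
    the exponent to delta + 1/4 = (p - 1) / 4 > 0, after which the bound is monotone in e <= 1. *)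
Lemma field_le e k q : 0 < e <= 1 ->
  `|field e k q| <= L `^ (1 - p) * (b (gradius_pos q) * pow_reg ((p - 1) / 4) 1 (gsq q)).
Proof.
move=> /andP[e0 e1]; have b_ := momentum_ge0 (gradius_pos_ge0 q).
have kb := kap_ge0 e0 b_.
rewrite /field normrM ger0_norm ?powR_ge0// ler_wpM2l ?powR_ge0//.
rewrite -mulrA normrM /fieldB (ger0_norm kb).
apply: ler_pM => //; first exact: kap_le.
rewrite normrM ger0_norm ?pow_reg_ge0//.
apply: (@le_trans _ _ (pow_reg delta e (gsq q) * pow_reg 4^-1 e (gsq q))).
  rewrite ler_wpM2l ?pow_reg_ge0//; apply: le_trans (hgauge_le k q) _.
  by apply: pow_reg_quarter => //; exact: gsq_ge0.
rewrite -pow_regD// (_ : delta + _ = (p - 1) / 4); last by rewrite /delta; field.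
rewrite [leRHS]/pow_reg; apply: pow_reg_le => //; last by rewrite lerD2l.
by rewrite divr_ge0// ltW.
Qed.

Lemma cvg_field k q (e : nat -> R) : (forall n, 0 < e n) -> e @ \oo --> 0 ->
  field (e n) k q @[n --> \oo] --> field0 k q.
Proof.
move=> e0 ce; have [N0|NN0] := eqVneq (gsq q) 0.
  have hg : hgauge k q = 0.
    by apply/eqP; rewrite -normr_eq0 eq_le normr_ge0 andbT (le_trans (hgauge_le k q))// N0 sqrtr0.
  rewrite /field /field0 hg !mulr0; under eq_fun do rewrite mulr0 mulr0.
  exact: cvg_cst.
apply: cvgMl_tmp; apply: cvgM; last exact: cvg_cst.
by apply: cvgM; [exact: cvg_kap|exact: cvg_pow_reg].
Qed.

(** For each e the divergence theorem applies to the regularised flux times eta, and the pointwise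
    bound on the divergence does not depend on e; the limit e -> 0 restores the flux of the
    barrier. *)
Lemma barrier_supersolution (eta : heis R m -> R) (M : R) : class_C 1 eta ->
  (forall q, 0 <= eta q) -> cube_supported M eta ->
  (forall q, eta q != 0 -> gradius q <= T) ->
  0 <= rVint (fun q => sigma * g (barrier_fun q) * eta q +
                 \sum_k flux p k barrier_fun q * hZ k eta q).
Proof.
move=> Ce eta0 se eT; have [de _] := Ce.
pose e n : R := n.+1%:R^-1.
have e0 n : 0 < e n by rewrite invr_gt0.
have e1 n : e n <= 1 by rewrite invf_le1// ler1n.
have ce : e @ \oo --> 0 by exact: cvg_harmonic.
pose Fk n q := \sum_k field (e n) k q * hZ k eta q.
have Cf n k := class_C_field k (e0 n).
have iF n : integrand (Fk n).
  apply: integrand_sum => k; apply: integrandM; last exact: integrand_hZ Ce se.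
  by apply: continuous_locally_bounded; exact: class_C_continuous (Cf n k).
have iS : integrand (fun q => sigma * g (barrier_fun q) * eta q).
  apply: integrandM; last first.
    split; last by exists M.
    by apply: continuous_locally_bounded; exact: class_C_continuous Ce.
  apply: continuous_locally_bounded; apply: (@class_CM _ _ 0); first exact: class_C_cst.
  exact: (@class_C_comp _ _ 0 g barrier_fun g_cont (class_CW class_C_barrier)).
have Cfe n k : class_C 1 (fun q => field (e n) k q * eta q) by exact: class_CM.
have sfe n k : cube_supported M (fun q => field (e n) k q * eta q).
  by move=> q qM; rewrite se ?mulr0.
have hfe n k q : hZ k (fun q => field (e n) k q * eta q) q =
    field (e n) k q * hZ k eta q + dfield (e n) k q * eta q.
  apply: hZE; first by case: (Cfe n k).
  exact: isd_mul (isd_field k q (e0 n)) (hZ_derive k (de q)).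
have ge n : 0 <= rVint (fun q => sigma * g (barrier_fun q) * eta q) + rVint (Fk n).
  have <- : rVint (fun q => \sum_k hZ k (fun q => field (e n) k q * eta q) q) = 0.
    rewrite rVint_sum => [|k]; last exact: integrand_hZ (Cfe n k) (sfe n k).
    by rewrite big1// => k _; exact: rVint_hZ (Cfe n k) (sfe n k).
  rewrite -rVintD//; apply: le_rVint.
  - by apply: integrand_sum => k; exact: integrand_hZ (Cfe n k) (sfe n k).
  - exact: integrandD.
  - move=> q; rewrite (eq_bigr _ (fun k _ => hfe n k q)) big_split/= -mulr_suml addrC lerD2r.
    have [->|eN0] := eqVneq (eta q) 0; first by rewrite !mulr0.
    by rewrite ler_wpM2r// sum_dfield_le ?e0 ?e1// eT.
pose bnd q := \sum_(k < m + m) L `^ (1 - p) *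
  (b (gradius_pos q) * pow_reg ((p - 1) / 4) 1 (gsq q)) * `|hZ k eta q|.
have cbnd : continuous bnd.
  apply: (class_C_continuous (k := 0)); apply: class_C_sum => k.
  apply: class_CM; last first.
    have cn : continuous (fun s : R => `|s|) by exact: norm_continuous.
    by apply: (@class_C_comp R _ 0 (fun s : R => `|s|) (hZ k eta)); [exact: cn|exact: hZ_continuous].
  apply: class_CM; first exact: class_C_cst.
  apply: class_CM; first exact: (@class_C_comp _ _ 0 b gradius_pos momentum_continuous gradius_pos_continuous).
  exact: (@class_C_comp _ _ 0 (pow_reg _ 1) gsq (continuous_pow_reg ltr01) (class_C_gsq 0)).
have [_ /(_ M)[C CP]] := continuous_locally_bounded cbnd.
have [||q|iF0 cF] := @rVint_dominated R _ Fk
    (fun q => \sum_k flux p k barrier_fun q * hZ k eta q) M C iF.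
- move=> n q qM; rewrite /Fk big1// => k _.
  by rewrite (cube_supported_hZ k se) ?mulr0.
- move=> n q qM; apply: le_trans (CP q qM); apply: le_trans (ler_norm _).
  apply: le_trans (ler_norm_sum _ _ _) _; apply: ler_sum => k _.
  by rewrite normrM ler_wpM2r// field_le// e0 e1.
- apply: cvg_sumR => k; apply: cvgM; last exact: cvg_cst.
  by rewrite flux_barrier; exact: cvg_field.
rewrite rVintD//.
set A := rVint _ in ge *; set B := rVint _.
have cT : A + rVint (Fk n) @[n --> \oo] --> A + B.
  by apply: cvgD; [exact: cvg_cst|exact: cF].
exact: (cvgr_to_ge cT (nearW _ ge)).
Qed.

End barrier.

(** * Comparison with the barrier *)

Section nonexistence.
Context {R : realType}.

(** Used for the cutoff and its opposite, it gives a zero derivative also at the ends of the flat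
    pieces, where the function is constant on one side only. *)
Lemma derive_at_min (f df : R -> R) (c : R) :
  (forall x : R, is_derive x 1 f (df x)) -> (forall x, f c <= f x) -> df c = 0.
Proof.
move=> dfE fc; have c1 : c - 1 <= c + 1 by lra.
have cI : c \in `]c - 1, c + 1[ by rewrite in_itv/=; apply/andP; split; lra.
have [_ <-] := dfE c.
have D t : t \in `]c - 1, c + 1[ -> derivable f t 1 by move=> _; have [] := dfE t.
by have [_ ->] := derive1_at_min c1 D cI (fun t _ => fc t).
Qed.

Lemma cutoff (x2 T : R) : x2 < T -> exists chi dchi : R -> R,
  [/\ forall x : R, is_derive x 1 chi (dchi x), continuous dchi, forall x, 0 <= chi x,
      forall x, x <= x2 -> chi x = 1 /\ dchi x = 0 &
      forall x, T <= x -> chi x = 0 /\ dchi x = 0].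
Proof.
move=> x2T; have [S [P [CSP _ ndS S0 S1]]] := @smooth_step R.
have D0 : 0 < T - x2 by rewrite subr_gt0.
have C1 : Ck 1 (fun x => 1 + (- 1) * S ((T - x2)^-1 * x + - ((T - x2)^-1 * x2))).
  apply: CkD; first exact: Ck_cst.
  by apply: CkM; [exact: Ck_cst|apply: Ck_affine; have [] := CSP 1%N].
have [dchi dchiE cd] := C1.
set chi := (fun x => 1 + _) in dchiE.
have argE x : (T - x2)^-1 * x + - ((T - x2)^-1 * x2) = (x - x2) / (T - x2).
  by rewrite -mulrBr mulrC.
have chiE x : chi x = 1 - S ((x - x2) / (T - x2)) by rewrite /chi argE mulN1r.
have Sge x : 0 <= S x.
  have [x0|x0] := leP x 0; first by have [-> _] := S0 x x0.
  by have [<- _] := S0 0 (lexx 0); exact/ndS/ltW.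
have Sle x : S x <= 1.
  have [x1|x1] := leP 1 x; first by rewrite S1.
  by rewrite -(S1 1 (lexx 1)); exact/ndS/ltW.
have chi0 x : 0 <= chi x by rewrite chiE subr_ge0.
exists chi, dchi; split => // x.
  move=> xx2; have E : chi x = 1.
    have le0 : (x - x2) / (T - x2) <= 0 by rewrite pmulr_lle0 ?invr_gt0// subr_le0.
    by have [S00 _] := S0 _ le0; rewrite chiE S00 subr0.
  split=> //; apply/eqP; rewrite -oppr_eq0; apply/eqP.
  apply: (@derive_at_min (fun y => - chi y) (fun y => - dchi y) x) => y.
  by rewrite lerN2 E chiE gerBl.
move=> xT; have E : chi x = 0.
  rewrite chiE S1 ?subrr// ler_pdivlMr// mul1r lerD2r//.
split=> //; apply: (@derive_at_min chi dchi x) => // y.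
by rewrite E.
Qed.

(** [B] is the scale at which the divergence bound equals sigma, and larger L only decrease it. The
    bound A < L will put the point q0 in the core of the barrier. *)
Lemma barrier_scale (m : nat) (p T sigma A : R) : 1 < p -> 0 < T -> 0 < sigma ->
  exists L, [/\ 1 <= L, A < L & @barrier_const R m p T * L `^ (- (p / 4)) <= sigma].
Proof.
move=> p1 T0 s0; set C := barrier_const p T.
have C0 : 0 <= C by exact: barrier_const_ge0.
have p0 : 0 < p / 4 by rewrite divr_gt0// (lt_trans ltr01).
pose B := (C / sigma) `^ (p / 4)^-1.
pose L := Num.max (Num.max 1 B) (A + 1).
have L1 : 1 <= L by rewrite !le_max lexx.
have LB : B <= L by rewrite !le_max lexx orbT.
have L0 : 0 < L by exact: lt_le_trans L1.
exists L; split => //; first by rewrite lt_max ltrDl ltr01 orbT.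
rewrite powRN ler_pdivrMr ?powR_gt0// mulrC -ler_pdivrMr//.
have -> : C / sigma = B `^ (p / 4).
  by rewrite /B -powRrM mulVf ?gt_eqF// powRr1// divr_ge0// ltW.
by apply: ge0_ler_powR; rewrite ?nnegrE ?powR_ge0 ?(ltW p0) ?(ltW L0).
Qed.

Lemma gauge_in_cube m (q : heis R m) Y : 1 <= Y -> gauge q <= Y -> in_cube (1 + Y) q.
Proof.
move=> Y1 gY.
(* Valid since Y <= Y^2. It is used once for |z|^4 <= Y and then again for each coordinate. *)
have sq x : x ^+ 2 <= Y -> `|x| <= Y.
  move=> xY; have [//|Yx] := leP `|x| Y.
  have : Y ^+ 2 < `|x| ^+ 2 by rewrite ltrXn2r// ?nnegrE// (le_trans ler01).
  rewrite real_normK ?num_real// => Yx2.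
  have : Y <= Y ^+ 2 by rewrite expr2 -[leLHS]mulr1 ler_pM2l// (lt_le_trans ltr01).
  by move: xY Yx2; lra.
have zY : zsq q <= Y.
  rewrite -[leLHS]ger0_norm ?zsq_ge0//; apply: sq; apply: le_trans gY.
  by rewrite lerDl sqr_ge0.
move=> i; apply: (@le_trans _ _ Y); last by rewrite lerDr.
apply: sq; rewrite -(splitK i); case: (fintype.split i) => j /=.
  apply: le_trans zY; rewrite /zsq (bigD1 j)//= lerDl.
  by apply: sumr_ge0 => k _; exact: sqr_ge0.
by apply: le_trans gY; rewrite (ord1 j) -[X in X <= _]add0r lerD ?sqr_ge0.
Qed.

Variables (m : nat) (p : R) (f h g : R -> R).
Hypotheses (p_gt1 : 1 < p)
  (f_cont : {within `[0, +oo[, continuous f})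
  (f_incr : {in `[0, +oo[ &, {homo f : s t / s < t}})
  (f_pos : forall t : R, 0 < t -> 0 < f t)
  (h_cont : {within `]0, +oo[, continuous h})
  (h_ge0 : forall t : R, 0 < t -> 0 <= h t)
  (h_L1 : lebesgue_measure.-integrable `]0, +oo[ (EFin \o h))
  (g_cont : {within `[0, +oo[, continuous g})
  (g_bound : exists2 D : R, 0 < D &
    forall s t : R, 0 <= s <= 1 -> 0 < t ->
      g (s * t) <= D * s * t ^+ 2 * derive1 (phi p) t).

Lemma nonexistence (u : heis R m -> R) (q0 : heis R m) :
  (forall q, 0 <= u q) -> weak_solution p f h g u -> 0 < u q0 ->
  ~ L1_at_pinfty (fun t => (KO_Kinv p (primitive0 f t))^-1).
Proof.
move=> u_ge0 u_sol uq0 KO.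
pose a := u q0 / 2; have a0 : 0 < a by rewrite divr_gt0.
have [psi [sigma [s0 Cpsi [psia psi_le] mpsi sub]]] :=
  gradient_term_removal p_gt1 f_cont f_incr f_pos h_cont h_ge0 h_L1 g_cont g_bound
    u_ge0 u_sol a0.
have Cu : class_C 1 u by case: u_sol.
have cf : continuous (fun s : R => f (Num.max s 0)).
  by apply: continuous_truncation f_cont => s; rewrite /= in_itv/= andbT.
have [F [F0 dF]] := continuous_primitive cf.
have [T T0 profile] := fast_profile p_gt1 f_cont f_incr f_pos F0 dF a0 KO.
have [L [L1 q0L LC]] := barrier_scale m (gauge q0) p_gt1 T0 s0.
have L0 : 0 < L by exact: lt_le_trans L1.
pose v q := psi (u q); have Cv : class_C 1 v by exact: class_C_comp.
pose Y := L * (1 + T).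
(* The bound [gauge q <= Y] says exactly that [gradius L q <= T]. *)
have Y1 : 1 <= Y by rewrite /Y -[leLHS]mulr1 ler_pM// lerDl ltW.
have [_ /(_ (1 + Y))[C vC]] := continuous_locally_bounded (class_C_continuous Cv).
have [b [alpha [G [[cG iG G0 Gf] [b0 al0] al_ge [x2 /andP[x20 x2T] Cx2] [db dal]]]]] := profile C.
pose w := @barrier_fun R m L alpha.
have Cw : class_C 1 w by exact: (class_C_barrier p_gt1 L b0 db dal).
have [chi [dchi [dchiE cdchi chi0 chi1 chiT]]] := cutoff x2T.
pose pos (s : R) : R := Num.max s 0.
have dsq x : is_derive x (1 : R) (fun s : R => s ^+ 2) (2 * x).
  by apply: is_derive_eq (isd_exp 2 (is_derive_id x 1)) _; rewrite expr1 mulr1.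
have cdsq : continuous (fun s : R => 2 * s) by move=> x; apply: cvgMl_tmp; exact: cvg_id.
have dpos2 := derive_pos_part dsq cdsq (mulr0 2).
have Cpos2 := Ck1_pos_part dsq cdsq (mulr0 2).
pose d q := v q + (- 1) * w q.
have dE q : d q = v q - w q by rewrite /d mulN1r.
have Cd : class_C 1 d.
  by apply: class_CD => //; apply: class_CM => //; exact: class_C_cst.
(* The cutoff extends the test function by 0 beyond radius T. It is constant up to x2, and between
   x2 and T the positive part already vanishes. *)
pose eta q := pos (d q) ^+ 2 * chi (gradius L q).
have Cchi : class_C 1 (fun q : heis R m => chi (gradius L q)).
  by apply: class_C_comp; [exists dchi|exact: class_C_radius].
have Ceta : class_C 1 eta by apply: class_CM => //; exact: class_C_comp Cpos2 Cd.
have eta0 q : 0 <= eta q by rewrite mulr_ge0 ?sqr_ge0.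
have w_ge q : a <= w q by exact: al_ge.
have far q : x2 <= gradius L q -> gradius L q <= T -> v q < w q.
  move=> x2r rT; apply: (@le_lt_trans _ _ C).
    apply: le_trans (ler_norm _) _; apply: vC; apply: gauge_in_cube => //.
    by move: rT; rewrite /gradius lerBlDr ler_pdivrMr// mulrC addrC.
  apply: lt_le_trans Cx2 _; apply: (profile_ndecr G0 b0 db dal (ltW x20)).
  by rewrite le_max x2r.
have etaN0 q : eta q != 0 -> gradius L q < T /\ w q < v q.
  rewrite mulf_eq0 negb_or => /andP[P0 c0]; split.
    by rewrite ltNge; apply: contra c0 => /chiT[->].
  rewrite -subr_gt0 -dE ltNge; apply: contra P0 => d0.
  by rewrite /pos (max_idPr d0) expr0n.
have seta : cube_supported (1 + Y) eta.
  move=> q qY; apply/eqP/negPn/negP => /etaN0[rT _]; apply: qY.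
  apply: gauge_in_cube => //.
  by move: (ltW rT); rewrite /gradius lerBlDr ler_pdivrMr// mulrC addrC.
have Y0 : 0 <= 1 + Y by rewrite addr_ge0// (le_trans ler01).
have eta_u q : eta q != 0 -> a <= u q.
  by move=> /etaN0[_ wv]; rewrite -mpsi psia (le_trans (w_ge q))// ltW.
have [dv _] := Cv; have [dw _] := Cw; have [de _] := Ceta.
have heta k q : hZ k eta q = 2 * pos (d q) * chi (gradius L q) * (hZ k v q - hZ k w q).
  apply: hZE => //.
  have Dd : is_derive q (hvec k q) d (hZ k v q - hZ k w q).
    apply: is_derive_eq (isd_add (hZ_derive k (dv q)) (isd_scale (- 1) (hZ_derive k (dw q)))) _.
    by rewrite mulN1r.
  have Dpos : is_derive q (hvec k q) (fun q => pos (d q) ^+ 2)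
      (2 * pos (d q) * (hZ k v q - hZ k w q)).
    exact: (isd_comp (f := d) (dpos2 _) Dd).
  have Dchi := isd_comp (f := gradius L) (dchiE _) (isd_radius L k q).
  apply: is_derive_eq (isd_mul Dpos Dchi) _.
  (* The derivative of the cutoff can be nonzero only for x2 < gradius < T, where v < w. *)
  have -> : pos (d q) ^+ 2 * (dchi (gradius L q) * (hgauge k q / L)) = 0.
    have [rx|rx] := leP (gradius L q) x2; first by have [_ ->] := chi1 _ rx; rewrite mul0r mulr0.
    have [rT|rT] := leP T (gradius L q); first by have [_ ->] := chiT _ rT; rewrite mul0r mulr0.
    have dq : d q <= 0 by rewrite dE subr_le0 ltW// far// ltW.
    by rewrite /pos (max_idPr dq) expr0n mul0r.
  by rewrite add0r mulrAC.
have cfv (y : heis R m -> R) : class_C 1 y -> continuous (fun q => f (pos (y q))).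
  by move=> Cy; exact: (@class_C_comp _ _ 0 (fun s : R => f (Num.max s 0)) y cf (class_CW Cy)).
have ieta : integrand eta.
  split; last by exists (1 + Y).
  by apply: continuous_locally_bounded; exact: class_C_continuous Ceta.
(* This gap is nonnegative, continuous and positive at q0, where w = a < v. It will be dominated by
   the difference of the two weak inequalities, which has a nonpositive integral. *)
pose E q := sigma * (f (pos (v q)) + (- 1) * f (pos (w q))) * eta q.
have cE : continuous E.
  apply: (@class_CM _ _ 0); last exact: class_CW.
  apply: (@class_CM _ _ 0); first exact: class_C_cst.
  apply: (@class_CD _ _ 0); first exact: cfv.
  by apply: (@class_CM _ _ 0); [exact: class_C_cst|exact: cfv].
have iE : integrand E.
  split; first exact: continuous_locally_bounded.
  by exists (1 + Y) => q qY; rewrite /E seta ?mulr0.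
have posv q : eta q != 0 -> [/\ pos (v q) = v q, pos (w q) = w q, a <= w q & w q < v q].
  move=> /etaN0[_ wv]; split => //; apply/max_idPl.
    by rewrite (le_trans (ltW a0))// (le_trans (w_ge q))// ltW.
  by rewrite (le_trans (ltW a0)).
have f_lt s t : 0 <= s -> s < t -> f s < f t.
  by move=> s0' st; apply: f_incr => //; rewrite in_itv/= andbT// (le_trans s0')// ltW.
have E0 q : 0 <= E q.
  have [e0|eN0] := eqVneq (eta q) 0; first by rewrite /E e0 mulr0.
  have [pv pw aw wv] := posv q eN0.
  rewrite mulr_ge0// mulr_ge0 ?(ltW s0)// mulN1r subr_ge0 pv pw ltW// f_lt//.
  by rewrite (le_trans (ltW a0)).
have rq0 : gradius L q0 <= 0 by rewrite subr_le0 ler_pdivrMr// mul1r ltW.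
have wq0 : w q0 = a by rewrite /w /barrier_fun /gradius_pos (max_idPr rq0).
have vq0 : a < v q0.
  rewrite -psia /v (leW_mono mpsi) /a ltr_pdivrMr// mulr_natr mulr2n ltrDl//.
have etaq0 : 0 < eta q0.
  have [c1 _] := chi1 _ (le_trans rq0 (ltW x20)).
  rewrite /eta c1 mulr1 exprn_gt0// /pos lt_max dE wq0 subr_gt0 vq0//.
have Eq0 : 0 < E q0.
  have [pv pw aw wv] := posv q0 (lt0r_neq0 etaq0).
  rewrite mulr_gt0// mulr_gt0// mulN1r subr_gt0 pv pw f_lt//.
  by rewrite (le_trans (ltW a0)).
have Epos := rVint_gt0 cE iE E0 Eq0.
have I1 := sub eta (1 + Y) Y0 Ceta eta0 seta eta_u.
have I2 := barrier_supersolution p_gt1 T0 L1 LC cG iG G0 b0 db dal Ceta eta0 seta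
  (fun q e => ltW (proj1 (etaN0 q e))).
have iflux y : class_C 1 y -> integrand (fun q => \sum_k flux p k y q * hZ k eta q).
  move=> Cy; apply: integrand_sum => k; apply: integrandM; first exact: flux_locally_bounded.
  exact: integrand_hZ Ceta seta.
have i1 : integrand (fun q => sigma * f (pos (v q)) * eta q + \sum_k flux p k v q * hZ k eta q).
  apply: integrandD; last exact: iflux.
  apply: integrandM => //; apply: continuous_locally_bounded.
  by apply: (@class_CM _ _ 0); [exact: class_C_cst|exact: cfv].
have i2 : integrand (fun q => sigma * G (w q) * eta q + \sum_k flux p k w q * hZ k eta q).
  apply: integrandD; last exact: iflux.
  apply: integrandM => //; apply: continuous_locally_bounded.
  apply: (@class_CM _ _ 0); first exact: class_C_cst.
  exact: (@class_C_comp _ _ 0 G w cG (class_CW Cw)).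
suff : rVint E <= rVint (fun q => sigma * f (pos (v q)) * eta q + \sum_k flux p k v q * hZ k eta q) -
    rVint (fun q => sigma * G (w q) * eta q + \sum_k flux p k w q * hZ k eta q).
  by move: I1 I2 Epos; rewrite -/w; move: (rVint E) (rVint _) (rVint _) => x y z; lra.
rewrite -rVintB//; apply: le_rVint => // [|q].
  by apply: integrandD => //; exact: integrandN.
(* The gradient part becomes a nonnegative multiple of the pairing in [flux_monotone]; replacing
   [G (w q)] by the larger f(w) then leaves [E]. *)
have -> : sigma * f (pos (v q)) * eta q + \sum_k flux p k v q * hZ k eta q -
  (sigma * G (w q) * eta q + \sum_k flux p k w q * hZ k eta q) =
  sigma * (f (pos (v q)) - G (w q)) * eta q +
  2 * pos (d q) * chi (gradius L q) *
    \sum_k (flux p k v q - flux p k w q) * (hZ k v q - hZ k w q).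
  rewrite opprD addrACA; congr (_ + _); first by ring.
  rewrite mulr_sumr -sumrB; apply: eq_bigr => k _; rewrite heta.
  by move: (flux p k v q) (flux p k w q) (hZ k v q) (hZ k w q) (pos _) (chi _) => *; ring.
apply: (@le_trans _ _ (sigma * (f (pos (v q)) - G (w q)) * eta q)); last first.
  rewrite lerDl mulr_ge0 ?flux_monotone// mulr_ge0// mulr_ge0//.
  by rewrite /pos le_max lexx orbT.
have [e0|eN0] := eqVneq (eta q) 0; first by rewrite /E e0 !mulr0.
have [pv pw aw wv] := posv q eN0.
rewrite /E ler_wpM2r// ler_pM2l// mulN1r lerD2l lerN2 pw.
exact: Gf.
Qed.

End nonexistence.

Theorem theorem6p6 (R : realType) (m : nat) (p : R) (f h g : R -> R)
  (m_ge1 : (1 <= m)%N) (p_gt1 : 1 < p)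
  (f_cont : {within `[0, +oo[, continuous f})
  (f_incr : {in `[0, +oo[ &, {homo f : s t / s < t}})
  (f_pos : forall t : R, 0 < t -> 0 < f t)
  (h_cont : {within `]0, +oo[, continuous h})
  (h_ge0 : forall t : R, 0 < t -> 0 <= h t)
  (h_noninc : {in `]0, +oo[ &, {homo h : s t /~ s <= t}})
  (h_L1 : lebesgue_measure.-integrable `]0, +oo[ (EFin \o h))
  (g_cont : {within `[0, +oo[, continuous g})
  (g_ge0 : forall t : R, 0 <= t -> 0 <= g t)
  (g_bound : exists2 D : R, 0 < D &
    forall s t : R, 0 <= s <= 1 -> 0 < t ->
      g (s * t) <= D * s * t ^+ 2 * derive1 (phi p) t) :
  (exists u : heis R m -> R,
    [/\ forall q, 0 <= u q,
        ~ (exists c : R, forall q, u q = c)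
      & weak_solution p f h g u])
  <->
  ~ L1_at_pinfty (fun t => (KO_Kinv p (primitive0 f t))^-1).
Proof.
split=> [[u [u_ge0 u_ncst u_sol]]|]; last first.
  exact: existence m_ge1 p_gt1 f_cont f_incr f_pos h_cont h_ge0 g_cont g_ge0.
have [q0 uq0] : exists q0, 0 < u q0.
  apply: contrapT => u0; apply: u_ncst; exists 0 => q.
  by apply/eqP; rewrite eq_le u_ge0 andbT leNgt; apply/negP => uq; apply: u0; exists q.
exact (nonexistence p_gt1 f_cont f_incr f_pos h_cont h_ge0 h_L1 g_cont g_bound
  u_ge0 u_sol uq0).
Qed.
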